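(* Let $g\in L^2(\mathbb{R})$ and let $\Lambda=A\mathbb{Z}^2$ with $A\in\mathrm{GL}(2,\mathbb{Q})$, $\det A=1$, be such that the Gabor system $\{e^{2\pi i a x}g(x-b) : (a,b)\in\Lambda\}$ is a Riesz basis of $L^2(\mathbb{R})$. Then $Zg\notin\mathrm{VMO}_{\rm loc}(\mathbb{R}^2)$.
   Context: Zak transform: for $f\in L^1(\mathbb{R})\cap L^2(\mathbb{R})$, $Zf(x,\omega)=\sum_{k\in\mathbb{Z}}f(x+k)e^{-2\pi i k\omega}$ for a.e. $(x,\omega)\in\mathbb{R}^2$. The map $f\mapsto Zf|_{[0,1]^2}$ extends continuously to a unitary map from $L^2(\mathbb{R})$ onto $L^2([0,1]^2)$; for $f\in L^2(\mathbb{R})$, $Zf\in L^2_{\rm loc}(\mathbb{R}^2)$ denotes the quasi-periodic extension of $Zf|_{[0,1]^2}$ to $\mathbb{R}^2$, i.e. $Zf(x+m,\omega+n)=e^{2\pi i m\omega}Zf(x,\omega)$ for $m,n\in\mathbb{Z}$ and a.e. $(x,\omega)$. VMO: a cube in $\mathbb{R}^n$ of side length $\delta>0$ is a set $I_1\times\dots\times I_n$ where each $I_i\subset\mathbb{R}$ is a closed interval of length $\delta$. For $F\in L^1_{\rm loc}(\mathbb{R}^n)$ and a bounded measurable set $\Delta\subset\mathbb{R}^n$ with $|\Delta|>0$, put $F_\Delta=\frac1{|\Delta|}\int_\Delta F\,dx$ and $M_\Delta(F)=\frac1{|\Delta|}\int_\Delta|F-F_\Delta|\,dx$. For a bounded open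 set $U\subset\mathbb{R}^n$ and $\varepsilon>0$, put $S_{\varepsilon,U}(F)=\sup\{M_Q(F): Q\subset U\text{ a cube},\ |Q|<\varepsilon\}$. $F\in\mathrm{BMO}(U)$ means $\sup_{Q\subset U}M_Q(F)<\infty$ (supremum over all cubes contained in $U$); $F\in\mathrm{VMO}(U)$ means $F\in\mathrm{BMO}(U)$ and $\lim_{\varepsilon\to0}S_{\varepsilon,U}(F)=0$; $F\in\mathrm{VMO}_{\rm loc}(\mathbb{R}^n)$ means $F\in\mathrm{VMO}(U)$ for every bounded open $U\subset\mathbb{R}^n$. *)

(* Defs.v *)
From HB Require Import structures.
From mathcomp Require Import all_boot all_order all_algebra.
From mathcomp Require Import complex.
From mathcomp Require Import all_classical all_reals all_analysis.

Set Implicit Arguments.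
Unset Strict Implicit.
Unset Printing Implicit Defensive.

Import Order.TTheory GRing.Theory Num.Theory.
Import numFieldNormedType.Exports.
Import Normc.

Local Open Scope classical_set_scope.
Local Open Scope ring_scope.

(** Complex-valued functions are maps into [R[i]]; [normc] is the modulus with
    values in [R].  Elements of L^1, L^2, ... are represented by Borel functions,
    equality being almost everywhere equality. *)

Section ComplexIntegration.
Context {d : measure_display} {T : measurableType d} {R : realType}.
Variable mu : {measure set T -> \bar R}.
Implicit Types (D : set T) (p : nat) (f : T -> R[i]).

Definition cmeasurable D f : Prop :=
  measurable_fun D (fun x => complex.Re (f x)) /\
  measurable_fun D (fun x => complex.Im (f x)).

Definition int_normc D p f : \bar R :=
  (\int[mu]_(x in D) (normc (f x) ^+ p)%:E)%E.

Definition in_Lp D p f : Prop :=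
  cmeasurable D f /\ (int_normc D p f < +oo)%E.

Definition cintegral D f : R[i] :=
  Complex (Rintegral mu D (fun x => complex.Re (f x)))
          (Rintegral mu D (fun x => complex.Im (f x))).

End ComplexIntegration.

Section Definitions.
Variable R : realType.

Local Notation mu1 := (@lebesgue_measure R).
Local Notation mu2 := (@lebesgue_measure R \x @lebesgue_measure R)%E.

Definition e2pi (t : R) : R[i] :=
  Complex (cos (2 * pi * t)) (sin (2 * pi * t)).

(** * Riesz bases of L^2(R) *)

Definition lincomb (I : Type) (phi : I -> R -> R[i]) (c : I -> R[i])
  (s : seq I) (x : R) : R[i] := \sum_(l <- s) c l * phi l x.

(** The family [phi], indexed by the elements of [L], is complete in L^2(R) and
    equivalent, on finite linear combinations, to an orthonormal family. *)
Definition riesz_basis (I : eqType) (L : set I) (phi : I -> R -> R[i]) : Prop :=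
  [/\ forall l, L l -> in_Lp mu1 setT 2 (phi l),
      forall f : R -> R[i], in_Lp mu1 setT 2 f -> forall eps : R, 0 < eps ->
        exists (s : seq I) (c : I -> R[i]),
          (forall l, l \in s -> L l) /\
          (int_normc mu1 setT 2 (fun x => (f x - lincomb phi c s x)%R) < eps%:E)%E
    & exists a b : R, [/\ 0 < a, 0 < b &
        forall (s : seq I) (c : I -> R[i]), uniq s ->
          (forall l, l \in s -> L l) ->
          ((a * \sum_(l <- s) normc (c l) ^+ 2)%R%:E
             <= int_normc mu1 setT 2 (lincomb phi c s)
             <= (b * \sum_(l <- s) normc (c l) ^+ 2)%R%:E)%E]].

(** * Gabor systems *)

Definition lattice (A : 'M[rat]_2) : set (R * R) :=
  [set ab | exists z : 'cV[int]_2,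
     let v : 'cV[R]_2 := map_mx ratr A *m map_mx intr z in
     ab = (v 0 0, v 1 0)].

Definition gabor (g : R -> R[i]) (ab : R * R) (x : R) : R[i] :=
  e2pi (ab.1 * x) * g (x - ab.2).

(** * The Zak transform *)

(** The partial sum over the integers [k] with [- N <= k <= N]. *)
Definition zak_partial (f : R -> R[i]) (z : R * R) (N : nat) : R[i] :=
  \sum_(0 <= i < N.*2.+1)
    let k : R := i%:R - N%:R in f (z.1 + k) * e2pi (- (k * z.2)).

(** For integrable [f] the series converges absolutely for almost every [z]. *)
Definition zak_series (f : R -> R[i]) (z : R * R) : R[i] :=
  Complex (limn (fun N => complex.Re (zak_partial f z N)))
          (limn (fun N => complex.Im (zak_partial f z N))).

Definition unit_square : set (R * R) := `[0, 1] `*` `[0, 1].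

(** [F] is (a representative of) the Zak transform of [g] in L^2(R): on the unit
    square it is the L^2-limit of the series [zak_series f], as [f] in the dense
    subspace of L^1 and L^2 functions tends to [g] in L^2(R), and [F] is extended
    to the plane by quasi-periodicity. *)
Definition is_zak (g : R -> R[i]) (F : R * R -> R[i]) : Prop :=
  [/\ @cmeasurable _ (measurableTypeR R * measurableTypeR R)%type R setT F,
      in_Lp mu2 unit_square 2 F,
      forall eps : R, 0 < eps -> exists2 delta : R, 0 < delta &
        forall f : R -> R[i], in_Lp mu1 setT 1 f -> in_Lp mu1 setT 2 f ->
          (int_normc mu1 setT 2 (fun x => (f x - g x)%R) < delta%:E)%E ->
          (int_normc mu2 unit_square 2 (fun z => (zak_series f z - F z)%R)
             < eps%:E)%E
    & forall m n : int, {ae mu2, forall z : R * R,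
        F (z.1 + m%:~R, z.2 + n%:~R) = e2pi (m%:~R * z.2) * F z}].

(** * Vanishing mean oscillation *)

Definition L1loc (F : R * R -> R[i]) : Prop :=
  forall K : set (R * R), compact K -> in_Lp mu2 K 1 F.

Definition is_cube (Q : set (R * R)) : Prop :=
  exists a b delta : R, 0 < delta /\ Q = `[a, a + delta] `*` `[b, b + delta].

Definition mean (D : set (R * R)) (F : R * R -> R[i]) : R[i] :=
  real_complex R (fine (mu2 D))^-1 * cintegral mu2 D F.

Definition mean_osc (D : set (R * R)) (F : R * R -> R[i]) : \bar R :=
  (((fine (mu2 D))^-1)%:E * int_normc mu2 D 1 (fun z => (F z - mean D F)%R))%E.

(** These are suprema in [0, +oo]: adjoining [0] only matters for empty [U],
    where the supremum over no cube would otherwise be [-oo]. *)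
Definition osc_small (eps : R) (U : set (R * R)) (F : R * R -> R[i]) : \bar R :=
  ereal_sup (0%E |` [set mean_osc Q F | Q in
    [set Q | [/\ is_cube Q, Q `<=` U & (mu2 Q < eps%:E)%E]]]).

Definition BMO (U : set (R * R)) (F : R * R -> R[i]) : Prop :=
  (ereal_sup (0%E |` [set mean_osc Q F | Q in
    [set Q | is_cube Q /\ Q `<=` U]]) < +oo)%E.

Definition VMO (U : set (R * R)) (F : R * R -> R[i]) : Prop :=
  BMO U F /\ osc_small eps U F @[eps --> 0^'+] --> 0%E.

Definition VMOloc (F : R * R -> R[i]) : Prop :=
  L1loc F /\
  forall U : set (R * R), open U -> bounded_set U -> VMO U F.

End Definitions.

(* Main.v *)
Require Import Defs.
From HB Require Import structures.
From mathcomp Require Import all_boot all_order all_algebra.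
From mathcomp Require Import perm complex.
From mathcomp Require Import all_classical all_reals all_analysis.
From mathcomp Require Import measurable_realfun.
From mathcomp Require Import ring lra zify.

Set Implicit Arguments.
Unset Strict Implicit.
Unset Printing Implicit Defensive.

Import Order.TTheory GRing.Theory Num.Theory.
Import numFieldNormedType.Exports.
Import Normc.

Local Open Scope classical_set_scope.
Local Open Scope ring_scope.

(** Why the oscillation cannot vanish.  Let [q] be a common denominator of the entries of
    [A].  The lattice contains [q Z^2], with index [q ^ 2] since [det A = 1].  Let [F] be
    the Zak transform, made quasi-periodic at every point, and let [M(x, y)] be the matrix
    with one row for each of the [q ^ 2] classes of the lattice modulo [q Z^2], one column
    for each of the [q ^ 2] points congruent to [(x, y)] modulo [(1 / q) Z^2] in a unit
    square, and the values of the shifted functions [zshift l F] as entries.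

    On the Zak side, the time-frequency shifts by [q Z^2] act as multiplication by the
    characters of period [1 / q].  The lower Riesz inequality therefore bounds [M] from
    below in the mean against every squared trigonometric polynomial of period [1 / q]
    ([zak_lower], [trig_lower]).  These polynomials being dense for a suitable weight
    ([approximable_indic]), [M] is bounded from below at almost every point
    ([fibre_lower_ae]).  The square shape of [M] then makes its determinant bounded away
    from 0.

    By quasi-periodicity, [M(x, y + 1) = M(x, y)], and [M(x + 1, y)] is [M(x, y)] times a
    diagonal matrix of determinant [u * e2pi (q ^ 2 * y)].  If [F] were continuous, the loop
    [y |-> det M(x, y)], for [y] in a period, would have a winding number independent of
    [x], whereas it would increase by [q ^ 2] from [x] to [x + 1].

    Vanishing mean oscillation replaces continuity, as it does in degree theory.  The
    values of [F] are replaced by averages over cubes of side [d = 1 / N].  For small [d]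
    the averages deviate little in mean from the values, so the matrix of averages
    inherits the lower bound ([zmx_rows_expand]); averages over neighbouring cubes of the
    grid of step [d] are close, and quasi-periodicity persists up to a small error
    ([good_averages_small]).  A matrix that is bounded from below has a determinant whose
    relative variation is small under small changes of the entries
    ([rows_expand_det_close]).  So the determinants on the grid of step [d] form a discrete
    zero-free map of the square whose columns change by a small factor from one to the
    next, and still gain [q ^ 2] turns in total, which [no_twisted_grid] excludes. *)

(** * The modulus of complex numbers *)

Section ComplexModulus.
Context {R : realType}.
Implicit Types (z w : R[i]) (t : R).

Lemma normc_ge0 z : 0 <= normc z.
Proof. by case: z => a b; exact: sqrtr_ge0. Qed.

Lemma normc_eq0 z : (normc z == 0) = (z == 0).
Proof. by apply/eqP/eqP => [/eq0_normc //|->]; exact: normc0. Qed.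

Lemma sqr_normcE z : normc z ^+ 2 = complex.Re z ^+ 2 + complex.Im z ^+ 2.
Proof. by case: z => a b /=; rewrite sqr_sqrtr// addr_ge0 ?sqr_ge0. Qed.

Lemma normc_distC z w : normc (z - w) = normc (w - z).
Proof. by rewrite -normcN opprB. Qed.

Lemma normc_sub_le (u z w : R[i]) : normc (z - w) <= normc (z - u) + normc (u - w).
Proof. by rewrite -[z - w](_ : (z - u) + (u - w) = _) ?le_normcD// addrA subrK. Qed.

Lemma normc_subr_le z w : normc z - normc w <= normc (z - w).
Proof. by rewrite lerBlDr -{1}(subrK w z) le_normcD. Qed.

Lemma normc_sum (I : Type) (s : seq I) (P : pred I) (F : I -> R[i]) :
  normc (\sum_(i <- s | P i) F i) <= \sum_(i <- s | P i) normc (F i).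
Proof.
elim/big_rec2: _ => [|i x y _ h]; first by rewrite normc0.
exact: le_trans (le_normcD _ _) (lerD (lexx _) h).
Qed.

Lemma normc_real t : normc (Complex t 0) = `|t|.
Proof. by rewrite /= expr0n addr0 sqrtr_sqr. Qed.

Lemma Re_le_normc z : `|complex.Re z| <= normc z.
Proof.
case: z => a b /=; rewrite -sqrtr_sqr ler_wsqrtr// lerDl sqr_ge0 //.
Qed.

Lemma Im_le_normc z : `|complex.Im z| <= normc z.
Proof.
case: z => a b /=; rewrite -sqrtr_sqr ler_wsqrtr// lerDr sqr_ge0 //.
Qed.

Lemma normc_le_ReIm z : normc z <= `|complex.Re z| + `|complex.Im z|.
Proof.
case: z => a b /=; rewrite -[leRHS]ger0_norm ?addr_ge0// -sqrtr_sqr ler_wsqrtr//.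
rewrite sqrrD !real_normK ?num_real// -addrA lerD2l lerDr mulrn_wge0 ?mulr_ge0//.
Qed.

Lemma sqr_normcD_le z w : normc (z + w) ^+ 2 <= 2 * normc z ^+ 2 + 2 * normc w ^+ 2.
Proof.
have h := le_normcD z w; have := normc_ge0 z; have := normc_ge0 w.
have := normc_ge0 (z + w) => *; have := sqr_ge0 (normc z - normc w); nra.
Qed.

(** Cauchy-Schwarz against the constant vector. *)
Lemma sqr_sum_le (I : Type) (s : seq I) (f : I -> R) :
  (\sum_(i <- s) f i) ^+ 2 <= (size s)%:R * \sum_(i <- s) f i ^+ 2.
Proof.
elim: s => [|i s IH]; first by rewrite !big_nil expr0n mulr0.
rewrite !big_cons /= -natr1.
set S := \sum_(_ <- _) f _ in IH *; set Q := \sum_(_ <- _) _ in IH *.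
set n : R := (size s)%:R in IH *.
have n0 : 0 <= n by rewrite ler0n.
have Q0 : 0 <= Q by apply: sumr_ge0 => j _; exact: sqr_ge0.
have h : 2 * f i * S <= n * f i ^+ 2 + Q.
  rewrite /S /Q /n -sum1_size natr_sum mulr_suml -big_split mulr_sumr /=.
  apply: ler_sum => j _; have := sqr_ge0 (f i - f j); nra.
nra.
Qed.

Lemma sqr_normc_sum_le (I : Type) (s : seq I) (f : I -> R[i]) :
  normc (\sum_(i <- s) f i) ^+ 2 <= (size s)%:R * \sum_(i <- s) normc (f i) ^+ 2.
Proof.
apply: le_trans (sqr_sum_le _ _).
rewrite lerXn2r// ?nnegrE ?normc_ge0// ?normc_sum//.
by apply: sumr_ge0 => *; exact: normc_ge0.
Qed.

End ComplexModulus.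

(** * Winding numbers of discrete loops *)

Section UnitCircle.
Context {R : realType}.
Implicit Types (s t : R).

Lemma e2piD s t : e2pi (s + t) = e2pi s * e2pi t.
Proof.
rewrite /e2pi mulrDr cosD sinD; apply/eqP; rewrite eq_complex /= eqxx /=.
by rewrite [X in _ == X]addrC.
Qed.

Lemma e2pi0 : e2pi (0 : R) = 1.
Proof. by rewrite /e2pi mulr0 cos0 sin0. Qed.

Lemma e2piNM t : e2pi (- t) * e2pi t = 1.
Proof. by rewrite -e2piD addNr e2pi0. Qed.

Lemma e2pi1 : e2pi (1 : R) = 1.
Proof. by rewrite /e2pi mulr1 mulr_natl cos2pi sin2pi. Qed.

Lemma e2pi_nat n : e2pi (n%:R : R) = 1.
Proof. by elim: n => [|n IH]; [exact: e2pi0|rewrite -natr1 e2piD IH e2pi1 mulr1]. Qed.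

Lemma e2pi_int (m : int) : e2pi (m%:~R : R) = 1.
Proof.
case: m => n; first exact: e2pi_nat.
by rewrite NegzE mulrNz; have := e2piNM n.+1%:R; rewrite -pmulrn e2pi_nat mulr1.
Qed.

Lemma normc_e2pi t : normc (e2pi t) = 1.
Proof. by rewrite /e2pi /= cos2Dsin2 sqrtr1. Qed.

Lemma e2pi_neq0 t : e2pi t != 0.
Proof. by rewrite -normc_eq0 normc_e2pi oner_eq0. Qed.

Lemma e2piN t : e2pi (- t) = (e2pi t)^-1.
Proof. by apply: (mulIf (e2pi_neq0 t)); rewrite e2piNM mulVf ?e2pi_neq0. Qed.

Lemma e2piB s t : e2pi (s - t) = e2pi s / e2pi t.
Proof. by rewrite e2piD e2piN. Qed.

Lemma conjc_e2pi t : (e2pi t)^*%C = e2pi (- t).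
Proof. by rewrite /e2pi mulrN cosN sinN. Qed.

Lemma e2pi_sum (I : Type) (r : seq I) (P : pred I) (f : I -> R) :
  e2pi (\sum_(i <- r | P i) f i) = \prod_(i <- r | P i) e2pi (f i).
Proof. by elim/big_rec2: _ => [|i x y _ <-]; [exact: e2pi0|exact: e2piD]. Qed.

Lemma e2piMn t n : e2pi (n%:R * t) = e2pi t ^+ n.
Proof.
elim: n => [|n IH]; first by rewrite mul0r e2pi0.
by rewrite -natr1 mulrDl mul1r e2piD IH exprSr.
Qed.

Lemma cos_lip s t : `|cos s - cos t| <= `|s - t|.
Proof.
wlog st : s t / s < t => [hw|].
  have [/hw//|/hw|->] := ltgtP s t; last by rewrite !subrr.
  by rewrite distrC [leRHS]distrC.
have [|c _ E] := @MVT_segment R (@cos R) (-%R \o sin) s t (ltW st).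
  by apply: continuous_subspaceT; exact: continuous_cos.
rewrite distrC E /= normrM [leRHS]distrC -[leRHS]mul1r.
by rewrite ler_wpM2r// normrN sin_max.
Qed.

Lemma sin_lip s t : `|sin s - sin t| <= `|s - t|.
Proof.
by rewrite -!cosBpihalf (le_trans (cos_lip _ _))// opprB addrA subrK.
Qed.

Lemma e2pi_lip s t : normc (e2pi s - e2pi t) <= 4 * pi * `|s - t|.
Proof.
apply: le_trans (normc_le_ReIm _) _ => /=.
have -> : 4 * pi * `|s - t| = `|2 * pi * s - 2 * pi * t| + `|2 * pi * s - 2 * pi * t|.
  by rewrite -mulrBr !normrM (ger0_norm (pi_ge0 R)) ger0_norm//; ring.
by rewrite lerD ?cos_lip ?sin_lip.
Qed.

(** By the formula for double angles, [cos (2 s) = 1] forces [sin s = 0], and the sine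
    has no zero in ]0, pi[. *)
Lemma e2pi_eq1 t : `|t| < 1 -> e2pi t = 1 -> t = 0.
Proof.
move=> t1 E; apply/eqP; rewrite -normr_eq0; apply/negP => /negP t0.
have tgt : 0 < `|t| by rewrite lt_neqAle eq_sym t0 normr_ge0.
have C : cos (2 * pi * `|t|) = 1.
  have -> : cos (2 * pi * `|t|) = cos (2 * pi * t).
    rewrite -[RHS]cos_norm normrM ger0_norm// mulr_ge0// pi_ge0 //.
  by case: E.
have : 0 < sin (pi * `|t|).
  by rewrite sin_gt0_pi// mulr_gt0 ?pi_gt0//= gtr_pMr ?pi_gt0.
have C2 : cos (2 * pi * `|t|) = cos (pi * `|t|) ^+ 2 *+ 2 - 1.
  by rewrite -cos_mulr2n; congr (cos _); ring.
rewrite {}C in C2.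
have : sin (pi * `|t|) ^+ 2 = 0 by rewrite sin2cos2; lra.
by move/eqP; rewrite sqrf_eq0 => /eqP ->; rewrite ltxx.
Qed.

(** The angle, in turns, of a number with positive real part. *)
Definition turn (w : R[i]) : R := atan (complex.Im w / complex.Re w) / (2 * pi).

Lemma turnE w : 0 < complex.Re w -> w = Complex (normc w) 0 * e2pi (turn w).
Proof.
case: w => a b /= a0; rewrite /turn /e2pi /=.
have p0 := pi_gt0 R.
have -> : 2 * pi * (atan (b / a) / (2 * pi)) = atan (b / a).
  by rewrite mulrC divfK// gt_eqF// mulr_gt0.
have C := cos_atan (b / a); have T := atanK (b / a).
have D : Num.sqrt (1 + (b / a) ^+ 2) = Num.sqrt (a ^+ 2 + b ^+ 2) / a.
  rewrite -[X in _ = _ / X](gtr0_norm a0) -sqrtr_sqr -sqrtrV ?sqr_ge0// -sqrtrM ?addr_ge0 ?sqr_ge0//.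
  by apply: (f_equal (@Num.sqrt R)); field; rewrite gt_eqF.
have S0 : 0 < Num.sqrt (a ^+ 2 + b ^+ 2).
  by rewrite sqrtr_gt0 ltr_wpDr ?sqr_ge0// exprn_gt0.
rewrite D in C.
have CC : cos (atan (b / a)) = a / Num.sqrt (a ^+ 2 + b ^+ 2) by rewrite C invf_div.
have SS : sin (atan (b / a)) = b / Num.sqrt (a ^+ 2 + b ^+ 2).
  move: T; rewrite /tan CC => T.
  have -> : sin (atan (b / a)) = (sin (atan (b / a)) / (a / Num.sqrt (a ^+ 2 + b ^+ 2))) * (a / Num.sqrt (a ^+ 2 + b ^+ 2)).
    by field; rewrite !gt_eqF.
  by rewrite T; field; rewrite !gt_eqF.
by apply/eqP; rewrite eq_complex /= CC SS !mul0r subr0 addr0; apply/andP; split;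
  apply/eqP; field; rewrite gt_eqF.
Qed.

Lemma near1_Re_gt0 (w : R[i]) : normc (w - 1) <= 2^-1 -> 0 < complex.Re w.
Proof.
case: w => a b h; have := le_trans (Re_le_normc _) h.
by rewrite /= ler_norml => /andP[? ?]; lra.
Qed.

Lemma turn_small (w : R[i]) : normc (w - 1) <= 2^-1 -> `|turn w| <= 8^-1.
Proof.
move=> h; have a0 := near1_Re_gt0 h.
move: (le_trans (Re_le_normc _) h) (le_trans (Im_le_normc _) h) a0.
case: w {h} => a b /=; rewrite subr0.
move=> ha hb a0; have := ha; have := hb; rewrite 2!ler_norml.
move=> /andP[? ?] /andP[? ?].
rewrite /turn /= normrM [X in _ * X]ger0_norm ?invr_ge0 ?mulr_ge0 ?pi_ge0//.
rewrite ler_pdivrMr ?mulr_gt0 ?pi_gt0//.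
have -> : 8^-1 * (2 * pi) = pi / 4 :> R by field.
rewrite -atan1 ler_norml -atanN !le_atan//.
  by rewrite ler_pdivrMr// mul1r; lra.
by rewrite ler_pdivlMr// mulN1r; lra.
Qed.

(** Along a loop [a 0, ..., a N], the total angle swept, in turns. *)
Definition winding (a : nat -> R[i]) (N : nat) : R :=
  \sum_(0 <= j < N) turn (a j.+1 / a j).

(** Closeness in ratio; the constant 1/2 keeps the ratio in the right half plane, with an
    angle of at most an eighth of a turn, so that the identities between angles below,
    which hold modulo 1, hold exactly. *)
Definition close (z w : R[i]) : Prop := normc (z / w - 1) <= 2^-1.

Lemma close_neq0 (z w : R[i]) : close z w -> z != 0 /\ w != 0.
Proof.
move=> /near1_Re_gt0 h; split; apply/eqP => z0; move: h; rewrite z0.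
  by rewrite mul0r ltxx.
by rewrite invr0 mulr0 ltxx.
Qed.

(** The ratio of [b] to the twisted loop stays near 1 and takes the same value at both
    ends, so the increments of its angle telescope to 0; what remains is the angle swept
    by [a], plus [theta] at each step. *)
Lemma winding_twist (a b : nat -> R[i]) (u : R[i]) (theta : R) (N : nat) :
  `|theta| < 4^-1 -> u != 0 ->
  (forall j, (j < N)%N -> close (a j.+1) (a j)) ->
  (forall j, (j < N)%N -> close (b j.+1) (b j)) ->
  (forall j, (j <= N)%N -> close (b j) (u * e2pi (theta * j%:R) * a j)) ->
  b N / (u * e2pi (theta * N%:R) * a N) = b 0%N / (u * a 0%N) ->
  winding b N = winding a N + theta * N%:R.
Proof.
move=> th u0 ha hb hr rN.
pose r j := b j / (u * e2pi (theta * j%:R) * a j).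
have r0 : r N = r 0%N by rewrite /r rN mulr0 e2pi0 mulr1.
suff step j : (j < N)%N ->
    turn (b j.+1 / b j) = turn (a j.+1 / a j) + theta + (turn (r j.+1) - turn (r j)).
  rewrite /winding (eq_big_nat _ _ (F2 := fun j => turn (a j.+1 / a j) + theta + (turn (r j.+1) - turn (r j)))).
    have T := telescope_sumr (turn \o r) (leq0n N); rewrite /= in T.
    by rewrite 2!big_split /= T r0 subrr addr0 sumr_const_nat subn0 mulr_natr.
  by move=> j /andP[_ jN]; exact: step.
move=> jN.
have [bj1 bj] := close_neq0 (hb _ jN); have [aj1 aj] := close_neq0 (ha _ jN).
set A := a j.+1 / a j; set B := b j.+1 / b j.
set t := turn B - turn A - theta - (turn (r j.+1) - turn (r j)).
suff : t = 0 by rewrite /t; lra.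
have hA := ha _ jN; have hB := hb _ jN.
have hr1 := hr _ jN; have hr0 := hr _ (ltnW jN).
have E0 : B * r j = e2pi theta * A * r j.+1.
  rewrite /B /A /r -natr1 mulrDr mulr1 e2piD; field.
  by rewrite u0 !e2pi_neq0 aj bj aj1.
apply: e2pi_eq1.
  have := turn_small hA; have := turn_small hB.
  have := turn_small hr1; have := turn_small hr0.
  rewrite -/(r j) -/(r j.+1) -/A -/B /t.
  move: th; rewrite !ltr_norml.
  move=> /andP[? ?]; do 4 (rewrite {1}ler_norml => /andP[? ?]).
  by apply/andP; split; lra.
have tB := turnE (near1_Re_gt0 hB); have tA := turnE (near1_Re_gt0 hA).
have tr1 := turnE (near1_Re_gt0 hr1); have tr0 := turnE (near1_Re_gt0 hr0).
rewrite -/(r j) -/(r j.+1) -/A -/B in tB tA tr1 tr0.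
have NE : normc B * normc (r j) = normc A * normc (r j.+1).
  by rewrite -!normcM E0 -mulrA (normcM (e2pi theta)) normc_e2pi mul1r.
have B0 : B != 0 by rewrite mulf_neq0 ?invr_eq0.
have A0 : A != 0 by rewrite mulf_neq0 ?invr_eq0.
have r00 : r j != 0 by rewrite !mulf_neq0 ?invr_eq0 ?mulf_neq0 ?e2pi_neq0.
have r10 : r j.+1 != 0 by rewrite !mulf_neq0 ?invr_eq0 ?mulf_neq0 ?e2pi_neq0.
have cM (x y : R) : Complex (x * y) 0 = Complex x 0 * Complex y 0.
  by apply/eqP; rewrite eq_complex /= !mul0r !mulr0 subr0 addr0 !eqxx.
have nz (z : R[i]) : z != 0 -> Complex (normc z) 0 != 0.
  by move=> z0; rewrite -normc_eq0 normc_real normr_eq0 normc_eq0.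
have E1 : e2pi (turn B) * e2pi (turn (r j)) = e2pi theta * e2pi (turn A) * e2pi (turn (r j.+1)).
  apply: (mulfI (nz _ B0)); apply: (mulIf (nz _ r00)).
  transitivity (B * r j); first by rewrite [in RHS]tB [in RHS]tr0; ring.
  rewrite E0 {1}tA {1}tr1.
  transitivity (Complex (normc A * normc (r j.+1)) 0 * (e2pi theta * e2pi (turn A) * e2pi (turn (r j.+1)))).
    by rewrite cM; ring.
  by rewrite -NE cM; ring.
rewrite /t !e2piB.
apply: (mulIf (e2pi_neq0 (turn (r j.+1)))); rewrite mul1r.
transitivity ((e2pi (turn B) * e2pi (turn (r j))) / (e2pi theta * e2pi (turn A))).
  by field; rewrite !e2pi_neq0.
by rewrite E1; field; rewrite !e2pi_neq0.
Qed.

(** The columns are closed loops, and neighbouring columns have the same winding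
    number; the twist by [n] turns between the first and the last column would change
    it by [n]. This is the discrete form of the fact that a continuous map from a square
    to the punctured plane has no winding along the boundary. *)
Lemma no_twisted_grid (d : nat -> nat -> R[i]) (u : R[i]) (n N : nat) :
  (0 < n)%N -> (4 * n < N)%N -> u != 0 ->
  (forall i, (i <= N)%N -> d i N = d i 0%N) ->
  (forall i j, (i <= N)%N -> (j < N)%N -> close (d i j.+1) (d i j)) ->
  (forall i j, (i < N)%N -> (j <= N)%N -> close (d i.+1 j) (d i j)) ->
  (forall j, (j <= N)%N ->
     close (d N j) (u * e2pi (n%:R / N%:R * j%:R) * d 0%N j)) ->
  False.
Proof.
move=> n0 nN u0 per hv hh tw.
have N0 : (0 < N)%N by apply: leq_ltn_trans nN.
have NR : 0 < N%:R :> R by rewrite ltr0n.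
have W i : (i <= N)%N -> winding (d i) N = winding (d 0%N) N.
  elim: i => // i IH iN; rewrite -(IH (ltnW iN)) -[RHS]addr0.
  have := @winding_twist (d i) (d i.+1) 1 0 N.
  rewrite mul0r; apply; rewrite ?normr0 ?oner_eq0 //.
  - by move=> j; apply: hv; exact: ltnW.
  - by move=> j; exact: hv.
  - by move=> j jN; rewrite mul0r e2pi0 !mul1r; exact: hh.
  - by rewrite e2pi0 mulr1 !per// ltnW.
have := @winding_twist (d 0%N) (d N) u (n%:R / N%:R) N.
rewrite W// (divfK (lt0r_neq0 NR)) => H.
suff : winding (d 0%N) N = winding (d 0%N) N + n%:R.
  by move/eqP; rewrite -subr_eq0 opprD addrA subrr sub0r oppr_eq0 pnatr_eq0 gtn_eqF.
apply: H => //.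
- rewrite ger0_norm ?divr_ge0// ltr_pdivrMr//.
  by rewrite mulrC ltr_pdivlMr// -natrM ltr_nat mulnC.
- by move=> j; exact: hv.
- by move=> j; exact: hv.
- by rewrite e2pi_nat mulr1 !per.
Qed.

End UnitCircle.

(** * Determinants of nearby matrices *)

Section DeterminantPerturbation.
Context {R : realType}.

Lemma prod_perturb (I : Type) (s : seq I) (x y : I -> R[i]) (e : R) :
  0 <= e <= 1 -> (forall i, normc (x i) <= 1) -> (forall i, normc (y i) <= e) ->
  normc (\prod_(i <- s) (x i + y i) - \prod_(i <- s) x i)
    <= (2 ^+ size s - 1) * e.
Proof.
move=> /andP[e0 e1] hx hy.
have P' (r : seq I) : normc (\prod_(i <- r) (x i + y i)) <= 2 ^+ size r.
  elim: r => [|i r IH]; first by rewrite big_nil normc1.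
  rewrite big_cons normcM exprS ler_pM ?normc_ge0//.
  apply: le_trans (le_normcD _ _) _.
  by have := hx i; have := hy i; lra.
elim: s => [|i s IH]; first by rewrite !big_nil !subrr normc0 mul0r.
rewrite !big_cons /=; set P := \prod_(j <- s) (x j + y j) in IH *; set Q := \prod_(j <- s) x j in IH *.
have := P' s; rewrite -/P => HP; have -> : (x i + y i) * P - x i * Q = x i * (P - Q) + y i * P by ring.
apply: le_trans (le_normcD _ _) _; rewrite !normcM exprS.
have h1 : normc (x i) * normc (P - Q) <= (2 ^+ size s - 1) * e.
  by rewrite -[leRHS]mul1r ler_pM ?normc_ge0.
have h2 : normc (y i) * normc P <= e * 2 ^+ size s by rewrite ler_pM ?normc_ge0 ?P'.
lra.
Qed.

Lemma det_perturb (n : nat) (X : 'M[R[i]]_n) (e : R) :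
  0 <= e <= 1 -> (forall i j, normc (X i j) <= e) ->
  normc (\det (1%:M + X) - 1) <= n`!%:R * (2 ^+ n * e).
Proof.
move=> /andP[e0 e1] hX.
rewrite -[X in normc (_ - X)](det1 R[i] n) /determinant -sumrB.
apply: le_trans (normc_sum _ _ _) _.
have -> : n`!%:R * (2 ^+ n * e) = \sum_(s : 'S_n) (2 ^+ n * e).
  by rewrite sumr_const card_Sn mulr_natl.
apply: ler_sum => s _.
rewrite -mulrBr normcM.
have -> : normc ((-1 : R[i]) ^+ s) = 1.
  by case: (odd_perm s); rewrite ?expr0 ?expr1 ?normcN normc1.
rewrite mul1r.
have := @prod_perturb _ (index_enum 'I_n) (fun i => (1%:M : 'M[R[i]]_n) i (s i)) (fun i => X i (s i)) e.
rewrite e0 e1 => /(_ isT) H.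
under eq_bigr do rewrite mxE.
apply: le_trans (H _ _) _ => //.
  by move=> i; rewrite mxE; case: (i == s i); rewrite ?normc1 ?normc0.
rewrite ler_wpM2r//.
have -> : size (index_enum 'I_n) = n by rewrite -[RHS]card_ord cardT enumT.
by rewrite lerBlDr lerDl.
Qed.

(** A quantitative form of invertibility: the inverse is bounded by [1 / kappa] for the
    l^1 norm of rows. *)
Definition rows_expand (n : nat) (kappa : R) (M : 'M[R[i]]_n) : Prop :=
  forall v : 'rV[R[i]]_n,
    kappa * \sum_i normc (v 0 i) <= \sum_j normc ((v *m M) 0 j).

Lemma rows_expand_unit n (kappa : R) (M : 'M[R[i]]_n) :
  0 < kappa -> rows_expand kappa M -> M \in unitmx.
Proof.
move=> k0 hM; rewrite -row_free_unit; apply: inj_row_free => v vM.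
have := hM v; rewrite vM [X in _ <= X]big1 => [h|j _]; last by rewrite mxE normc0.
have S0 : \sum_i normc (v 0 i) <= 0 by rewrite -(pmulr_rle0 _ k0).
apply/rowP => i; rewrite mxE; apply: eq0_normc; apply/eqP.
rewrite eq_le normc_ge0 andbT (le_trans _ S0)//.
by rewrite (bigD1 i)//= lerDl; apply: sumr_ge0 => *; exact: normc_ge0.
Qed.

Lemma rows_expand_inv n (kappa : R) (M : 'M[R[i]]_n) i j :
  0 < kappa -> rows_expand kappa M -> normc (invmx M i j) <= kappa^-1.
Proof.
move=> k0 hM; have uM := rows_expand_unit k0 hM.
have := hM (row i (invmx M)); rewrite -row_mul mulVmx//.
have -> : \sum_j0 normc ((row i 1%:M : 'rV[R[i]]_n) 0 j0) = 1.
  rewrite (bigD1 i)//= !mxE eqxx normc1 big1 ?addr0// => k ki.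
  by rewrite !mxE eq_sym (negPf ki) normc0.
rewrite -ler_pdivlMl// mulr1; apply: le_trans.
rewrite (bigD1 j)//= mxE lerDl; apply: sumr_ge0 => *; exact: normc_ge0.
Qed.

(** [M' = M (1 + M^-1 (M' - M))], and [M^-1] is bounded by [1 / kappa]. *)
Lemma rows_expand_det_close (n : nat) (kappa : R) : 0 < kappa ->
  exists2 eta : R, 0 < eta & forall M M' : 'M[R[i]]_n, rows_expand kappa M ->
    (forall i j, normc (M' i j - M i j) <= eta) -> close (\det M') (\det M).
Proof.
move=> k0.
pose c : R := n`!%:R * 2 ^+ n.
have c0 : 0 <= c by rewrite mulr_ge0 ?exprn_ge0.
pose e : R := (2 * (c + 1))^-1.
have e0 : 0 < e by rewrite invr_gt0; lra.
have e1 : e <= 1 by rewrite invf_le1; lra.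
have n0 : 0 <= n%:R :> R by rewrite ler0n.
exists (e * kappa / (n%:R + 1)); first by rewrite divr_gt0 ?mulr_gt0//; lra.
move=> M M' hM hE; have uM := rows_expand_unit k0 hM.
rewrite /close.
have -> : \det M' / \det M = \det (1%:M + invmx M *m (M' - M)).
  have E : M' = M *m (1%:M + invmx M *m (M' - M)).
    by rewrite mulmxDr mulmx1 mulmxA mulmxV// mul1mx addrC subrK.
  rewrite [in LHS]E det_mulmx mulrAC mulfV ?mul1r//.
apply: le_trans (@det_perturb n _ e _ _) _.
- by rewrite (ltW e0).
- move=> i j; rewrite mxE; apply: le_trans (normc_sum _ _ _) _.
  apply: le_trans (_ : \sum_(k < n) (e / (n%:R + 1)) <= _).
    apply: ler_sum => k _; rewrite normcM !mxE.
    have -> : e / (n%:R + 1) = kappa^-1 * (e * kappa / (n%:R + 1)).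
      by field; rewrite lt0r_neq0// gt_eqF//; lra.
    by rewrite ler_pM ?normc_ge0 ?rows_expand_inv// (hE k j).
  rewrite sumr_const card_ord -[leLHS]mulr_natl mulrCA ler_piMr ?ltW//.
  by rewrite ltr_pdivrMr; lra.
rewrite mulrA -/c /e -ler_pdivlMr ?invr_gt0; last by lra.
by rewrite invrK mulrA mulVf// mul1r; lra.
Qed.

End DeterminantPerturbation.

(** * Representatives of a rational lattice modulo q Z^2 *)

Section RationalLattice.
Context {R : realType}.
Local Notation i0 := (0 : 'I_2).
Local Notation i1 := (1 : 'I_2).

Lemma latticeE (A : 'M[rat]_2) (ab : R * R) :
  lattice A ab <-> exists z : int * int,
    ab = (ratr (A i0 i0) * z.1%:~R + ratr (A i0 i1) * z.2%:~R,
          ratr (A i1 i0) * z.1%:~R + ratr (A i1 i1) * z.2%:~R).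
Proof.
have E (z : 'cV[int]_2) i : (map_mx ratr A *m map_mx intr z : 'cV[R]_2) i 0 =
    ratr (A i i0) * (z i0 0)%:~R + ratr (A i i1) * (z i1 0)%:~R.
  rewrite mxE big_ord_recl big_ord1 !mxE.
  by rewrite (_ : lift ord0 ord0 = i1)//; exact/val_inj.
split=> [[z ->]|[[z0 z1] ->]]; first by exists (z 0 0, z 1 0); rewrite /= !E.
exists (\col_i if i == 0 then z0 else z1).
by rewrite /= !E !mxE.
Qed.

Lemma common_denominator (A : 'M[rat]_2) :
  exists (q : nat) (B : 'I_2 -> 'I_2 -> int), (0 < q)%N /\
    forall i j, A i j * q%:R = (B i j)%:~R.
Proof.
pose D : int := \prod_(p : 'I_2 * 'I_2) denq (A p.1 p.2).
have D0 : 0 < D by apply: prodr_gt0 => p _; exact: denq_gt0.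
exists `|D|%N, (fun i j => numq (A i j) *
  \prod_(p : 'I_2 * 'I_2 | p != (i, j)) denq (A p.1 p.2)).
split=> [|i j]; first by rewrite absz_gt0 gt_eqF.
rewrite pmulrn gtz0_abs// /D (bigD1 (i, j))//= !intrM mulrA.
by rewrite -numqE.
Qed.

Lemma small_multiple_eq (a b n : nat) (t : int) :
  (a < n)%N -> (b < n)%N -> a%:Z - b%:Z = t * n%:Z -> a = b.
Proof.
move=> an bn h; have [t0|t0|t0] := ltgtP t 0; last by rewrite t0 in h; lia.
  by have : t * n%:Z <= - n%:Z; [nia|lia].
by have : n%:Z <= t * n%:Z; [nia|lia].
Qed.

(** [A Z^2] contains [q Z^2] for a common denominator [q] of [A], and the index
    is [q ^ 2] because [det A = 1]: with [B = q A], the quotient is [Z^2] modulo the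
    columns of the adjugate of [B], for which the rectangle of sides
    [q ^ 2 / d] and [d], [d] the gcd of the second row, is a set of representatives. *)
Lemma lattice_representatives (A : 'M[rat]_2) : \det A = 1 ->
  exists (q : nat) (lam : 'I_(q * q) -> R * R), [/\ (0 < q)%N,
    forall k (m : int * int),
      lattice A ((lam k).1 + q%:R * m.1%:~R, (lam k).2 + q%:R * m.2%:~R),
    forall k k' (m m' : int * int),
      (lam k).1 + q%:R * m.1%:~R = (lam k').1 + q%:R * m'.1%:~R ->
      (lam k).2 + q%:R * m.2%:~R = (lam k').2 + q%:R * m'.2%:~R ->
      k = k' /\ m = m'
    & forall k, exists c : int, q%:R * (lam k).1 = c%:~R].
Proof.
move=> dA; have [q [B [q0 hB]]] := common_denominator A.
have qQ : (q%:R : rat) != 0 by rewrite pnatr_eq0 -lt0n.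
have qR : (q%:R : R) != 0 by rewrite pnatr_eq0 -lt0n.
have dB : B i0 i0 * B i1 i1 - B i0 i1 * B i1 i0 = (q * q)%N%:Z.
  apply: (@intr_inj rat); rewrite rmorphB !rmorphM /= -!hB.
  move: dA; rewrite (expand_det_row _ i0) big_ord_recl big_ord1 /cofactor !det_mx11 !mxE /=.
  rewrite (_ : lift ord0 ord0 = i1); last exact/val_inj.
  rewrite (_ : lift i1 0 = i0); last exact/val_inj.
  move=> dA.
  rewrite -!pmulrn -[RHS]mulr1 -dA /bump /= expr0 expr1; ring.
have hR i j : ratr (A i j) * q%:R = (B i j)%:~R :> R.
  by rewrite -(ratr_nat R q) -rmorphM /= hB ratr_int.
have hR' i j : ratr (A i j) = (B i j)%:~R / q%:R :> R by rewrite -hR mulfK.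
pose b00 := B i0 i0; pose b01 := B i0 i1; pose b10 := B i1 i0; pose b11 := B i1 i1.
have [u [w huw]] := Bezoutz b00 b10.
set g := gcdz b00 b10 in huw.
have /dvdzP[c00 E00] : (g %| b00)%Z := dvdz_gcdl _ _.
have /dvdzP[c10 E10] : (g %| b10)%Z := dvdz_gcdr _ _.
have qq0 : (q * q)%N%:Z > 0 by rewrite ltz_nat muln_gt0 q0.
have dBe : b00 * b11 - b01 * b10 = (q * q)%N%:Z by [].
have gE : (q * q)%N%:Z = (c00 * b11 - b01 * c10) * g.
  by rewrite -dBe {1}E00 {1}E10; ring.
have g0 : 0 < g.
  rewrite lt_neqAle eq_sym; apply/andP; split; last by rewrite /g /gcdz.
  by apply/eqP => g0; move: qq0; rewrite gE g0 mulr0.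
set e := c00 * b11 - b01 * c10 in gE.
have e0 : 0 < e by move: qq0; rewrite gE pmulr_lgt0.
pose dn := `|g|%N; pose en := `|e|%N.
have gn : g = dn%:Z by rewrite /dn gtz0_abs.
have en' : e = en%:Z by rewrite /en gtz0_abs.
have qqn : (q * q = en * dn)%N by apply/eqP; rewrite -eqz_nat [X in _ == X]PoszM -gn -en' gE.
have dn0 : (0 < dn)%N by rewrite -ltz_nat -gn.
pose z1 (k : 'I_(q * q)) := (k %/ dn)%N; pose z2 (k : 'I_(q * q)) := (k %% dn)%N.
pose lam (k : 'I_(q * q)) : R * R :=
  (ratr (A i0 i0) * (z1 k)%:R + ratr (A i0 i1) * (z2 k)%:R,
   ratr (A i1 i0) * (z1 k)%:R + ratr (A i1 i1) * (z2 k)%:R).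
have dBR : b00%:~R * b11%:~R - b01%:~R * b10%:~R = q%:R * q%:R :> R.
  by rewrite -!rmorphM -rmorphB /= dBe -pmulrn natrM.
exists q, lam; split=> //.
- move=> k [m1 m2]; apply/latticeE.
  exists ((z1 k)%:Z + (b11 * m1 - b01 * m2), (z2 k)%:Z + (b00 * m2 - b10 * m1)).
  rewrite /lam /= !rmorphD !rmorphN !rmorphM /= -!pmulrn.
  rewrite !hR' -/b00 -/b01 -/b10 -/b11; congr pair.
    transitivity (b00%:~R / q%:R * (z1 k)%:R + b01%:~R / q%:R * (z2 k)%:R + (q%:R * q%:R) / q%:R * m1%:~R :> R).
      by field.
    by rewrite -dBR; field.
  transitivity (b10%:~R / q%:R * (z1 k)%:R + b11%:~R / q%:R * (z2 k)%:R + (q%:R * q%:R) / q%:R * m2%:~R :> R).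
    by field.
  by rewrite -dBR; field.
- move=> k k' [m1 m2] [m1' m2'] /= E1 E2.
  pose D1 := (z1 k)%:Z - (z1 k')%:Z; pose D2 := (z2 k)%:Z - (z2 k')%:Z.
  pose n1 := m1' - m1; pose n2 := m2' - m2.
  have row i (m m' : int) :
      ratr (A i i0) * (z1 k)%:R + ratr (A i i1) * (z2 k)%:R + q%:R * m%:~R =
      ratr (A i i0) * (z1 k')%:R + ratr (A i i1) * (z2 k')%:R + q%:R * m'%:~R :> R ->
      B i i0 * D1 + B i i1 * D2 = (q * q)%N%:Z * (m' - m).
    move=> /(congr1 ( *%R q%:R)) E; apply: (@intr_inj R).
    rewrite rmorphD !rmorphM !rmorphB /= -!pmulrn ?natrM; move: E; rewrite !hR'.
    have X (a b c d r : R) : q%:R * (a / q%:R * c + b / q%:R * d + q%:R * r) =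
      a * c + b * d + q%:R * q%:R * r by field.
    by rewrite !X => H; lra.
  have F1 : b00 * D1 + b01 * D2 = (q * q)%N%:Z * n1 := row _ _ _ E1.
  have F2 : b10 * D1 + b11 * D2 = (q * q)%N%:Z * n2 := row _ _ _ E2.
  have qqn0 : (q * q)%N%:Z != 0 by rewrite gt_eqF.
  have G1 : D1 = b11 * n1 - b01 * n2.
    apply: (mulfI qqn0).
    transitivity (b11 * (b00 * D1 + b01 * D2) - b01 * (b10 * D1 + b11 * D2)).
      by rewrite -dBe; ring.
    by rewrite F1 F2; ring.
  have G2 : D2 = b00 * n2 - b10 * n1.
    apply: (mulfI qqn0).
    transitivity (b00 * (b10 * D1 + b11 * D2) - b10 * (b00 * D1 + b01 * D2)).
      by rewrite -dBe; ring.
    by rewrite F1 F2; ring.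
  have hz2 l : (z2 l < dn)%N by rewrite ltn_mod.
  have hz1 l : (z1 l < en)%N by rewrite ltn_divLR// -qqn.
  have D20 : D2 = 0.
    have : D2 = (c00 * n2 - c10 * n1) * g by rewrite G2 {1}E00 {1}E10; ring.
    by rewrite gn /D2 => /(small_multiple_eq (hz2 k) (hz2 k')) ->; rewrite subrr.
  have D10 : D1 = 0.
    have h0 : b00 * D1 = (q * q)%N%:Z * n1 by rewrite -F1 D20 mulr0 addr0.
    have h1 : b10 * D1 = (q * q)%N%:Z * n2 by rewrite -F2 D20 mulr0 addr0.
    have : g * D1 = (q * q)%N%:Z * (u * n1 + w * n2).
      rewrite -huw; transitivity (u * (b00 * D1) + w * (b10 * D1)); first by ring.
      by rewrite h0 h1; ring.
    rewrite gE (mulrC e) -mulrA => /(mulfI (lt0r_neq0 g0)); rewrite en' mulrC.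
    by rewrite /D1 => /(small_multiple_eq (hz1 k) (hz1 k')) ->; rewrite subrr.
  split.
    apply/val_inj; rewrite /= (divn_eq k dn) (divn_eq k' dn) -/(z1 k) -/(z2 k) -/(z1 k') -/(z2 k').
    by move: D10 D20; rewrite /D1 /D2; lia.
  have N1 : n1 = 0.
    by apply: (mulfI qqn0); rewrite -F1 D10 D20 !mulr0 addr0.
  have N2 : n2 = 0.
    by apply: (mulfI qqn0); rewrite -F2 D10 D20 !mulr0 addr0.
  by move: N1 N2; rewrite /n1 /n2 => /subr0_eq -> /subr0_eq ->.
- move=> k; exists (b00 * (z1 k)%:Z + b01 * (z2 k)%:Z).
  rewrite /lam /= rmorphD !rmorphM /= -!pmulrn !hR' -/b00 -/b01.
  by field.
Qed.

End RationalLattice.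

(** * Measurability of complex-valued functions *)

Section ComplexMeasurability.
Context {d : measure_display} {T : measurableType d} {R : realType}.
Implicit Types (D : set T) (f g : T -> R[i]).

Lemma cmeasurable_cst D (c : R[i]) : cmeasurable D (fun=> c).
Proof. by split; exact: measurable_cst. Qed.

Lemma cmeasurableD D f g :
  cmeasurable D f -> cmeasurable D g -> cmeasurable D (fun x => f x + g x).
Proof.
move=> [f1 f2] [g1 g2]; split.
  rewrite (_ : (fun _ => _) = (fun x => complex.Re (f x)) \+ (fun x => complex.Re (g x))).
    exact: measurable_funD.
  by apply/funext => x /=; case: (f x) (g x) => [? ?] [].
rewrite (_ : (fun _ => _) = (fun x => complex.Im (f x)) \+ (fun x => complex.Im (g x))).
  exact: measurable_funD.
by apply/funext => x /=; case: (f x) (g x) => [? ?] [].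
Qed.

Lemma cmeasurableM D f g :
  cmeasurable D f -> cmeasurable D g -> cmeasurable D (fun x => f x * g x).
Proof.
move=> [f1 f2] [g1 g2]; split.
  rewrite (_ : (fun _ => _) = (fun x => complex.Re (f x)) \* (fun x => complex.Re (g x))
      \- (fun x => complex.Im (f x)) \* (fun x => complex.Im (g x))).
    by apply: measurable_funB; exact: measurable_funM.
  by apply/funext => x /=; case: (f x) (g x) => [? ?] [].
rewrite (_ : (fun _ => _) = (fun x => complex.Re (f x)) \* (fun x => complex.Im (g x))
    \+ (fun x => complex.Im (f x)) \* (fun x => complex.Re (g x))).
  by apply: measurable_funD; exact: measurable_funM.
by apply/funext => x /=; case: (f x) (g x) => [? ?] [].
Qed.

Lemma cmeasurableN D f : cmeasurable D f -> cmeasurable D (fun x => - f x).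
Proof.
move=> mf; rewrite (_ : (fun _ => _) = (fun x => (-1) * f x)).
  by apply: cmeasurableM => //; exact: cmeasurable_cst.
by apply/funext => x; rewrite mulN1r.
Qed.

Lemma cmeasurableB D f g :
  cmeasurable D f -> cmeasurable D g -> cmeasurable D (fun x => f x - g x).
Proof. by move=> mf mg; apply: cmeasurableD => //; exact: cmeasurableN. Qed.

Lemma cmeasurable_sum (I : Type) (s : seq I) D (f : I -> T -> R[i]) :
  (forall i, cmeasurable D (f i)) ->
  cmeasurable D (fun x => \sum_(i <- s) f i x).
Proof.
move=> mf; elim: s => [|i s IH].
  rewrite (_ : (fun _ => _) = fun=> 0); first exact: cmeasurable_cst.
  by apply/funext => x; rewrite big_nil.
rewrite (_ : (fun _ => _) = (fun x => f i x + \sum_(j <- s) f j x)).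
  exact: cmeasurableD.
by apply/funext => x; rewrite big_cons.
Qed.

Lemma cmeasurable_e2pi D (h : T -> R) :
  measurable_fun D h -> cmeasurable D (fun x => e2pi (h x)).
Proof.
move=> mh; split => /=.
  apply: measurableT_comp.
    by apply: continuous_measurable_fun; exact: continuous_cos.
  by apply: measurable_funM => //; exact: measurable_cst.
apply: measurableT_comp.
  by apply: continuous_measurable_fun; exact: continuous_sin.
by apply: measurable_funM => //; exact: measurable_cst.
Qed.

Lemma measurable_normcX D f p :
  cmeasurable D f -> measurable_fun D (fun x => normc (f x) ^+ p).
Proof.
move=> [f1 f2]; apply: measurable_funX.
rewrite (_ : (fun _ => _) = Num.sqrt \o
  (fun x => complex.Re (f x) ^+ 2 + complex.Im (f x) ^+ 2)).
  apply: measurableT_comp; last by apply: measurable_funD; exact: measurable_funX.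
  by apply: continuous_measurable_fun; exact: sqrt_continuous.
by apply/funext => x /=; rewrite -sqr_normcE sqrtr_sqr ger0_norm ?normc_ge0.
Qed.

Lemma measurable_normc D f :
  cmeasurable D f -> measurable_fun D (fun x => normc (f x)).
Proof. by move=> /(@measurable_normcX _ _ 1). Qed.

End ComplexMeasurability.

Lemma cmeasurable_comp d d' (T : measurableType d) (T' : measurableType d')
    (R : realType) (f : T' -> R[i]) (h : T -> T') :
  measurable_fun setT h -> cmeasurable setT f -> cmeasurable setT (f \o h).
Proof.
move=> mh [f1 f2]; split; first exact: (measurableT_comp f1 mh).
exact: (measurableT_comp f2 mh).
Qed.

(** * Integrals over periods of a flow *)

(** The two coordinates of the plane are treated alike through a flow [sh] that preserves
    the measure and moves a coordinate [phi] at unit speed. *)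
Section Slices.
Local Open Scope ereal_scope.
Context {d : measure_display} {T : measurableType d} {R : realType}.
Variable mu : {measure set T -> \bar R}.
Variables (sh : R -> T -> T) (phi : T -> R).
Hypothesis msh : forall s, measurable_fun setT (sh s).
Hypothesis mphi : measurable_fun setT phi.
Hypothesis shD : forall s t z, sh (s + t)%R z = sh s (sh t z).
Hypothesis sh0 : forall z, sh 0%R z = z.
Hypothesis phish : forall s z, phi (sh s z) = (phi z + s)%R.
Hypothesis sh_mu : forall s A, measurable A -> mu (sh s @^-1` A) = mu A.

Definition slice (D : set T) (a b : R) : set T :=
  D `&` [set z | a <= phi z < b]%R.

Lemma measurable_slice D a b : measurable D -> measurable (slice D a b).
Proof.
move=> mD; apply: measurableI => //.
rewrite (_ : [set _ | _] = phi @^-1` `[a, b[).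
  by rewrite -[X in measurable X]setTI; exact: mphi.
by apply/seteqP; split => z /=; rewrite in_itv.
Qed.

Lemma integral_shift s D (u : T -> \bar R) : measurable D ->
  measurable_fun setT u -> (forall z, 0 <= u z) ->
  \int[mu]_(z in sh s @^-1` D) u (sh s z) = \int[mu]_(z in D) u z.
Proof.
move=> mD mu_ u0.
rewrite -[LHS](@ge0_integral_pushforward _ _ _ _ _ _ (msh s) mu D u)//; last exact: measurable_funTS.
by apply: eq_measure_integral => A mA _; exact: sh_mu.
Qed.

Lemma slice_split D a b c (u : T -> \bar R) : measurable D ->
  measurable_fun setT u -> (forall z, 0 <= u z) -> (a <= b)%R -> (b <= c)%R ->
  \int[mu]_(z in slice D a c) u z =
  \int[mu]_(z in slice D a b) u z + \int[mu]_(z in slice D b c) u z.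
Proof.
move=> mD mu_ u0 ab bc; rewrite -ge0_integral_setU//=.
- congr integral; rewrite /slice -setIUr; congr (_ `&` _).
  apply/seteqP; split => z /=.
    by move=> /andP[h1 h2]; have [?|?] := ltP (phi z) b; [left|right]; rewrite ?h1 ?h2 //; apply/andP.
  by move=> [] /andP[h1 h2]; apply/andP; split => //; [exact: lt_le_trans bc|exact: le_trans h1].
- exact: measurable_slice.
- exact: measurable_slice.
- exact: measurable_funTS.
- apply/disj_set2P; rewrite /slice; apply/seteqP; split => // z [[_ /=]].
  by move=> /andP[_ h1] [_ /= /andP[h2 _]]; move: (lt_le_trans h1 h2); rewrite ltxx.
Qed.

Lemma slice_shift D a b s (u : T -> \bar R) : measurable D ->
  (forall t, sh t @^-1` D = D) ->
  measurable_fun setT u -> (forall z, 0 <= u z) ->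
  \int[mu]_(z in slice D (a + s)%R (b + s)%R) u z = \int[mu]_(z in slice D a b) u (sh s z).
Proof.
move=> mD Dsh mu_ u0; rewrite -(@integral_shift s)//; last exact: measurable_slice.
congr integral; rewrite /slice preimage_setI Dsh; congr (_ `&` _).
by apply/seteqP; split => z /=; rewrite phish lerD2r ltrD2r.
Qed.

(** The slice is moved by periods until it contains [tau]; it is then cut there, and the
    part beyond [tau] is moved back by one period. *)
Lemma slice_periodic D tau c (u : T -> \bar R) : (0 < tau)%R -> measurable D ->
  (forall t, sh t @^-1` D = D) ->
  measurable_fun setT u -> (forall z, 0 <= u z) ->
  (forall z, u (sh tau z) = u z) ->
  \int[mu]_(z in slice D c (c + tau)%R) u z = \int[mu]_(z in slice D 0%R tau) u z.
Proof.
move=> tau0 mD Dsh mu_ u0 up.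
have upn (n : nat) z : u (sh (tau *+ n)%R z) = u z.
  by elim: n z => [|n IH] z; [rewrite mulr0n sh0|rewrite mulrSr addrC shD up].
have upz (k : int) z : u (sh (k%:~R * tau)%R z) = u z.
  case: k => n; first by rewrite -pmulrn mulr_natl upn.
  by rewrite -(upn n.+1 (sh _ z)) -shD NegzE mulrNz -pmulrn mulNr mulr_natl subrr sh0.
pose k : int := Num.floor (c / tau).
pose t := (c - k%:~R * tau)%R.
have t0 : (0 <= t)%R by rewrite subr_ge0 -ler_pdivlMr// floor_le.
have t1 : (t <= tau)%R.
  rewrite lerBlDr -[X in (_ <= X + _)%R]mul1r -mulrDl -ler_pdivrMr// addrC.
  by have := floorD1_gt (c / tau); rewrite intrD => /ltW.
have cE : c = (t + k%:~R * tau)%R by rewrite /t subrK.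
have -> : (c + tau = (t + tau) + k%:~R * tau)%R by rewrite {1}cE addrAC.
rewrite [X in slice D X]cE slice_shift//.
under eq_integral do rewrite upz.
rewrite (@slice_split _ t tau)//; last by rewrite lerDr.
rewrite -[X in slice D X (_ + _)%R]add0r slice_shift//.
under [X in _ + X]eq_integral do rewrite up.
by rewrite addeC -slice_split.
Qed.

Lemma slice_tile D tau c n (u : T -> \bar R) : (0 < tau)%R -> measurable D ->
  (forall t, sh t @^-1` D = D) ->
  measurable_fun setT u -> (forall z, 0 <= u z) ->
  \int[mu]_(z in slice D c (c + n%:R * tau)%R) u z =
  \int[mu]_(z in slice D c (c + tau)%R) (\sum_(j < n) u (sh (j%:R * tau)%R z)).
Proof.
move=> tau0 mD Dsh mu_ u0.
rewrite ge0_integral_sum//; last 2 first.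
- exact: measurable_slice.
- move=> j; apply: measurable_funTS; exact: (measurableT_comp mu_ (msh _)).
elim: n => [|n IH].
  rewrite big_ord0 mul0r addr0 (_ : slice D c c = set0) ?integral_set0//.
  by apply/seteqP; split => // z [_ /= /andP[h1 h2]]; move: (le_lt_trans h1 h2); rewrite ltxx.
rewrite big_ord_recr /= -IH -slice_shift//.
rewrite (addrAC c tau) -natr1 mulrDl mul1r addrA -slice_split//.
- by rewrite lerDl mulr_ge0 ?ler0n// ltW.
- by rewrite lerDl ltW.
Qed.

End Slices.

(** * Translations, boxes and cubes of the plane *)

Section Plane.
Local Open Scope ereal_scope.
Context {R : realType}.
Local Notation mu1 := (@lebesgue_measure R).
Local Notation mu2 := (mu1 \x mu1).
Local Notation line := (measurableTypeR R).
Local Notation plane := (line * line)%type.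

Definition trans (s t : R) (z : R * R) : R * R := (z.1 + s, z.2 + t)%R.

Lemma measurable_addr (c : R) : measurable_fun setT (fun x : line => (x + c)%R : line).
Proof. by apply: measurable_funD; [exact: measurable_id|exact: measurable_cst]. Qed.

Lemma lebesgue_measure_addr (c : R) (A : set line) : measurable A ->
  mu1 ((fun x : line => (x + c)%R : line) @^-1` A) = mu1 A.
Proof.
pose h : line -> line := fun x => (x + c)%R.
have mh : measurable_fun setT h := measurable_addr c.
move=> mA; have := @lebesgue_measure_unique R (pushforward mu1 h).
move=> H; rewrite [RHS]H// => _ [[a b]] _ <-;
transitivity (mu1 (h @^-1` `]a, b]%classic)); last by [].
have -> : h @^-1` `]a, b]%classic = `](a - c)%R, (b - c)%R]%classic.
  by apply/seteqP; split => x /=; rewrite !in_itv /= /h ltrBlDr lerBrDr.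
by rewrite !lebesgue_measure_itv/= !lte_fin ltrD2r -!EFinB; case: ifP => // _; congr EFin; ring.
Qed.

Lemma measurable_trans (s t : R) : measurable_fun setT (trans s t : plane -> plane).
Proof.
apply: measurable_fun_pair.
  exact: (measurableT_comp (measurable_addr s) measurable_fst).
exact: (measurableT_comp (measurable_addr t) measurable_snd).
Qed.

Lemma lebesgue2_trans (s t : R) (A : set plane) : measurable A ->
  mu2 (trans s t @^-1` A) = mu2 A.
Proof.
have mt := measurable_trans s t.
move=> mA; have := @product_measure_unique _ _ _ _ R mu1 mu1 (pushforward mu2 (trans s t : plane -> plane)).
move=> H; rewrite [RHS]H// => {mA}A B mA mB;
transitivity (mu2 (((fun x : line => (x + s)%R : line) @^-1` A) `*`
    ((fun x : line => (x + t)%R : line) @^-1` B))); first by [].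
rewrite product_measure1E; last 2 first.
- by rewrite -[X in measurable X]setTI; exact: measurable_addr.
- by rewrite -[X in measurable X]setTI; exact: measurable_addr.
by congr (_ * _); exact: lebesgue_measure_addr.
Qed.

Lemma transD (s t s' t' : R) z : trans (s + s') (t + t') z = trans s t (trans s' t' z).
Proof. by rewrite /trans /= !addrA !(addrAC _ s) !(addrAC _ t). Qed.

Lemma trans0 z : trans 0 0 z = z.
Proof. by case: z => x y; rewrite /trans /= !addr0. Qed.

Lemma ge0_integral_trans (s t : R) (D : set plane) (u : plane -> \bar R) :
  measurable D -> measurable_fun setT u -> (forall z, 0 <= u z) ->
  \int[mu2]_(z in trans s t @^-1` D) u (trans s t z) = \int[mu2]_(z in D) u z.
Proof.
move=> mD mu_ u0.
apply: (@integral_shift _ plane R mu2 (fun=> trans s t) _ _ 0%R D u) => //.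
- by move=> _; exact: measurable_trans.
- by move=> _ A mA; exact: lebesgue2_trans.
Qed.

Lemma integral_trans (s t : R) (D : set plane) (u : plane -> \bar R) :
  measurable D -> measurable_fun setT u ->
  \int[mu2]_(z in trans s t @^-1` D) u (trans s t z) = \int[mu2]_(z in D) u z.
Proof.
move=> mD mu_; rewrite integralE [RHS]integralE.
congr (_ - _).
  by rewrite -[RHS](@ge0_integral_trans s t)//;
    [by apply: eq_integral => z _; rewrite !funeposE|exact: measurable_funepos].
by rewrite -[RHS](@ge0_integral_trans s t)//;
  [by apply: eq_integral => z _; rewrite !funenegE|exact: measurable_funeneg].
Qed.

(** Half-open, so that the translates of a box tile larger boxes exactly. *)
Definition box (a b c d : R) : set (R * R) :=
  [set z | a <= z.1 < b /\ c <= z.2 < d]%R.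

Let level (f : R * R -> R) (c d : R) : set (R * R) := [set z | c <= f z < d]%R.

Let measurable_level (f : plane -> line) c d : measurable_fun setT f ->
  measurable (level f c d : set plane).
Proof.
move=> mf; rewrite (_ : level _ _ _ = f @^-1` `[c, d[).
  by rewrite -[X in measurable X]setTI; exact: mf.
by apply/seteqP; split => z /=; rewrite /level /= in_itv.
Qed.

Lemma box_slice1 a b c d : box a b c d = slice fst (level snd c d) a b.
Proof. by apply/seteqP; split => z [? ?]; split. Qed.

Lemma box_slice2 a b c d : box a b c d = slice snd (level fst a b) c d.
Proof. by apply/seteqP; split => z [? ?]; split. Qed.

Lemma measurable_box a b c d : measurable (box a b c d : set plane).
Proof.
rewrite box_slice1; apply: measurable_slice; first exact: measurable_fst.
by apply: measurable_level; exact: measurable_snd.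
Qed.

Lemma box_trans s t a b c d :
  trans s t @^-1` (box (a + s) (b + s) (c + t) (d + t))%R = box a b c d.
Proof. by apply/seteqP; split => z; rewrite /box /= !lerD2r !ltrD2r. Qed.

Lemma integral_box_trans (s t a b c d : R) (u : plane -> \bar R) :
  measurable_fun setT u -> (forall z, 0 <= u z) ->
  \int[mu2]_(z in box (a + s) (b + s) (c + t) (d + t)) u z =
  \int[mu2]_(z in box a b c d) u (trans s t z).
Proof.
move=> mu_ u0; rewrite -(@ge0_integral_trans s t)//; last exact: measurable_box.
by rewrite box_trans.
Qed.

Let sh1 s : R * R -> R * R := trans s 0.
Let sh2 s : R * R -> R * R := trans 0 s.

Let sh1D s t z : sh1 (s + t)%R z = sh1 s (sh1 t z).
Proof. by rewrite /sh1 -transD addr0. Qed.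
Let sh2D s t z : sh2 (s + t)%R z = sh2 s (sh2 t z).
Proof. by rewrite /sh2 -transD addr0. Qed.

Let sh1_level c d t : sh1 t @^-1` (level snd c d) = level snd c d.
Proof. by apply/seteqP; split => z; rewrite /level /= addr0. Qed.
Let sh2_level c d t : sh2 t @^-1` (level fst c d) = level fst c d.
Proof. by apply/seteqP; split => z; rewrite /level /= addr0. Qed.

Lemma box_periodic1 (tau c a b : R) (u : plane -> \bar R) : (0 < tau)%R ->
  measurable_fun setT u -> (forall z, 0 <= u z) ->
  (forall z, u (trans tau 0 z) = u z) ->
  \int[mu2]_(z in box c (c + tau) a b) u z = \int[mu2]_(z in box 0 tau a b) u z.
Proof.
move=> tau0 mu_ u0 u1; rewrite !box_slice1.
apply: (@slice_periodic _ plane R mu2 sh1 (fst : plane -> R)) => //.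
- by move=> s; exact: measurable_trans.
- exact: trans0.
- by move=> s A mA; exact: lebesgue2_trans.
- by apply: measurable_level; exact: measurable_snd.
Qed.

Lemma box_periodic2 (tau c a b : R) (u : plane -> \bar R) : (0 < tau)%R ->
  measurable_fun setT u -> (forall z, 0 <= u z) ->
  (forall z, u (trans 0 tau z) = u z) ->
  \int[mu2]_(z in box a b c (c + tau)) u z = \int[mu2]_(z in box a b 0 tau) u z.
Proof.
move=> tau0 mu_ u0 u1; rewrite !box_slice2.
apply: (@slice_periodic _ plane R mu2 sh2 (snd : plane -> R)) => //.
- by move=> s; exact: measurable_trans.
- exact: trans0.
- by move=> s A mA; exact: lebesgue2_trans.
- by apply: measurable_level; exact: measurable_fst.
Qed.

Lemma box_periodic (tau c d : R) (u : plane -> \bar R) : (0 < tau)%R ->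
  measurable_fun setT u -> (forall z, 0 <= u z) ->
  (forall z, u (trans tau 0 z) = u z) -> (forall z, u (trans 0 tau z) = u z) ->
  \int[mu2]_(z in box c (c + tau) d (d + tau)) u z = \int[mu2]_(z in box 0 tau 0 tau) u z.
Proof. by move=> *; rewrite box_periodic1// box_periodic2. Qed.

Lemma box_tile1 (tau c a b : R) n (u : plane -> \bar R) : (0 < tau)%R ->
  measurable_fun setT u -> (forall z, 0 <= u z) ->
  \int[mu2]_(z in box c (c + n%:R * tau) a b) u z =
  \int[mu2]_(z in box c (c + tau) a b) (\sum_(j < n) u (trans (j%:R * tau) 0 z)).
Proof.
move=> tau0 mu_ u0; rewrite !box_slice1.
apply: (@slice_tile _ plane R mu2 sh1 (fst : plane -> R)) => //.
- by move=> s; exact: measurable_trans.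
- by move=> s A mA; exact: lebesgue2_trans.
- by apply: measurable_level; exact: measurable_snd.
Qed.

Lemma box_tile2 (tau c a b : R) n (u : plane -> \bar R) : (0 < tau)%R ->
  measurable_fun setT u -> (forall z, 0 <= u z) ->
  \int[mu2]_(z in box a b c (c + n%:R * tau)) u z =
  \int[mu2]_(z in box a b c (c + tau)) (\sum_(j < n) u (trans 0 (j%:R * tau) z)).
Proof.
move=> tau0 mu_ u0; rewrite !box_slice2.
apply: (@slice_tile _ plane R mu2 sh2 (snd : plane -> R)) => //.
- by move=> s; exact: measurable_trans.
- by move=> s A mA; exact: lebesgue2_trans.
- by apply: measurable_level; exact: measurable_fst.
Qed.

Lemma measurable_transl s t d' (T' : measurableType d') (u : plane -> T') :
  measurable_fun setT u -> measurable_fun setT (fun z => u (trans s t z)).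
Proof. by move=> mu_; apply: (measurableT_comp mu_); exact: measurable_trans. Qed.

Lemma box_tile (tau : R) n (u : plane -> \bar R) : (0 < tau)%R ->
  measurable_fun setT u -> (forall z, 0 <= u z) ->
  \int[mu2]_(z in box 0 (n%:R * tau) 0 (n%:R * tau)) u z =
  \int[mu2]_(z in box 0 tau 0 tau)
    (\sum_(p : 'I_n * 'I_n) u (trans (p.1%:R * tau) (p.2%:R * tau) z)).
Proof.
move=> tau0 mu_ u0.
rewrite -[X in box 0 X]add0r box_tile1// add0r -[X in box _ _ _ X]add0r box_tile2//; last first.
- by move=> z; apply: sume_ge0.
- by apply: emeasurable_sum => j; exact: measurable_transl.
rewrite add0r; apply: eq_integral => z _.
rewrite exchange_big pair_big /=; apply: eq_bigr => p _.
by rewrite -transD addr0 add0r.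
Qed.

Lemma null_vertical (c : R) : mu2 [set z : plane | z.1 = c] = 0.
Proof.
rewrite (_ : [set _ | _] = [set c] `*` setT).
  transitivity (mu1 [set c] * mu1 setT); first exact: product_measure1E.
  by rewrite lebesgue_measure_set1 mul0e.
by apply/seteqP; split => z /=; [move=> ->|case].
Qed.

Lemma null_horizontal (c : R) : mu2 [set z : plane | z.2 = c] = 0.
Proof.
rewrite (_ : [set _ | _] = setT `*` [set c]).
  transitivity (mu1 setT * mu1 [set c]); first exact: product_measure1E.
  by rewrite lebesgue_measure_set1 mule0.
by apply/seteqP; split => z /=; [move=> ->|case].
Qed.

Lemma integral_null_diff (D E N : set plane) (u : plane -> \bar R) :
  measurable D -> measurable E -> measurable N -> mu2 N = 0 ->
  measurable_fun setT u -> (forall z, 0 <= u z) ->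
  D `<=` E -> E `\` D `<=` N ->
  \int[mu2]_(z in D) u z = \int[mu2]_(z in E) u z.
Proof.
move=> mD mE mN N0 mu_ u0 DE EN.
rewrite (@ge0_negligible_integral _ _ _ mu2 D N)//; last exact: measurable_funTS.
rewrite (@ge0_negligible_integral _ _ _ mu2 E N)//; last exact: measurable_funTS.
congr integral; apply/seteqP; split => z [h nN]; split => //; first exact: DE.
by apply: contrapT => nD; apply: nN; exact: EN.
Qed.

Lemma measurable_vertical (c : R) : measurable ([set z : plane | z.1 = c] : set plane).
Proof.
rewrite (_ : [set _ | _] = [set c] `*` setT); first exact: (@measurableX _ _ line line).
by apply/seteqP; split => z /=; [move=> ->|case].
Qed.

Lemma measurable_horizontal (c : R) : measurable ([set z : plane | z.2 = c] : set plane).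
Proof.
rewrite (_ : [set _ | _] = setT `*` [set c]); first exact: (@measurableX _ _ line line).
by apply/seteqP; split => z /=; [move=> ->|case].
Qed.

Definition cross (a b : R) : set (R * R) := [set z | z.1 = a] `|` [set z | z.2 = b].

Lemma measurable_cross a b : measurable (cross a b : set plane).
Proof. by apply: measurableU; [exact: measurable_vertical|exact: measurable_horizontal]. Qed.

Lemma null_cross a b : mu2 (cross a b) = 0.
Proof.
apply: null_set_setU.
- exact: measurable_vertical.
- exact: measurable_horizontal.
- exact: null_vertical.
- exact: null_horizontal.
Qed.

Definition cube (a b d : R) : set (R * R) := `[a, (a + d)%R]%classic `*` `[b, (b + d)%R]%classic.

Lemma measurable_cube a b d : measurable (cube a b d : set plane).
Proof. exact: measurableX. Qed.

Lemma cubeE a b d z : cube a b d z <-> (a <= z.1 <= a + d)%R /\ (b <= z.2 <= b + d)%R.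
Proof. by rewrite /cube /= !in_itv. Qed.

Lemma integral_cube_box (a b d : R) (u : plane -> \bar R) :
  measurable_fun setT u -> (forall z, 0 <= u z) ->
  \int[mu2]_(z in cube a b d) u z = \int[mu2]_(z in box a (a + d) b (b + d)) u z.
Proof.
move=> mu_ u0; apply/esym.
apply: (@integral_null_diff _ _ (cross (a + d) (b + d))) => //.
- exact: measurable_box.
- exact: measurable_cube.
- exact: measurable_cross.
- exact: null_cross.
- move=> z [/andP[? ?] /andP[? ?]]; apply/cubeE; split; apply/andP; split => //; exact: ltW.
- move=> z [/cubeE[/andP[h1 h2] /andP[h3 h4]]] nb.
  have [e1|n1] := eqVneq z.1 (a + d)%R; first by left.
  right; apply/eqP; apply/negPn/negP => n2; apply: nb; split.
    by rewrite h1 lt_neqAle n1 h2.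
  by rewrite h3 lt_neqAle n2 h4.
Qed.

Lemma measure_cube a b d : (0 <= d)%R -> mu2 (cube a b d) = (d ^+ 2)%:E.
Proof.
move=> d0; transitivity (mu1 `[a, (a + d)%R]%classic * mu1 `[b, (b + d)%R]%classic).
  exact: product_measure1E.
rewrite !lebesgue_measure_itv /= !lte_fin !ltrDl.
case: ifPn => [_|]; first by rewrite -!EFinD -EFinM; congr EFin; ring.
by rewrite -leNgt => d1; rewrite (_ : d = 0%R) ?mule0 ?expr0n//; apply/eqP; rewrite eq_le d0 d1.
Qed.

Lemma cube_trans s t a b d : trans s t @^-1` (cube (a + s) (b + t) d)%R = cube a b d.
Proof.
by apply/seteqP; split => z /cubeE[h1 h2]; apply/cubeE; move: h1 h2;
  rewrite /= !(addrAC _ _ d) !lerD2r.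
Qed.

Lemma unit_squareE : @unit_square R = cube 0 0 1.
Proof. by rewrite /unit_square /cube !add0r. Qed.

End Plane.

(** * Integrals of nonnegative real functions *)

Section NonnegativeIntegrals.
Local Open Scope ereal_scope.
Context {d : measure_display} {T : measurableType d} {R : realType}.
Variable mu : {measure set T -> \bar R}.
Implicit Types (D : set T) (u v : T -> R).

Lemma nint_ge0 D u : (forall x, 0 <= u x)%R -> 0 <= \int[mu]_(x in D) (u x)%:E.
Proof. by move=> u0; apply: integral_ge0 => x _; rewrite lee_fin. Qed.

Lemma nint_le D u v : measurable D -> measurable_fun setT u -> measurable_fun setT v ->
  (forall x, 0 <= u x)%R -> (forall x, D x -> u x <= v x)%R ->
  \int[mu]_(x in D) (u x)%:E <= \int[mu]_(x in D) (v x)%:E.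
Proof.
move=> mD mu_ mv u0 uv; apply: ge0_le_integral => //.
- by move=> x _; rewrite lee_fin.
- by apply/measurable_EFinP; exact: measurable_funTS.
- by apply/measurable_EFinP; exact: measurable_funTS.
Qed.

Lemma nintD D u v : measurable D -> measurable_fun setT u -> measurable_fun setT v ->
  (forall x, 0 <= u x)%R -> (forall x, 0 <= v x)%R ->
  \int[mu]_(x in D) (u x + v x)%:E =
  \int[mu]_(x in D) (u x)%:E + \int[mu]_(x in D) (v x)%:E.
Proof.
move=> mD mu_ mv u0 v0; rewrite -ge0_integralD//.
- by move=> x _; rewrite lee_fin.
- by apply/measurable_EFinP; exact: measurable_funTS.
- by move=> x _; rewrite lee_fin.
- by apply/measurable_EFinP; exact: measurable_funTS.
Qed.

Lemma nintZ D (k : R) u : measurable D -> measurable_fun setT u -> (0 <= k)%R ->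
  (forall x, 0 <= u x)%R ->
  \int[mu]_(x in D) (k * u x)%:E = k%:E * \int[mu]_(x in D) (u x)%:E.
Proof.
move=> mD mu_ k0 u0; rewrite -ge0_integralZl_EFin//.
- by move=> x _; rewrite lee_fin.
- by apply/measurable_EFinP; exact: measurable_funTS.
Qed.

Lemma nint_sum (I : Type) (s : seq I) D (u : I -> T -> R) : measurable D ->
  (forall i, measurable_fun setT (u i)) -> (forall i x, 0 <= u i x)%R ->
  \int[mu]_(x in D) (\sum_(i <- s) u i x)%:E =
  \sum_(i <- s) \int[mu]_(x in D) (u i x)%:E.
Proof.
move=> mD mu_ u0; rewrite -ge0_integral_sum//.
- by apply: eq_integral => x _; rewrite sumEFin.
- by move=> i; apply/measurable_EFinP; exact: measurable_funTS.
- by move=> i x _; rewrite lee_fin.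
Qed.

Lemma nint_cst D (k : R) : measurable D -> \int[mu]_(x in D) k%:E = k%:E * mu D.
Proof. by move=> mD; rewrite -integral_cst. Qed.

Lemma nint_sub D E u : measurable D -> measurable E -> measurable_fun setT u ->
  (forall x, 0 <= u x)%R -> D `<=` E ->
  \int[mu]_(x in D) (u x)%:E <= \int[mu]_(x in E) (u x)%:E.
Proof.
move=> mD mE mu_ u0 DE; apply: ge0_subset_integral => //.
  by apply/measurable_EFinP; exact: measurable_funTS.
by move=> x _; rewrite lee_fin.
Qed.

Lemma ae_mono (P Q : T -> Prop) : (forall x, P x -> Q x) ->
  {ae mu, forall x, P x} -> {ae mu, forall x, Q x}.
Proof. by move=> PQ; apply: filterS. Qed.

Lemma nint_ae D u v : measurable D -> measurable_fun setT u -> measurable_fun setT v ->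
  (forall x, 0 <= u x)%R -> (forall x, 0 <= v x)%R -> {ae mu, forall x, u x = v x} ->
  \int[mu]_(x in D) (u x)%:E = \int[mu]_(x in D) (v x)%:E.
Proof.
move=> mD mu_ mv u0 v0 uv; apply: ge0_ae_eq_integral => //.
- by apply/measurable_EFinP; exact: measurable_funTS.
- by apply/measurable_EFinP; exact: measurable_funTS.
- by move=> x _; rewrite lee_fin.
- by move=> x _; rewrite lee_fin.
by apply: filterS uv => x /= ->.
Qed.

End NonnegativeIntegrals.

(** * Parseval's identity for trigonometric polynomials *)

Section DiscreteParseval.
Context {R : realType}.

Lemma sum_e2pi_root (L : nat) (k : int) :
  (0 < L)%N -> k != 0 -> `|k| < L%:Z ->
  \sum_(r < L) e2pi (k%:~R * (r%:R / L%:R)) = 0 :> R[i].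
Proof.
move=> L0 k0 kL; have LR : (L%:R : R) != 0 by rewrite pnatr_eq0 -lt0n.
pose z : R[i] := e2pi (k%:~R / L%:R).
have zr (r : nat) : e2pi (k%:~R * (r%:R / L%:R)) = z ^+ r.
  by rewrite /z -e2piMn; congr e2pi; field.
have zL : z ^+ L = 1.
  by rewrite -zr divff// mulr1 e2pi_int.
have z1 : z - 1 != 0.
  rewrite subr_eq0; apply/eqP => /e2pi_eq1 h.
  have kR : k%:~R / L%:R = 0 :> R.
    apply: h; rewrite normrM normfV (ger0_norm (ler0n _ _)) ltr_pdivrMr ?ltr0n// mul1r.
    by rewrite -intr_norm pmulrn ltr_int.
  by move/eqP: kR; rewrite mulf_eq0 invr_eq0 (negPf LR) orbF intr_eq0 (negPf k0).
apply: (mulfI z1); rewrite mulr0; under eq_bigr do rewrite zr.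
by rewrite -subrX1 zL subrr.
Qed.

Lemma orthogonal_sum_sqr (I K : eqType) (s : seq I) (r : seq K)
    (chi : I -> K -> R[i]) (c : I -> R[i]) (L : R) : uniq s ->
  (forall i j, i \in s -> j \in s -> \sum_(k <- r) chi i k * (chi j k)^*%C =
     if i == j then L%:C%C else 0) ->
  \sum_(k <- r) normc (\sum_(i <- s) c i * chi i k) ^+ 2 =
  L * \sum_(i <- s) normc (c i) ^+ 2.
Proof.
move=> us orth.
have N (z : R[i]) : (normc z ^+ 2)%:C%C = z * z^*%C.
  by rewrite -sqr_normc rmorphXn.
apply: (fmorph_inj (real_complex R)).
rewrite rmorph_sum rmorphM rmorph_sum /=.
under eq_bigr do rewrite N rmorph_sum mulr_suml /=.
under [in RHS]eq_bigr do rewrite N.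
rewrite exchange_big mulr_sumr /= big_seq [RHS]big_seq; apply: eq_bigr => i si.
under eq_bigr do rewrite mulr_sumr.
rewrite exchange_big /= (bigD1_seq i)//=.
rewrite [X in _ + X]big_seq_cond [X in _ + X]big1 ?addr0 => [|j /andP[sj ji]].
  transitivity (c i * (c i)^*%C * \sum_(k <- r) chi i k * (chi i k)^*%C).
    by rewrite mulr_sumr; apply: eq_bigr => k _; rewrite rmorphM; ring.
  by rewrite orth// eqxx mulrC.
transitivity (c i * (c j)^*%C * \sum_(k <- r) chi i k * (chi j k)^*%C).
  by rewrite mulr_sumr; apply: eq_bigr => k _; rewrite rmorphM; ring.
by rewrite orth// eq_sym (negPf ji) mulr0.
Qed.

Lemma int_seq_bound (s : seq int) : exists L : nat, (0 < L)%N /\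
  forall i j, i \in s -> j \in s -> `|i - j| < L%:Z.
Proof.
have [M hM] : exists M : nat, forall i, i \in s -> `|i| <= M%:Z.
  elim: s => [|a s [M IH]]; first by exists 0%N.
  exists (`|a| + M)%N => i; rewrite inE => /orP[/eqP ->|/IH]; lia.
exists (M + M).+1; split=> // i j /hM h1 /hM h2; lia.
Qed.

(** On a grid of [L] points, with [L] larger than the differences of the frequencies,
    distinct characters are orthogonal. *)
Lemma parseval_grid1 (s : seq int) : uniq s ->
  exists L : nat, (0 < L)%N /\ forall (c : int -> R[i]) (t : R),
   \sum_(r < L) normc (\sum_(k <- s) c k * e2pi (k%:~R * (t + r%:R / L%:R))) ^+ 2 =
   L%:R * \sum_(k <- s) normc (c k) ^+ 2.
Proof.
move=> us; have [L [L0 hL]] := int_seq_bound s; exists L; split=> // c t.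
apply: (@orthogonal_sum_sqr int _ s (index_enum 'I_L)
  (fun k (r : 'I_L) => e2pi (k%:~R * (t + r%:R / L%:R))) c L%:R us) => i j si sj.
have E (r : 'I_L) : e2pi (i%:~R * (t + r%:R / L%:R)) * (e2pi (j%:~R * (t + r%:R / L%:R)))^*%C
    = e2pi ((i - j)%:~R * t) * e2pi ((i - j)%:~R * (r%:R / L%:R)) :> R[i].
  by rewrite conjc_e2pi -!e2piD; congr e2pi; rewrite intrB; ring.
under eq_bigr do rewrite E.
rewrite -mulr_sumr; have [->|ij] := eqVneq i j.
  rewrite subrr mul0r e2pi0 mul1r.
  under eq_bigr do rewrite mul0r e2pi0.
  by rewrite sumr_const card_ord rmorph_nat.
by rewrite sum_e2pi_root ?mulr0 ?subr_eq0// hL.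
Qed.

Lemma parseval_grid2 (s : seq (int * int)) (c : int * int -> R[i]) : uniq s ->
  exists L : nat, (0 < L)%N /\ forall x y : R,
   \sum_(r : 'I_L * 'I_L) normc (\sum_(m <- s) c m *
      e2pi (m.1%:~R * (x + r.1%:R / L%:R) + m.2%:~R * (y + r.2%:R / L%:R))) ^+ 2 =
   L%:R ^+ 2 * \sum_(m <- s) normc (c m) ^+ 2.
Proof.
move=> us; have [L [L0 hL]] := int_seq_bound ([seq m.1 | m <- s] ++ [seq m.2 | m <- s]).
exists L; split=> // x y.
apply: (@orthogonal_sum_sqr _ _ s (index_enum ('I_L * 'I_L)%type)
  (fun m (r : 'I_L * 'I_L) => e2pi (m.1%:~R * (x + r.1%:R / L%:R) + m.2%:~R * (y + r.2%:R / L%:R)))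
  c (L%:R ^+ 2) us) => m m' sm sm'.
have E (r : 'I_L * 'I_L) :
    e2pi (m.1%:~R * (x + r.1%:R / L%:R) + m.2%:~R * (y + r.2%:R / L%:R)) *
      (e2pi (m'.1%:~R * (x + r.1%:R / L%:R) + m'.2%:~R * (y + r.2%:R / L%:R)))^*%C
    = e2pi ((m.1 - m'.1)%:~R * x + (m.2 - m'.2)%:~R * y) *
      (e2pi ((m.1 - m'.1)%:~R * (r.1%:R / L%:R)) * e2pi ((m.2 - m'.2)%:~R * (r.2%:R / L%:R))) :> R[i].
  by rewrite conjc_e2pi -!e2piD; congr e2pi; rewrite !intrB; ring.
under eq_bigr do rewrite E.
rewrite -mulr_sumr.
have -> : \sum_(r : 'I_L * 'I_L) e2pi ((m.1 - m'.1)%:~R * (r.1%:R / L%:R)) * e2pi ((m.2 - m'.2)%:~R * (r.2%:R / L%:R))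
  = (\sum_(r < L) e2pi ((m.1 - m'.1)%:~R * (r%:R / L%:R))) * (\sum_(r < L) e2pi ((m.2 - m'.2)%:~R * (r%:R / L%:R))) :> R[i].
  by rewrite big_distrlr pair_big.
have H (k k' : int) : k \in [seq m.1 | m <- s] ++ [seq m.2 | m <- s] ->
    k' \in [seq m.1 | m <- s] ++ [seq m.2 | m <- s] ->
    \sum_(r < L) e2pi ((k - k')%:~R * (r%:R / L%:R)) = (if k == k' then L%:R else 0) :> R[i].
  move=> hk hk'; have [->|kk'] := eqVneq k k'.
    under eq_bigr do rewrite subrr mul0r e2pi0.
    by rewrite sumr_const card_ord.
  by rewrite sum_e2pi_root ?subr_eq0// hL.
rewrite !H ?mem_cat ?map_f ?orbT//.
case: m m' {sm sm' E} => [m1 m2] [m1' m2'] /=; rewrite xpair_eqE.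
have [->|/=] := eqVneq m1 m1'; last by rewrite mul0r mulr0.
have [->|/=] := eqVneq m2 m2'; last by rewrite !mulr0.
by rewrite !subrr !mul0r addr0 e2pi0 mul1r /= rmorphXn rmorph_nat expr2.
Qed.

End DiscreteParseval.

Section TrigonometricParseval.
Local Open Scope ereal_scope.
Context {R : realType}.
Local Notation mu1 := (@lebesgue_measure R).
Local Notation mu2 := (mu1 \x mu1).
Local Notation line := (measurableTypeR R).
Local Notation plane := (line * line)%type.

Lemma measurable_linear (a b c : R) :
  measurable_fun setT (fun z : plane => (a * z.1 + b * z.2 + c)%R : line).
Proof.
apply: measurable_funD; last exact: measurable_cst.
apply: measurable_funD; apply: measurable_funM; try exact: measurable_cst.
  exact: measurable_fst.
exact: measurable_snd.
Qed.

Lemma measure_box (a b c d : R) : (a <= b)%R -> (c <= d)%R ->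
  mu2 (box a b c d) = ((b - a) * (d - c))%:E.
Proof.
move=> ab cd.
have -> : box a b c d = `[a, b[%classic `*` `[c, d[%classic.
  by apply/seteqP; split => z; rewrite /box /= !in_itv.
transitivity (mu1 `[a, b[%classic * mu1 `[c, d[%classic); first exact: product_measure1E.
rewrite !lebesgue_measure_itv /= !lte_fin -!EFinB.
move: ab; rewrite le_eqVlt => /orP[/eqP ->|->]; first by rewrite ltxx subrr mul0r mul0e.
move: cd; rewrite le_eqVlt => /orP[/eqP ->|->]; first by rewrite ltxx subrr mulr0 mule0.
by rewrite EFinM.
Qed.

(** The square of side 1 is tiled by small squares over which the squared modulus of
    the polynomial, summed along the tiles, is constant. *)
Lemma trig_parseval (s : seq (int * int)) (c : int * int -> R[i]) : uniq s ->
  \int[mu2]_(z in box 0 1 0 1)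
     (normc (\sum_(m <- s) c m * e2pi (m.1%:~R * z.1 + m.2%:~R * z.2)) ^+ 2)%:E
  = (\sum_(m <- s) normc (c m) ^+ 2)%:E.
Proof.
move=> us; have [L [L0 hL]] := parseval_grid2 c us.
have LR : (0 < L%:R :> R)%R by rewrite ltr0n.
pose u (z : plane) : R := (normc (\sum_(m <- s) c m * e2pi (m.1%:~R * z.1 + m.2%:~R * z.2)) ^+ 2)%R.
have mu_ : measurable_fun setT u.
  apply: measurable_normcX; apply: cmeasurable_sum => m; apply: cmeasurableM.
    exact: cmeasurable_cst.
  apply: cmeasurable_e2pi; have := @measurable_linear m.1%:~R m.2%:~R 0.
  by under eq_fun do rewrite addr0.
have E1 : (1 = L%:R * L%:R^-1 :> R)%R by rewrite mulfV// gt_eqF.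
transitivity (\int[mu2]_(z in box 0 (L%:R * L%:R^-1) 0 (L%:R * L%:R^-1)) (u z)%:E).
  by rewrite -E1.
rewrite (@box_tile R _ L (fun z => (u z)%:E)) ?invr_gt0//; last 2 first.
- exact/measurable_EFinP.
- by move=> z; rewrite lee_fin sqr_ge0.
under eq_integral do rewrite sumEFin /u /trans /= hL.
transitivity ((L%:R ^+ 2 * \sum_(m <- s) normc (c m) ^+ 2)%R%:E * mu2 (box 0 L%:R^-1 0 L%:R^-1)).
  by apply: nint_cst; exact: measurable_box.
rewrite measure_box ?invr_ge0 ?ltW// -EFinM !subr0; congr EFin.
by field; rewrite gt_eqF.
Qed.

End TrigonometricParseval.

(** * Quasi-periodic functions and their shifts *)

Section QuasiPeriodicity.
Local Open Scope ereal_scope.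
Context {R : realType}.
Local Notation mu1 := (@lebesgue_measure R).
Local Notation mu2 := (mu1 \x mu1).
Local Notation line := (measurableTypeR R).
Local Notation plane := (line * line)%type.
Implicit Types (F : R * R -> R[i]).

Definition quasiperiodic F : Prop := forall (m n : int) (z : R * R),
  F (z.1 + m%:~R, z.2 + n%:~R)%R = (e2pi (m%:~R * z.2) * F z)%R.

(** The quasi-periodic extension of the restriction of [F] to the square [0, 1[^2. *)
Definition quasiperiodize F (z : R * R) : R[i] :=
  (e2pi ((Num.floor z.1)%:~R * z.2) *
   F (z.1 - (Num.floor z.1)%:~R, z.2 - (Num.floor z.2)%:~R))%R.

Lemma quasiperiodize_qp F : quasiperiodic (quasiperiodize F).
Proof.
move=> m n [x y]; rewrite /quasiperiodize /=.
have fl (t : R) (k : int) : Num.floor (t + k%:~R)%R = (Num.floor t + k)%R.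
  by rewrite floorDrz ?intr_int// intrKfloor.
rewrite !fl !intrD mulrA -e2piD.
have -> : (x + m%:~R - ((Num.floor x)%:~R + m%:~R) = x - (Num.floor x)%:~R :> R)%R by ring.
have -> : (y + n%:~R - ((Num.floor y)%:~R + n%:~R) = y - (Num.floor y)%:~R :> R)%R by ring.
congr (_ * _)%R.
have -> : (((Num.floor x)%:~R + m%:~R) * (y + n%:~R) =
  (m%:~R * y + (Num.floor x)%:~R * y) + ((Num.floor x + m) * n)%:~R :> R)%R.
  by rewrite intrM intrD; ring.
by rewrite [LHS]e2piD e2pi_int mulr1.
Qed.

Lemma measurable_floorR : measurable_fun setT (fun x : line => (Num.floor x)%:~R%R : line).
Proof.
by apply: nondecreasing_measurable => // x y xy; rewrite ler_int le_floor.
Qed.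

Lemma cmeasurable_quasiperiodize F :
  cmeasurable [set: plane] F -> cmeasurable [set: plane] (quasiperiodize F).
Proof.
have m1 : measurable_fun setT (fun z : plane => (Num.floor z.1)%:~R%R : line).
  exact: (measurableT_comp measurable_floorR measurable_fst).
have m2 : measurable_fun setT (fun z : plane => (Num.floor z.2)%:~R%R : line).
  exact: (measurableT_comp measurable_floorR measurable_snd).
move=> mF; apply: cmeasurableM.
  by apply: cmeasurable_e2pi; apply: measurable_funM => //; exact: measurable_snd.
apply: (@cmeasurable_comp _ _ plane plane R F) => //.
apply: measurable_fun_pair.
  by apply: measurable_funB => //; exact: measurable_fst.
by apply: measurable_funB => //; exact: measurable_snd.
Qed.

Lemma ae_countable (T : countType) (P : T -> plane -> Prop) :
  (forall i, {ae mu2, forall z, P i z}) -> {ae mu2, forall z, forall i, P i z}.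
Proof.
move=> h.
have [N hN] : exists N : nat -> set plane, forall k, [/\ measurable (N k), mu2 (N k) = 0 &
    forall i, pickle i = k -> ~` [set z | P i z] `<=` N k].
  suff /choice [N hN] : forall k, exists N : set plane, [/\ measurable N, mu2 N = 0 &
    forall i, pickle i = k -> ~` [set z | P i z] `<=` N] by exists N.
  move=> k; have [[i ik]|nk] := pselect (exists i : T, pickle i = k).
    have [N [mN N0 sN]] := h i; exists N; split => // j jk.
    by rewrite (_ : j = i)//; apply: (pcan_inj pickleK); rewrite jk ik.
  by exists set0; split => // i ik; case: nk; exists i.
have : mu2.-negligible (\bigcup_k N k).
  apply: negligible_bigcup => k; exists (N k); case: (hN k) => mN N0 _; split => //.
apply: negligibleS => z /= /existsNP[i nP].
by exists (pickle i) => //; case: (hN (pickle i)) => _ _ /(_ i erefl); apply.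
Qed.

(** Only the instance of the quasi-periodicity relation at the integer parts of the
    point is used, so that no translate of a null set occurs. *)
Lemma quasiperiodize_ae F :
  (forall m n : int, {ae mu2, forall z : R * R,
        F (z.1 + m%:~R, z.2 + n%:~R)%R = (e2pi (m%:~R * z.2) * F z)%R}) ->
  {ae mu2, forall z, quasiperiodize F z = F z}.
Proof.
move=> h.
have := @ae_countable (int * int)%type (fun mn z =>
  F (z.1 + mn.1%:~R, z.2 + mn.2%:~R)%R = (e2pi (mn.1%:~R * z.2) * F z)%R).
move=> /(_ (fun mn => h mn.1 mn.2)); apply: filterS => z hz.
rewrite /quasiperiodize.
have := hz (- Num.floor z.1, - Num.floor z.2)%R; rewrite /= !mulrNz => ->.
by rewrite mulrA -e2piD mulNr addrN e2pi0 mul1r.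
Qed.

Lemma quasiperiodic_normc F (m n : int) (z : R * R) : quasiperiodic F ->
  normc (F (z.1 + m%:~R, z.2 + n%:~R)%R) = normc (F z).
Proof. by move=> ->; rewrite normcM normc_e2pi mul1r. Qed.

(** The effect on the Zak transform of the time-frequency shift of [gabor]. *)
Definition zshift (l : R * R) F (z : R * R) : R[i] :=
  (e2pi (l.1 * z.1) * F (z.1 - l.2, z.2 - l.1))%R.

Lemma cmeasurable_zshift l F :
  cmeasurable [set: plane] F -> cmeasurable [set: plane] (zshift l F).
Proof.
move=> mF; apply: cmeasurableM.
  apply: cmeasurable_e2pi; have := @measurable_linear R l.1 0 0.
  by under eq_fun do rewrite mul0r !addr0.
exact: (cmeasurable_comp (measurable_trans (- l.2) (- l.1)) mF).
Qed.

Lemma normc_zshift l F z : normc (zshift l F z) = normc (F (trans (- l.2) (- l.1) z)).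
Proof. by rewrite /zshift normcM normc_e2pi mul1r. Qed.

Lemma integral_zshift l F : cmeasurable [set: plane] F ->
  (forall z, normc (F (trans 1 0 z)) = normc (F z)) ->
  (forall z, normc (F (trans 0 1 z)) = normc (F z)) ->
  \int[mu2]_(z in box 0 1 0 1) (normc (zshift l F z) ^+ 2)%:E =
  \int[mu2]_(z in box 0 1 0 1) (normc (F z) ^+ 2)%:E.
Proof.
move=> mF h1 h2; pose u (z : plane) := (normc (F z) ^+ 2)%:E.
have mu_ : measurable_fun setT u by apply/measurable_EFinP; exact: measurable_normcX.
have u0 z : 0 <= u z by rewrite lee_fin sqr_ge0.
under eq_integral do rewrite normc_zshift.
rewrite -(@integral_box_trans R (- l.2) (- l.1) 0 1 0 1 u)// !add0r.
rewrite (addrC 1 (- l.2))%R (addrC 1 (- l.1))%R box_periodic// => z.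
  by rewrite /u h1.
by rewrite /u h2.
Qed.

(** The lower Riesz inequality for the shifted Zak transforms: the lattice points are
    sorted into classes modulo [q Z^2], with representatives [lam]. *)
Definition zshift_lower (q n : nat) (lam : 'I_n -> R * R) F (A : R) : Prop :=
  forall (s : seq ('I_n * (int * int))) (c : 'I_n * (int * int) -> R[i]), uniq s ->
  (A * \sum_(j <- s) normc (c j) ^+ 2)%:E <=
  \int[mu2]_(z in box 0 1 0 1) (normc (\sum_(j <- s) c j *
    zshift ((lam j.1).1 + q%:R * j.2.1%:~R, (lam j.1).2 + q%:R * (- j.2.2)%:~R) F z)%R ^+ 2)%:E.

End QuasiPeriodicity.

(** * The Zak transform of functions with bounded support *)

Section ZakTransform.
Local Open Scope ereal_scope.
Context {R : realType}.
Local Notation mu1 := (@lebesgue_measure R).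
Local Notation mu2 := (mu1 \x mu1).
Local Notation line := (measurableTypeR R).
Local Notation plane := (line * line)%type.
Implicit Types (f g h : R -> R[i]).

Definition supported_in (K : nat) f : Prop := forall x, (K%:R < `|x|)%R -> f x = 0%R.

Definition zak_term f (z : R * R) (k : R) : R[i] :=
  (f (z.1 + k) * e2pi (- (k * z.2)))%R.

Lemma zak_partialE f z N :
  zak_partial f z N = (\sum_(0 <= i < N.*2.+1) zak_term f z (i%:R - N%:R))%R.
Proof. by []. Qed.

Lemma zak_term_eq0 K f z (k : R) : supported_in K f ->
  (K%:R + `|z.1| < `|k|)%R -> zak_term f z k = 0%R.
Proof.
move=> fK hk; rewrite /zak_term fK ?mul0r//.
have := ler_normB (z.1 + k)%R z.1; rewrite addrAC subrr add0r.
by move=> h; rewrite -(ltrD2r `|z.1|%R); exact: lt_le_trans h.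
Qed.

Lemma zak_partial_step K f z N : supported_in K f -> (K%:R + `|z.1| <= N%:R)%R ->
  zak_partial f z N.+1 = zak_partial f z N.
Proof.
move=> fK hN; rewrite !zak_partialE doubleS.
rewrite big_nat_recl// big_nat_recr//= (@zak_term_eq0 K)//; last first.
  rewrite sub0r normrN (ger0_norm (ler0n _ _)) (le_lt_trans hN)// ltr_nat//.
rewrite [X in (_ + (_ + X))%R](@zak_term_eq0 K)//; last first.
  rewrite -natrB ?(ger0_norm (ler0n _ _))//; last by rewrite -addnn; lia.
  by rewrite (le_lt_trans hN)// ltr_nat -addnn; lia.
rewrite add0r addr0; apply: eq_bigr => i _.
by congr (zak_term f z _); rewrite -!natr1; ring.
Qed.

Lemma zak_partial_stable K f z N n : supported_in K f -> (K%:R + `|z.1| <= N%:R)%R ->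
  (N <= n)%N -> zak_partial f z n = zak_partial f z N.
Proof.
move=> fK hN /subnK <-; elim: (n - N)%N => [//|k IH].
by rewrite addSn (@zak_partial_step K)// (le_trans hN)// ler_nat leq_addl.
Qed.

Lemma zak_series_eq K f z N : supported_in K f -> (K%:R + `|z.1| <= N%:R)%R ->
  zak_series f z = zak_partial f z N.
Proof.
move=> fK hN; rewrite /zak_series.
have E (p : R[i] -> R) : limn (fun n => p (zak_partial f z n)) = p (zak_partial f z N).
  apply: lim_near_cst => //; near=> n.
  by rewrite (@zak_partial_stable K _ _ N)//; near: n; exact: nbhs_infty_ge.
by rewrite !E; case: (zak_partial f z N).
Unshelve. all: by end_near. Qed.

Lemma natr_bound (x : R) : exists N : nat, (x <= N%:R)%R.
Proof.
exists (Num.bound `|x|%R); apply: le_trans (ler_norm _) _.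
by apply: ltW; exact: archi_boundP.
Qed.

Lemma zak_series_trans1 K f z : supported_in K f ->
  zak_series f (trans 1 0 z) = (e2pi z.2 * zak_series f z)%R.
Proof.
move=> fK; have [N hN] := natr_bound (K%:R + (`|z.1| + 1)).
rewrite (@zak_series_eq K _ _ N)//; last first.
  apply: le_trans hN; rewrite lerD2l /=; apply: le_trans (ler_normD _ _) _.
  by rewrite normr1.
rewrite (@zak_series_eq K _ _ N)//; last first.
  by apply: le_trans hN; rewrite lerD2l lerDl.
have E (k : R) : zak_term f (trans 1 0 z) k = (e2pi z.2 * zak_term f z (k + 1))%R.
  rewrite /zak_term /trans /= addr0 mulrCA -e2piD.
  congr (f _ * e2pi _)%R; ring.
rewrite !zak_partialE; under eq_bigr do rewrite E.
rewrite -mulr_sumr; congr (_ * _)%R.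
transitivity (\sum_(0 <= i < N.*2.+2) zak_term f z (i%:R - N%:R))%R.
  rewrite [RHS]big_nat_recl// [X in (X + _)%R](@zak_term_eq0 K)//; last first.
    rewrite sub0r normrN (ger0_norm (ler0n _ _)); apply: lt_le_trans hN.
    by rewrite addrA ltrDl.
  rewrite add0r; apply: eq_bigr => i _.
  by congr (zak_term f z _); rewrite -!natr1; ring.
rewrite [LHS]big_nat_recr//= [X in (_ + X)%R](@zak_term_eq0 K) ?addr0//.
rewrite -natrB ?(ger0_norm (ler0n _ _))//; last by rewrite -addnn; lia.
apply: (@lt_le_trans _ _ N%:R); last by rewrite ler_nat -addnn; lia.
by apply: lt_le_trans hN; rewrite addrA ltrDl.
Qed.

Lemma zak_series_trans2 f z : zak_series f (trans 0 1 z) = zak_series f z.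
Proof.
have E N : zak_partial f (trans 0 1 z) N = zak_partial f z N.
  rewrite !zak_partialE; apply: eq_bigr => i _.
  rewrite /zak_term /trans /= addr0 mulrDr mulr1 opprD e2piD; congr (_ * _)%R.
  have -> : (- (i%:R - N%:R) = (N%:Z - i%:Z)%:~R :> R)%R.
    by rewrite intrB -!pmulrn opprB.
  by rewrite e2pi_int mulr1.
by rewrite /zak_series; congr Complex; under eq_fun do rewrite E.
Qed.

Lemma cmeasurable_zak_partial f N : cmeasurable [set: line] f ->
  cmeasurable [set: plane] (fun z => zak_partial f z N).
Proof.
move=> mf; under eq_fun do rewrite zak_partialE.
apply: cmeasurable_sum => i; apply: cmeasurableM.
  have m1 : measurable_fun setT (fun z : plane => (z.1 + (i%:R - N%:R))%R : line).
    exact: (measurableT_comp (measurable_addr _) measurable_fst).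
  exact: (cmeasurable_comp m1 mf).
apply: cmeasurable_e2pi; have := @measurable_linear R 0 (- (i%:R - N%:R)) 0.
by under eq_fun do rewrite mul0r add0r addr0 mulNr.
Qed.

Lemma cmeasurable_zak_series K f : supported_in K f ->
  cmeasurable [set: line] f -> cmeasurable [set: plane] (zak_series f).
Proof.
move=> fK mf.
have C (p : R[i] -> R) z : p (zak_partial f z N) @[N --> \oo] --> p (zak_series f z).
  have [N hN] := natr_bound (K%:R + `|z.1|)%R.
  rewrite (@zak_series_eq K _ _ N)//; apply: cvg_near_cst; near=> n.
  by rewrite (@zak_partial_stable K _ _ N)//; near: n; exact: nbhs_infty_ge.
split.
- apply: (@measurable_fun_cvg _ _ _ _ (fun N z => complex.Re (zak_partial f z N))).
    by move=> N; case: (@cmeasurable_zak_partial f N mf).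
  by move=> z _; exact: (C (@complex.Re R)).
- apply: (@measurable_fun_cvg _ _ _ _ (fun N z => complex.Im (zak_partial f z N))).
    by move=> N; case: (@cmeasurable_zak_partial f N mf).
  by move=> z _; exact: (C (@complex.Im R)).
Unshelve. all: by end_near. Qed.

Lemma zak_partial_gabor f l z N :
  zak_partial (gabor f l) z N = zshift l (fun z => zak_partial f z N) z.
Proof.
rewrite /zshift !zak_partialE mulr_sumr; apply: eq_bigr => i _.
rewrite /zak_term /gabor /= mulrAC -e2piD [RHS]mulrA mulrAC -e2piD mulrC [RHS]mulrC.
by congr (f _ * e2pi _)%R; ring.
Qed.

Lemma zak_partial_lincomb f c s z N :
  zak_partial (lincomb (gabor f) c s) z N =
  (\sum_(l <- s) c l * zak_partial (gabor f l) z N)%R.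
Proof.
rewrite zak_partialE; under [RHS]eq_bigr do rewrite zak_partialE mulr_sumr.
rewrite exchange_big /=; apply: eq_bigr => i _.
by rewrite /zak_term /lincomb mulr_suml; apply: eq_bigr => l _; rewrite mulrA.
Qed.

Lemma integral_box_fst (w : R -> R) (a b : R) : measurable_fun [set: line] w ->
  (forall x, 0 <= w x)%R -> (forall x, ~~ (a <= x < b)%R -> w x = 0%R) ->
  \int[mu2]_(z in box a b 0 1) (w z.1)%:E = \int[mu1]_(x in setT) (w x)%:E.
Proof.
move=> mw w0 ws; rewrite integral_mkcond.
set u := (_ \_ _).
have u0 z : 0 <= u z by apply: erestrict_ge0 => *; rewrite lee_fin.
have mu_ : measurable_fun setT u.
  apply/(measurable_restrictT _ _).1; first exact: measurable_box.
  apply: measurable_funTS; apply/measurable_EFinP.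
  exact: (measurableT_comp mw measurable_fst).
rewrite (fubini_tonelli1 u)//; apply: eq_integral => x _.
rewrite /fubini_F.
transitivity (\int[mu1]_(y in `[0%R, 1%R[%classic) (w x)%:E).
  rewrite [RHS]integral_mkcond; apply: eq_integral => y _.
  rewrite /u /patch.
  have [hx|hx] := boolP (a <= x < b)%R; last by rewrite ws//; case: ifP; case: ifP.
  congr (if _ then _ else _); apply/idP/idP; rewrite !inE /box /= in_itv /=.
    by case.
  by move=> ->.
transitivity ((w x)%:E * mu1 `[0%R, 1%R[%classic); first exact: nint_cst.
by rewrite lebesgue_measure_itv /= lte_fin ltr01 sube0 mule1.
Qed.

(** Parseval's identity in the second variable turns the integral over the unit square
    into a sum of integrals of [normc h ^ 2] over unit intervals tiling the line. *)
Lemma zak_parseval K h N : supported_in K h -> cmeasurable [set: line] h ->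
  (K < N)%N ->
  \int[mu2]_(z in box 0 1 0 1) (normc (zak_partial h z N) ^+ 2)%:E =
  \int[mu1]_(x in setT) (normc (h x) ^+ 2)%:E.
Proof.
move=> hK mh KN.
pose ks : seq int := [seq (N%:Z - i%:Z)%R | i <- iota 0 N.*2.+1].
have uks : uniq ks by rewrite map_inj_uniq ?iota_uniq// => i j; lia.
have [L [L0 hL]] := parseval_grid1 uks (R := R).
have LR : (0 < L%:R :> R)%R by rewrite ltr0n.
have E1 : (0 + L%:R * L%:R^-1 = 1 :> R)%R by rewrite add0r mulfV// gt_eqF.
pose w x := (normc (h x) ^+ 2)%R.
have mw : measurable_fun [set: line] w by exact: measurable_normcX.
have w0 x : (0 <= w x)%R by exact: sqr_ge0.
pose v (z : plane) := (\sum_(k <- ks) w (z.1 - k%:~R))%R.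
have mwt (t : R) : measurable_fun setT (fun z : plane => w (z.1 + t)%R).
  exact: (measurableT_comp mw (measurableT_comp (measurable_addr _) measurable_fst)).
have mv : measurable_fun setT v.
  by apply: measurable_sum => k; exact: mwt.
have v0 z : (0 <= v z)%R by apply: sumr_ge0.
pose u (z : plane) := (normc (zak_partial h z N) ^+ 2)%R.
have mu_ : measurable_fun setT u.
  by apply: measurable_normcX; exact: cmeasurable_zak_partial.
have u0 z : (0 <= u z)%R by exact: sqr_ge0.
have Eu z : (\sum_(r < L) u (trans 0 (r%:R * L%:R^-1) z))%R = (L%:R * v z)%R.
  rewrite -(hL (fun k => h (z.1 - k%:~R)%R) z.2); apply: eq_bigr => r _; congr (normc _ ^+ 2)%R.
  rewrite zak_partialE /ks big_map /index_iota subn0.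
  apply: eq_bigr => i _; rewrite /zak_term /trans /= addr0.
  by rewrite intrB -!pmulrn; congr (h _ * e2pi _)%R; ring.
have T (p : plane -> R) : measurable_fun setT p -> (forall z, 0 <= p z)%R ->
    \int[mu2]_(z in box 0 1 0 1) (p z)%:E =
    \int[mu2]_(z in box 0 1 0 (0 + L%:R^-1)) (\sum_(r < L) p (trans 0 (r%:R * L%:R^-1) z))%:E.
  move=> mp p0; rewrite -[X in box 0 1 0 X]E1 (@box_tile2 R _ _ _ _ _ (fun z => (p z)%:E)) ?invr_gt0//; last exact/measurable_EFinP.
  by apply: eq_integral => z _; rewrite sumEFin.
transitivity (\int[mu2]_(z in box 0 1 0 1) (v z)%:E).
  rewrite (T u)// (T v)//; apply: eq_integral => z _; rewrite Eu.
  under [in RHS]eq_bigr do rewrite /v /trans /= addr0.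
  by rewrite sumr_const card_ord mulr_natl.
rewrite -(@integral_box_fst w (- N%:R) (- N%:R + N.*2.+1%:R * 1))//; last first.
  move=> x; rewrite negb_and -ltNge -leNgt mulr1 => hx.
  have KNR : (K%:R < N%:R :> R)%R by rewrite ltr_nat.
  rewrite /w hK ?normc0 ?expr0n//; case/orP: hx => hx.
    by rewrite lter_normr; apply/orP; right; lra.
  rewrite lter_normr; apply/orP; left; move: hx.
  rewrite -addnn -addn1 !natrD; lra.
rewrite (@box_tile1 R _ _ _ _ _ (fun z => (w z.1)%:E))//; last 2 first.
- apply/measurable_EFinP; exact: (measurableT_comp mw measurable_fst).
- by move=> z; rewrite lee_fin.
pose W (z : plane) := \sum_(j < N.*2.+1) (w (trans (j%:R * 1) 0 z).1)%:E.
have mW : measurable_fun setT W.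
  by apply: emeasurable_sum => j; apply/measurable_EFinP; exact: mwt.
have W0 z : 0 <= W z by apply: sume_ge0 => j _; rewrite lee_fin.
transitivity (\int[mu2]_(z in box (- N%:R) (- N%:R + 1) 0 1) W z); last by [].
have := @integral_box_trans R (- N%:R) 0 0 1 0 1 W mW W0.
rewrite !add0r !addr0 (addrC 1 (- N%:R))%R => ->.
apply: eq_integral => z _; rewrite /W sumEFin; congr EFin; rewrite /v /ks big_map.
rewrite -[iota 0 _]/(index_iota 0 N.*2.+1) big_mkord; apply: eq_bigr => i _ /=.
by rewrite intrB -!pmulrn mulr1 opprB addrA addrAC.
Qed.

Lemma cmeasurable_gabor f l : cmeasurable [set: line] f ->
  cmeasurable [set: line] (gabor f l).
Proof.
move=> mf; apply: cmeasurableM.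
  apply: cmeasurable_e2pi; apply: measurable_funM; first exact: measurable_cst.
  exact: measurable_id.
exact: (cmeasurable_comp (measurable_addr (- l.2)) mf).
Qed.

Lemma cmeasurable_lincomb f c s : cmeasurable [set: line] f ->
  cmeasurable [set: line] (lincomb (gabor f) c s).
Proof.
move=> mf; apply: cmeasurable_sum => l; apply: cmeasurableM.
  exact: cmeasurable_cst.
exact: cmeasurable_gabor.
Qed.

Definition zcomb (F : R * R -> R[i]) (c : R * R -> R[i]) (s : seq (R * R)) z : R[i] :=
  (\sum_(l <- s) c l * zshift l F z)%R.

Lemma cmeasurable_zcomb F c s : cmeasurable [set: plane] F ->
  cmeasurable [set: plane] (zcomb F c s).
Proof.
move=> mf; apply: cmeasurable_sum => l; apply: cmeasurableM.
  exact: cmeasurable_cst.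
exact: cmeasurable_zshift.
Qed.

(** The combination of shifts has bounded support too, and on the unit square its Zak
    series is one partial sum, the same for all the terms. *)
Lemma zak_lincomb_norm K f c s : supported_in K f -> cmeasurable [set: line] f ->
  int_normc mu1 setT 2 (lincomb (gabor f) c s) =
  \int[mu2]_(z in box 0 1 0 1) (normc (zcomb (zak_series f) c s z) ^+ 2)%:E.
Proof.
move=> fK mf.
have [M hM] : exists M : nat, forall l, l \in s -> (`|l.2| <= M%:R)%R.
  elim: s => [|a s [M IH]]; first by exists 0%N.
  have [M' hM'] := natr_bound `|a.2|; exists (M + M')%N => l.
  rewrite inE natrD => /orP[/eqP ->|/IH h]; first by rewrite (le_trans hM')// lerDr.
  by rewrite (le_trans h)// lerDl.
pose N := (K + M).+1.
rewrite /int_normc -(@zak_parseval (K + M) _ N)//; last 2 first.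
- move=> x hx; rewrite /lincomb big_seq big1// => l ls.
  rewrite /gabor fK ?mulr0//.
  have := hM _ ls; have := ler_normB (x - l.2)%R (- l.2)%R; rewrite opprK subrK normrN.
  by move: hx; rewrite natrD; lra.
- exact: cmeasurable_lincomb.
apply: eq_integral => z; rewrite inE => -[/andP[z0 z1] _].
congr (normc _ ^+ 2)%:E; rewrite zak_partial_lincomb /zcomb big_seq [RHS]big_seq.
apply: eq_bigr => l ls; congr (_ * _)%R; rewrite zak_partial_gabor /zshift.
congr (_ * _)%R; rewrite (@zak_series_eq K _ _ N)//=.
have := hM _ ls; have := ler_normB z.1 l.2; rewrite /N -natr1 natrD.
by have := ger0_norm z0; lra.
Qed.

End ZakTransform.

(** * The lower Riesz inequality for Zak transforms *)

Section CombinationNorms.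
Local Open Scope ereal_scope.
Context {d : measure_display} {T : measurableType d} {R : realType}.
Variable mu : {measure set T -> \bar R}.

Lemma nint_sqr_comb_le (I : Type) (s : seq I) (c : I -> R[i]) (phi : I -> T -> R[i])
    (D : set T) (J : \bar R) : measurable D ->
  (forall i, cmeasurable setT (phi i)) ->
  (forall i, \int[mu]_(x in D) (normc (phi i x) ^+ 2)%:E = J) ->
  \int[mu]_(x in D) (normc (\sum_(i <- s) c i * phi i x)%R ^+ 2)%:E <=
  ((size s)%:R * \sum_(i <- s) normc (c i) ^+ 2)%R%:E * J.
Proof.
move=> mD mphi hJ.
have m1 i : measurable_fun setT (fun x => normc (phi i x) ^+ 2)%R.
  by apply: measurable_normcX.
have k0 i : (0 <= (size s)%:R * normc (c i) ^+ 2)%R by rewrite mulr_ge0 ?sqr_ge0.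
apply: (@le_trans _ _ (\int[mu]_(x in D)
    (\sum_(i <- s) ((size s)%:R * normc (c i) ^+ 2) * normc (phi i x) ^+ 2)%R%:E)).
  apply: nint_le => //.
  - apply: measurable_normcX; apply: cmeasurable_sum => i; apply: cmeasurableM.
      exact: cmeasurable_cst.
    exact: mphi.
  - apply: measurable_sum => i; apply: measurable_funM => //; exact: measurable_cst.
  - by move=> x; exact: sqr_ge0.
  - move=> x _; apply: le_trans (sqr_normc_sum_le _ _) _.
    rewrite mulr_sumr; apply: ler_sum => i _.
    by rewrite normcM exprMn mulrA.
rewrite nint_sum//; last 2 first.
- by move=> i; apply: measurable_funM => //; exact: measurable_cst.
- by move=> i x; rewrite mulr_ge0 ?sqr_ge0.
rewrite mulr_sumr -sumEFin ge0_sume_distrl; last first.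
  by move=> i _; rewrite lee_fin.
apply: lee_sum => i _; rewrite nintZ// ?hJ//.
by move=> x; exact: sqr_ge0.
Qed.

Lemma nint_sqrD_le (f g : T -> R[i]) (D : set T) : measurable D ->
  cmeasurable setT f -> cmeasurable setT g ->
  \int[mu]_(x in D) (normc (f x + g x)%R ^+ 2)%:E <=
  2%:E * \int[mu]_(x in D) (normc (f x) ^+ 2)%:E +
  2%:E * \int[mu]_(x in D) (normc (g x) ^+ 2)%:E.
Proof.
move=> mD mf mg.
have m h : cmeasurable setT h -> measurable_fun setT (fun x : T => normc (h x : R[i]) ^+ 2)%R.
  by move=> mh; apply: measurable_normcX.
have n0 (h : T -> R[i]) x : (0 <= normc (h x) ^+ 2)%R by exact: sqr_ge0.
have n2 (h : T -> R[i]) x : (0 <= 2 * normc (h x) ^+ 2)%R by rewrite mulr_ge0.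
have m2 h : cmeasurable setT h -> measurable_fun setT (fun x : T => 2 * normc (h x : R[i]) ^+ 2)%R.
  by move=> mh; apply: measurable_funM; [exact: measurable_cst|exact: m].
have Z h : cmeasurable setT h -> 2%:E * \int[mu]_(x in D) (normc (h x : R[i]) ^+ 2)%:E =
    \int[mu]_(x in D) (2 * normc (h x) ^+ 2)%:E.
  by move=> mh; rewrite nintZ//; exact: m.
rewrite (Z _ mf) (Z _ mg) -nintD//; [|exact: m2|exact: m2].
apply: nint_le => //.
- by apply: m; exact: cmeasurableD.
- by apply: measurable_funD; exact: m2.
- by move=> x; exact: sqr_ge0.
- by move=> x _; exact: sqr_normcD_le.
Qed.

Lemma dominated_small (D : set T) (u_ : nat -> T -> R) (w : T -> R) (eps : R) :
  measurable D -> (forall n, measurable_fun setT (u_ n)) -> measurable_fun setT w ->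
  (forall n x, 0 <= u_ n x <= w x)%R ->
  \int[mu]_(x in D) (w x)%:E < +oo ->
  {ae mu, forall x, D x -> u_ ^~ x @ \oo --> (0%R : R)} -> (0 < eps)%R ->
  exists n, \int[mu]_(x in D) (u_ n x)%:E < eps%:E.
Proof.
move=> mD mu_ mw uw wfin u0 eps0.
have w0 x : (0 <= w x)%R by have /andP[h1 h2] := uw 0%N x; exact: le_trans h2.
have mf_ n : measurable_fun D (EFin \o u_ n).
  by apply/measurable_EFinP; exact: measurable_funTS.
have mG : measurable_fun D (EFin \o w).
  by apply/measurable_EFinP; exact: measurable_funTS.
have iG : mu.-integrable D (EFin \o w).
  apply/integrableP; split => //; apply: le_lt_trans wfin.
  by apply: ge0_le_integral => // [|x _]; [exact: measurableT_comp|
    rewrite /= ger0_norm].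
have fG n x : `|(EFin \o u_ n) x| <= (EFin \o w) x.
  by have /andP[h1 h2] := uw n x; rewrite /= ger0_norm// lee_fin.
have f0 : {ae mu, forall x, D x -> (fun n => (EFin \o u_ n) x) @ \oo --> (cst 0 : T -> \bar R) x}.
  by apply: filterS u0 => x h Dx; apply: cvg_EFin; [exact: nearW|exact: h].
have [_ _] := @dominated_convergence _ T R mu D mD (fun n => EFin \o u_ n) (cst 0) (EFin \o w) mf_
  (measurable_cst 0) f0 iG (aeW _ (fun x n _ => fG n x)).
rewrite integral_cst// mul0e.
move=> /fine_cvgP[ffin].
move=> /cvgrPdist_lt /(_ _ eps0) h.
have [n [h1 h2]] : exists n, (\int[mu]_(x in D) (EFin \o u_ n) x) \is a fin_num /\
    (`|fine 0 - fine (\int[mu]_(x in D) (EFin \o u_ n) x)| < eps)%R.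
  have [n _ hn] := filterI ffin h.
  by exists n; apply: hn => /=.
exists n; rewrite -(fineK h1) lte_fin.
by move: h2; rewrite sub0r normrN; apply: le_lt_trans; exact: ler_norm.
Qed.

End CombinationNorms.

Section ZakLowerBound.
Local Open Scope ereal_scope.
Context {R : realType}.
Local Notation mu1 := (@lebesgue_measure R).
Local Notation mu2 := (mu1 \x mu1).
Local Notation line := (measurableTypeR R).
Local Notation plane := (line * line)%type.
Implicit Types (f g h : R -> R[i]).

Lemma nint_line_shift (b : R) (u : line -> R) : measurable_fun setT u ->
  (forall x, 0 <= u x)%R ->
  \int[mu1]_(x in setT) (u (x + b)%R)%:E = \int[mu1]_(x in setT) (u x)%:E.
Proof.
move=> mu_ u0.
have := @integral_shift _ line R mu1 (fun=> (fun x : line => x + b : line)%R).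
move=> H; have := H _ _ 0%R setT (fun x => (u x)%:E); rewrite preimage_setT; apply => //.
- by move=> _; exact: measurable_addr.
- by move=> _ A mA; exact: lebesgue_measure_addr.
- exact/measurable_EFinP.
Qed.

Lemma gabor_norm f l : cmeasurable [set: line] f ->
  \int[mu1]_(x in setT) (normc (gabor f l x) ^+ 2)%:E =
  \int[mu1]_(x in setT) (normc (f x) ^+ 2)%:E.
Proof.
move=> mf; rewrite -[RHS](@nint_line_shift (- l.2) (fun x => normc (f x) ^+ 2)%R).
- by apply: eq_integral => x _; rewrite /gabor normcM normc_e2pi mul1r.
- exact: measurable_normcX.
- by move=> x; exact: sqr_ge0.
Qed.

Definition truncate (n : nat) g (x : R) : R[i] :=
  (Complex (\1_(`[(- n%:R)%R, (n%:R)%R]%classic) x) 0 * g x)%R.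

Lemma truncate_in n g x : (`|x| <= n%:R)%R -> truncate n g x = g x.
Proof.
move=> hx; rewrite /truncate indicE mem_set ?mul1r//=.
by rewrite in_itv /= -ler_norml.
Qed.

Lemma truncate_out n g x : (n%:R < `|x|)%R -> truncate n g x = 0%R.
Proof.
move=> hx; rewrite /truncate indicE memNset ?mul0r//=.
by rewrite in_itv /= -ler_norml; apply/negP; rewrite -ltNge.
Qed.

Lemma cmeasurable_truncate n g : cmeasurable [set: line] g ->
  cmeasurable [set: line] (truncate n g).
Proof.
move=> mg; apply: cmeasurableM => //; split => /=; last exact: measurable_cst.
exact: measurable_indic.
Qed.

Lemma truncate_L2 n g : in_Lp mu1 setT 2 g -> in_Lp mu1 setT 2 (truncate n g).
Proof.
move=> [mg gfin]; have mt := cmeasurable_truncate n mg; split => //.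
apply: le_lt_trans gfin; apply: nint_le => //.
- exact: measurable_normcX.
- exact: measurable_normcX.
- by move=> x; exact: sqr_ge0.
- move=> x _; have [hx|hx] := leP `|x|%R (n%:R)%R; first by rewrite truncate_in.
  by rewrite truncate_out// normc0 expr0n sqr_ge0.
Qed.

Lemma truncate_L1 n g : in_Lp mu1 setT 2 g -> in_Lp mu1 setT 1 (truncate n g).
Proof.
move=> [mg gfin]; have mt := cmeasurable_truncate n mg; split => //.
pose A : set line := `[(- n%:R)%R, (n%:R)%R]%classic.
have mA : measurable A by exact: measurable_itv.
apply: (@le_lt_trans _ _ (\int[mu1]_(x in setT) ((\1_A x + normc (g x) ^+ 2)%R)%:E)).
  apply: nint_le => //.
  - exact: measurable_normcX.
  - apply: measurable_funD; first exact: measurable_indic.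
    exact: measurable_normcX.
  - by move=> x; rewrite expr1 normc_ge0.
  - move=> x _; rewrite expr1; have [hx|hx] := leP `|x|%R (n%:R)%R.
      rewrite truncate_in// indicE mem_set; last by rewrite /A /= in_itv /= -ler_norml.
      rewrite (_ : true%:R = 1)%R//; set t := normc (g x).
      have h : (0 <= (t - 1) ^+ 2)%R by exact: sqr_ge0.
      have h' : (0 <= t ^+ 2)%R by exact: sqr_ge0.
      nra.
    by rewrite truncate_out// normc0 addr_ge0 ?sqr_ge0// indicE.
rewrite nintD//; [|exact: measurable_normcX|by move=> x; exact: sqr_ge0].
rewrite integral_indic// setIT lte_add_pinfty//.
have : mu1 `[(- n%:R)%R, (n%:R)%R]%classic < +oo; last exact.
by rewrite lebesgue_measure_itv /=; case: ifP => _; rewrite -?EFinD ltry.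
Qed.

Lemma truncate_cvg g (eps : R) : in_Lp mu1 setT 2 g -> (0 < eps)%R ->
  exists n, int_normc mu1 setT 2 (fun x => truncate n g x - g x)%R < eps%:E.
Proof.
move=> [mg gfin] eps0.
apply: (@dominated_small _ _ _ mu1 setT (fun n x => normc (truncate n g x - g x) ^+ 2)%R
  (fun x => normc (g x) ^+ 2)%R) => //.
- move=> n; apply: measurable_normcX; apply: cmeasurableB => //.
  exact: cmeasurable_truncate.
- exact: measurable_normcX.
- move=> n x; rewrite sqr_ge0 /=; have [hx|hx] := leP `|x|%R (n%:R)%R.
    by rewrite truncate_in// subrr normc0 expr0n sqr_ge0.
  by rewrite truncate_out// sub0r normcN.
- apply: aeW => x _; have [N hN] := natr_bound `|x|%R.
  apply: cvg_near_cst; near=> n; rewrite truncate_in ?subrr ?normc0 ?expr0n//.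
  apply: (le_trans hN); rewrite ler_nat; near: n; exact: nbhs_infty_ge.
Unshelve. all: by end_near. Qed.

(** For a truncation of [g] the Zak series is a finite sum and the transform is an
    isometry; the combination of shifts being fixed, truncating [g] changes both sides
    by arbitrarily little. The factor 4 comes from [|x + y|^2 <= 2 |x|^2 + 2 |y|^2],
    applied on the line and on the square. *)
Lemma zak_lower (g : R -> R[i]) (F : R * R -> R[i]) (c : R * R -> R[i])
    (s : seq (R * R)) (A : R) :
  in_Lp mu1 setT 2 g -> cmeasurable [set: plane] F -> quasiperiodic F ->
  (forall eps : R, (0 < eps)%R -> exists2 delta : R, (0 < delta)%R &
        forall f K, supported_in K f -> in_Lp mu1 setT 1 f -> in_Lp mu1 setT 2 f ->
          (int_normc mu1 setT 2 (fun x => (f x - g x)%R) < delta%:E)%E ->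
          (int_normc mu2 (@unit_square R) 2 (fun z => (zak_series f z - F z)%R)
             < eps%:E)%E) ->
  A%:E <= int_normc mu1 setT 2 (lincomb (gabor g) c s) ->
  A%:E <= 4%:E * \int[mu2]_(z in box 0 1 0 1) (normc (zcomb F c s z) ^+ 2)%:E.
Proof.
move=> gL2 mF qF hF hA; have mg := gL2.1.
pose C : R := ((size s)%:R * \sum_(i <- s) normc (c i) ^+ 2)%R.
have C0 : (0 <= C)%R by rewrite mulr_ge0// sumr_ge0// => i _; exact: sqr_ge0.
set X := \int[mu2]_(z in _) _.
apply/lee_addgt0Pr => eps eps0.
pose e : R := (eps / (6 * C + 1))%R.
have e0 : (0 < e)%R by rewrite divr_gt0// ltr_wpDl// mulr_ge0.
have [delta delta0 hd] := hF _ e0.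
have de0 : (0 < Num.min delta e)%R by rewrite lt_min delta0 e0.
have [n hn] := truncate_cvg gL2 de0.
pose f := truncate n g.
have fK : supported_in n f by move=> x; exact: truncate_out.
have mf : cmeasurable [set: line] f := cmeasurable_truncate n mg.
have hfd : int_normc mu1 setT 2 (fun x => (f x - g x)%R) < delta%:E.
  by apply: lt_le_trans hn _; rewrite lee_fin ge_min lexx.
have hfe : int_normc mu1 setT 2 (fun x => (f x - g x)%R) <= e%:E.
  by apply: ltW; apply: lt_le_trans hn _; rewrite lee_fin ge_min lexx orbT.
have mZ := cmeasurable_zak_series fK mf.
pose U z := (zak_series f z - F z)%R.
have mU : cmeasurable [set: plane] U by exact: cmeasurableB.
have hU : \int[mu2]_(z in box 0 1 0 1) (normc (U z) ^+ 2)%:E <= e%:E.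
  have := hd f n fK (truncate_L1 n gL2) (truncate_L2 n gL2) hfd.
  rewrite unit_squareE /int_normc integral_cube_box; last 2 first.
  - by apply/measurable_EFinP; exact: measurable_normcX.
  - by move=> z; rewrite lee_fin sqr_ge0.
  by rewrite !add0r => /ltW.
have F1 z : F (trans 1 0 z) = (e2pi z.2 * F z)%R.
  by have := qF 1%R 0%R z; rewrite mul1r.
have F2 z : F (trans 0 1 z) = F z.
  by have := qF 0%R 1%R z; rewrite mul0r e2pi0 mul1r.
have U1 z : normc (U (trans 1 0 z)) = normc (U z).
  by rewrite /U F1 (zak_series_trans1 _ fK) -mulrBr normcM normc_e2pi mul1r.
have U2 z : normc (U (trans 0 1 z)) = normc (U z).
  by rewrite /U F2 zak_series_trans2.
have E2 : \int[mu2]_(z in box 0 1 0 1) (normc (zcomb U c s z) ^+ 2)%:E <= C%:E * e%:E.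
  apply: (@le_trans _ _ (C%:E * \int[mu2]_(z in box 0 1 0 1) (normc (U z) ^+ 2)%:E)).
    apply: nint_sqr_comb_le; first exact: measurable_box.
      by move=> l; exact: cmeasurable_zshift.
    by move=> l; exact: integral_zshift.
  by apply: lee_wpmul2l.
have E1 : int_normc mu1 setT 2 (lincomb (gabor (fun x => g x - f x)%R) c s) <= C%:E * e%:E.
  have mgf : cmeasurable [set: line] (fun x => g x - f x)%R by exact: cmeasurableB.
  apply: (@le_trans _ _ (C%:E * \int[mu1]_(x in setT) (normc (f x - g x)%R ^+ 2)%:E)).
    apply: nint_sqr_comb_le => //; first by move=> l; exact: cmeasurable_gabor.
    by move=> l; rewrite gabor_norm//; apply: eq_integral => x _; rewrite normc_distC.
  by apply: lee_wpmul2l.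
have L1 : int_normc mu1 setT 2 (lincomb (gabor g) c s) <=
    2%:E * int_normc mu1 setT 2 (lincomb (gabor f) c s) + 2%:E * (C%:E * e%:E).
  apply: (@le_trans _ _ (2%:E * int_normc mu1 setT 2 (lincomb (gabor f) c s) +
     2%:E * int_normc mu1 setT 2 (lincomb (gabor (fun x => g x - f x)%R) c s))).
    rewrite /int_normc.
    have -> : lincomb (gabor g) c s = (fun x => lincomb (gabor f) c s x +
        lincomb (gabor (fun x => g x - f x)) c s x)%R.
      apply/funext => x; rewrite /lincomb -big_split /=; apply: eq_bigr => l _.
      by rewrite -mulrDr /gabor -mulrDr /= [(f _ + _)%R]addrC subrK.
    apply: nint_sqrD_le => //; apply: cmeasurable_lincomb => //.
    exact: cmeasurableB.
  by apply: leeD => //; apply: lee_wpmul2l.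
have L2 : int_normc mu1 setT 2 (lincomb (gabor f) c s) <= 2%:E * X + 2%:E * (C%:E * e%:E).
  rewrite (@zak_lincomb_norm R n)//.
  apply: (@le_trans _ _ (2%:E * X + 2%:E *
     \int[mu2]_(z in box 0 1 0 1) (normc (zcomb U c s z) ^+ 2)%:E)).
    have -> : zcomb (zak_series f) c s = (fun z => zcomb F c s z + zcomb U c s z)%R.
      apply/funext => z; rewrite /zcomb -big_split /=; apply: eq_bigr => l _.
      by rewrite -mulrDr /zshift -mulrDr /U [(F _ + _)%R]addrC subrK.
    apply: nint_sqrD_le; first exact: measurable_box.
      exact: cmeasurable_zcomb.
    exact: cmeasurable_zcomb.
  by apply: leeD => //; apply: lee_wpmul2l.
apply: (le_trans hA); apply: (le_trans L1).
have X0 : 0 <= X by apply: nint_ge0 => z; exact: sqr_ge0.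
move: L2; set Y := int_normc mu1 setT 2 (lincomb (gabor f) c s); move=> L2.
apply: (@le_trans _ _ (2%:E * (2%:E * X + 2%:E * (C%:E * e%:E)) + 2%:E * (C%:E * e%:E))).
  by apply: leeD => //; apply: lee_wpmul2l.
have Ce : (2 * (2 * (C * e)) + 2 * (C * e) <= eps)%R.
  rewrite (_ : (2 * (2 * (C * e)) + 2 * (C * e) = 6 * C * e)%R); last by ring.
  by rewrite /e mulrCA ler_piMr ?(ltW eps0)// ler_pdivrMr ?mul1r; lra.
case: X X0 {L2} => [x _| _|//].
  change ((2 * (2 * x + 2 * (C * e)) + 2 * (C * e))%R%:E <= (4 * x + eps)%R%:E).
  by rewrite lee_fin; lra.
by rewrite [X in _ <= X + _]gt0_muley ?lte_fin// addye// leey.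
Qed.

End ZakLowerBound.

(** * Trigonometric polynomials of period 1 / q *)

Section TrigonometricPolynomials.
Context {R : realType}.
Variable q : nat.
Implicit Types (z : R * R) (p : R * R -> R[i]).

Definition tchar (m : int * int) z : R[i] :=
  e2pi (m.1%:~R * (q%:R * z.1) + m.2%:~R * (q%:R * z.2)).

(** The trigonometric polynomials of period [1 / q] in each variable; the terms need
    not be collected, which makes the closure under products immediate. *)
Definition trig p : Prop := exists s : seq (R[i] * (int * int)),
  p = fun z => \sum_(t <- s) t.1 * tchar t.2 z.

Lemma tcharM m m' z : tchar m z * tchar m' z = tchar (m.1 + m'.1, m.2 + m'.2) z.
Proof. by rewrite /tchar -e2piD !intrD; congr e2pi; ring. Qed.

Lemma trig_tchar m : trig (tchar m).
Proof. by exists [:: (1, m)]; apply/funext => z; rewrite big_seq1 mul1r. Qed.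

Lemma trigD p p' : trig p -> trig p' -> trig (fun z => p z + p' z).
Proof.
by move=> [s ->] [s' ->]; exists (s ++ s'); apply/funext => z; rewrite big_cat.
Qed.

Lemma trigM p p' : trig p -> trig p' -> trig (fun z => p z * p' z).
Proof.
move=> [s ->] [s' ->].
exists [seq (t.1 * t'.1, (t.2.1 + t'.2.1, t.2.2 + t'.2.2)) | t <- s, t' <- s'].
apply/funext => z; rewrite big_allpairs_dep big_distrl /=; apply: eq_bigr => t _.
rewrite big_distrr /=; apply: eq_bigr => t' _.
by rewrite -tcharM; ring.
Qed.

Lemma trig_cst (c : R[i]) : trig (fun=> c).
Proof.
exists [:: (c, (0, 0))]; apply/funext => z.
by rewrite big_seq1 /tchar /= !mul0r addr0 e2pi0 mulr1.
Qed.

Lemma trigX p n : trig p -> trig (fun z => p z ^+ n).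
Proof.
move=> tp; elim: n => [|n IH]; first exact: trig_cst.
by under eq_fun do rewrite exprS; exact: trigM.
Qed.

Lemma trigB p p' : trig p -> trig p' -> trig (fun z => p z - p' z).
Proof.
move=> tp tp'; under eq_fun do rewrite -mulN1r.
by apply: trigD => //; apply: trigM => //; exact: trig_cst.
Qed.

Lemma trig_uniq p : trig p -> exists (s : seq (int * int)) (c : int * int -> R[i]),
  uniq s /\ p = fun z => \sum_(m <- s) c m * tchar m z.
Proof.
move=> [s ->]; exists (undup [seq t.2 | t <- s]), (fun m => \sum_(t <- s | t.2 == m) t.1).
split; first exact: undup_uniq.
apply/funext => z; under [RHS]eq_bigr do rewrite mulr_suml big_mkcond /=.
rewrite exchange_big /= big_seq [RHS]big_seq; apply: eq_bigr => t ts.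
rewrite (bigD1_seq t.2) ?undup_uniq//= ?mem_undup ?map_f// eqxx big1 ?addr0//.
by move=> m; rewrite eq_sym => /negPf ->.
Qed.

Local Notation line := (measurableTypeR R).
Local Notation plane := (line * line)%type.

Lemma cmeasurable_tchar m : cmeasurable [set: plane] (tchar m).
Proof.
apply: cmeasurable_e2pi.
have := @measurable_linear R (m.1%:~R * q%:R) (m.2%:~R * q%:R) 0.
by under eq_fun do rewrite addr0 -!mulrA.
Qed.

Lemma cmeasurable_trig p : trig p -> cmeasurable [set: plane] p.
Proof.
move=> [s ->]; apply: cmeasurable_sum => t; apply: cmeasurableM.
  exact: cmeasurable_cst.
exact: cmeasurable_tchar.
Qed.

Hypothesis q0 : (0 < q)%N.

Lemma tchar_trans m (j k : nat) z :
  tchar m (trans (j%:R * q%:R^-1) (k%:R * q%:R^-1) z) = tchar m z.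
Proof.
have qR : q%:R != 0 :> R by rewrite pnatr_eq0 -lt0n.
have E : m.1%:~R * (q%:R * (z.1 + j%:R * q%:R^-1)) + m.2%:~R * (q%:R * (z.2 + k%:R * q%:R^-1))
  = m.1%:~R * (q%:R * z.1) + m.2%:~R * (q%:R * z.2) + (m.1 * j%:Z + m.2 * k%:Z)%:~R :> R.
  by rewrite intrD !intrM -!pmulrn; field.
by rewrite /tchar /trans /= E [LHS]e2piD e2pi_int mulr1.
Qed.

Lemma trig_trans p (j k : nat) z : trig p ->
  p (trans (j%:R * q%:R^-1) (k%:R * q%:R^-1) z) = p z.
Proof. by move=> [s ->]; apply: eq_bigr => t _; rewrite tchar_trans. Qed.

End TrigonometricPolynomials.

(** * The lower bound against trigonometric polynomials *)

Section FibreLowerBound.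
Local Open Scope ereal_scope.
Context {R : realType}.
Local Notation mu1 := (@lebesgue_measure R).
Local Notation mu2 := (mu1 \x mu1).
Local Notation line := (measurableTypeR R).
Local Notation plane := (line * line)%type.
Variables (q n : nat) (lam : 'I_n -> R * R) (F : R * R -> R[i]).
Hypothesis q0 : (0 < q)%N.
Hypothesis lam_int : forall k, exists c : int, (q%:R * (lam k).1 = c%:~R)%R.
Hypothesis mF : cmeasurable [set: plane] F.
Hypothesis qpF : quasiperiodic F.

Let tau : R := (q%:R^-1)%R.
Let qR : (0 < q%:R :> R)%R. Proof. by rewrite ltr0n. Qed.
Let tau0 : (0 < tau)%R. Proof. by rewrite invr_gt0. Qed.
Let qtau : (q%:R * tau = 1)%R. Proof. by rewrite mulfV// gt_eqF. Qed.

Lemma zshift_trans1 l z : zshift l F (trans 1 0 z) = (e2pi z.2 * zshift l F z)%R.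
Proof.
rewrite /zshift /trans /= !addr0.
have := qpF 1%R 0%R (z.1 - l.2, z.2 - l.1)%R; rewrite /= mul1r !addr0.
rewrite (addrAC z.1 (- l.2) 1)%R => ->.
rewrite mulrDr mulr1 !mulrA -!e2piD.
by have -> : (l.1 * z.1 + l.1 + (z.2 - l.1) = z.2 + l.1 * z.1)%R by ring.
Qed.

Lemma zshift_trans2 l z : zshift l F (trans 0 1 z) = zshift l F z.
Proof.
rewrite /zshift /trans /= !addr0.
have := qpF 0%R 1%R (z.1 - l.2, z.2 - l.1)%R; rewrite /= mul0r !addr0 e2pi0 mul1r.
by rewrite (addrAC z.2 (- l.1) 1)%R => ->.
Qed.

(** Quasi-periodicity turns the shift by a point of [q Z^2] into a phase, which is a
    character of period [1 / q] because [q (lam k).1] is an integer. *)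
Lemma zshift_lattice k (m : int * int) z :
  zshift ((lam k).1 + q%:R * m.1%:~R, (lam k).2 + q%:R * (- m.2)%:~R)%R F z =
  (tchar q m z * zshift (lam k) F z)%R.
Proof.
have [c hc] := lam_int k.
rewrite /zshift /tchar /=.
have := qpF (q%:Z * m.2)%R (- (q%:Z * m.1))%R (z.1 - (lam k).2, z.2 - (lam k).1)%R.
rewrite /=.
rewrite (_ : (z.1 - (lam k).2 + (q%:Z * m.2)%:~R = z.1 - ((lam k).2 + q%:R * (- m.2)%:~R))%R); last first.
  by rewrite !intrM mulrNz -pmulrn; ring.
rewrite (_ : (z.2 - (lam k).1 + (- (q%:Z * m.1))%:~R = z.2 - ((lam k).1 + q%:R * m.1%:~R))%R); last first.
  by rewrite mulrNz intrM -pmulrn; ring.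
move=> ->; rewrite !mulrA -!e2piD; congr (_ * _)%R.
have -> : (((lam k).1 + q%:R * m.1%:~R) * z.1 + (q%:Z * m.2)%:~R * (z.2 - (lam k).1) =
  m.1%:~R * (q%:R * z.1) + m.2%:~R * (q%:R * z.2) + (lam k).1 * z.1 + (- (m.2 * c))%:~R :> R)%R.
  by rewrite mulrNz !intrM -hc -pmulrn; ring.
rewrite [LHS]e2piD e2pi_int mulr1; congr e2pi; ring.
Qed.

Variable A : R.
Hypothesis A0 : (0 < A)%R.
Hypothesis lower : zshift_lower q lam F A.

Section FixedVector.
Variable v : 'I_n -> R[i].

Definition fibre (z : R * R) : R[i] := (\sum_i v i * zshift (lam i) F z)%R.

(** The squared norm of [v M(z)], where [M(z)] is the matrix of the values of the
    shifted Zak transforms over the points congruent to [z] modulo [(1 / q) Z^2]. *)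
Definition fibre_sqr (z : R * R) : R :=
  (\sum_(p : 'I_q * 'I_q) normc (fibre (trans (p.1%:R * tau) (p.2%:R * tau) z)) ^+ 2)%R.

Lemma cmeasurable_fibre : cmeasurable [set: plane] fibre.
Proof.
apply: cmeasurable_sum => i; apply: cmeasurableM; first exact: cmeasurable_cst.
exact: cmeasurable_zshift.
Qed.

Lemma measurable_fibre_sqr : measurable_fun [set: plane] fibre_sqr.
Proof.
apply: measurable_sum => p; apply: (@measurable_transl R _ _ _ _ (fun z => normc (fibre z) ^+ 2)%R).
by apply: measurable_normcX; exact: cmeasurable_fibre.
Qed.

Lemma fibre_sqr_ge0 z : (0 <= fibre_sqr z)%R.
Proof. by apply: sumr_ge0 => p _; exact: sqr_ge0. Qed.

Lemma fibre_trans1 z : normc (fibre (trans 1 0 z)) = normc (fibre z).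
Proof.
rewrite /fibre; under eq_bigr do rewrite zshift_trans1 mulrCA.
by rewrite -mulr_sumr normcM normc_e2pi mul1r.
Qed.

Lemma fibre_trans2 z : normc (fibre (trans 0 1 z)) = normc (fibre z).
Proof. by rewrite /fibre; under eq_bigr do rewrite zshift_trans2. Qed.

Let sum_shift (f : nat -> R) : f q = f 0%N ->
  (\sum_(j < q) f j.+1 = \sum_(j < q) f j)%R.
Proof.
move=> fq; rewrite -(big_mkord xpredT (fun j => f j.+1)) -(big_mkord xpredT f).
apply: (@addrI _ (f 0%N)); rewrite -big_nat_recl// -fq.
by rewrite big_nat_recr//= addrC.
Qed.

Lemma fibre_sqr_trans1 z : fibre_sqr (trans tau 0 z) = fibre_sqr z.
Proof.
rewrite /fibre_sqr -(pair_bigA _ (fun i j : 'I_q => normc (fibre (trans (i%:R * tau) (j%:R * tau) (trans tau 0 z))) ^+ 2)%R).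
rewrite -(pair_bigA _ (fun i j : 'I_q => normc (fibre (trans (i%:R * tau) (j%:R * tau) z)) ^+ 2)%R) /=.
pose f (i : nat) := (\sum_(j < q) normc (fibre (trans (i%:R * tau) (j%:R * tau) z)) ^+ 2)%R.
transitivity (\sum_(i < q) f i.+1)%R.
  apply: eq_bigr => i _; apply: eq_bigr => j _.
  by rewrite -transD addr0 -natr1 mulrDl mul1r.
apply: sum_shift; rewrite /f; apply: eq_bigr => j _.
rewrite qtau mul0r -(fibre_trans1 (trans 0 _ z)) -transD.
by rewrite addr0 add0r.
Qed.

Lemma fibre_sqr_trans2 z : fibre_sqr (trans 0 tau z) = fibre_sqr z.
Proof.
rewrite /fibre_sqr -(pair_bigA _ (fun i j : 'I_q => normc (fibre (trans (i%:R * tau) (j%:R * tau) (trans 0 tau z))) ^+ 2)%R).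
rewrite -(pair_bigA _ (fun i j : 'I_q => normc (fibre (trans (i%:R * tau) (j%:R * tau) z)) ^+ 2)%R) /=.
apply: eq_bigr => i _.
pose f (j : nat) := (normc (fibre (trans (i%:R * tau) (j%:R * tau) z)) ^+ 2)%R.
transitivity (\sum_(j < q) f j.+1)%R.
  by apply: eq_bigr => j _; rewrite -transD addr0 /f -natr1 mulrDl mul1r.
apply: sum_shift; rewrite /f.
rewrite qtau mul0r -(fibre_trans2 (trans _ 0 z)) -transD.
by rewrite addr0 add0r.
Qed.

Let nv : R := (\sum_i normc (v i) ^+ 2)%R.

(** The coefficients [v i * c m], with [c] those of [p], are inserted in the lower
    inequality, where the shifts by [q Z^2] act as characters and assemble into [p].
    As [p] has period [1 / q], the unit square then folds onto the cell of side [1 / q],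
    and the sum over the sheets is [fibre_sqr]. *)
Lemma trig_lower p : trig q p ->
  (A * q%:R ^+ 2 * nv)%:E * \int[mu2]_(z in box 0 tau 0 tau) (normc (p z) ^+ 2)%:E <=
  \int[mu2]_(z in box 0 tau 0 tau) (normc (p z) ^+ 2 * fibre_sqr z)%:E.
Proof.
move=> tp; have mp := cmeasurable_trig tp.
have mp2 : measurable_fun [set: plane] (fun z => normc (p z) ^+ 2)%R by exact: measurable_normcX.
have Tile (u : plane -> R) : measurable_fun setT u -> (forall z, 0 <= u z)%R ->
    \int[mu2]_(z in box 0 1 0 1) (u z)%:E = \int[mu2]_(z in box 0 tau 0 tau)
      (\sum_(r : 'I_q * 'I_q) u (trans (r.1%:R * tau) (r.2%:R * tau) z))%:E.
  move=> mu_ u0; have -> : box 0 1 0 1 = box 0 (q%:R * tau) 0 (q%:R * tau) by rewrite qtau.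
  rewrite (@box_tile R tau q (fun z => (u z)%:E))//.
    by apply: eq_integral => z _; rewrite sumEFin.
  exact/measurable_EFinP.
have E1 : \int[mu2]_(z in box 0 1 0 1) (normc (p z) ^+ 2)%:E =
   (q%:R ^+ 2)%:E * \int[mu2]_(z in box 0 tau 0 tau) (normc (p z) ^+ 2)%:E.
  rewrite Tile//; last by move=> z; exact: sqr_ge0.
  rewrite -nintZ ?sqr_ge0//; last 2 first.
  - exact: measurable_box.
  - by move=> z; exact: sqr_ge0.
  apply: eq_integral => z _; congr EFin.
  under eq_bigr do rewrite trig_trans//.
  by rewrite sumr_const card_prod card_ord -[LHS]mulr_natl natrM expr2.
have E2 : \int[mu2]_(z in box 0 1 0 1) (normc (p z * fibre z)%R ^+ 2)%:E =
   \int[mu2]_(z in box 0 tau 0 tau) (normc (p z) ^+ 2 * fibre_sqr z)%:E.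
  rewrite Tile; last 2 first.
  - apply: measurable_normcX; apply: cmeasurableM => //; exact: cmeasurable_fibre.
  - by move=> z; exact: sqr_ge0.
  apply: eq_integral => z _; congr EFin; rewrite /fibre_sqr mulr_sumr.
  by apply: eq_bigr => r _; rewrite normcM exprMn trig_trans.
have [s [c [us pE]]] := trig_uniq tp.
have Pp : \int[mu2]_(z in box 0 1 0 1) (normc (p z) ^+ 2)%:E = (\sum_(m <- s) normc (c m) ^+ 2)%R%:E.
  pose qm (m : int * int) : int * int := (m.1 * q%:Z, m.2 * q%:Z)%R.
  have qinj : injective qm.
    have q0' : (q%:Z != 0)%R by rewrite -lt0n.
    by move=> [m1 m2] [m1' m2'] [/(mulIf q0') -> /(mulIf q0') ->].
  pose c' (m : int * int) := c ((m.1 %/ q%:Z)%Z, (m.2 %/ q%:Z)%Z).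
  have c'E m : c' (qm m) = c m.
    by rewrite /c' /qm /= !mulzK// -?lt0n//; case: m.
  have := @trig_parseval R [seq qm m | m <- s] c'.
  rewrite map_inj_uniq// => /(_ us); rewrite big_map.
  under [in RHS]eq_bigr do rewrite c'E.
  move=> <-; apply: eq_integral => z _; rewrite pE big_map; congr (normc _ ^+ 2)%:E.
  apply: eq_bigr => m _; rewrite c'E /tchar /qm /= !intrM -!pmulrn.
  by congr (_ * e2pi _)%R; ring.
rewrite -E2 mulrAC EFinM -[leLHS]muleA -E1 Pp -EFinM.
pose sv := [seq (i, m) | i <- enum 'I_n, m <- s].
have usv : uniq sv by rewrite allpairs_uniq ?enum_uniq// => -[? ?] [? ?].
have := lower (fun im => v im.1 * c im.2)%R usv.
rewrite big_allpairs big_enum /=.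
have -> : (\sum_(i : 'I_n) \sum_(m <- s) normc (v i * c m) ^+ 2 = nv * \sum_(m <- s) normc (c m) ^+ 2)%R.
  rewrite /nv mulr_suml; apply: eq_bigr => i _; rewrite mulr_sumr.
  by apply: eq_bigr => m _; rewrite normcM exprMn.
rewrite mulrA => h; apply: (le_trans h); rewrite le_eqVlt; apply/orP; left; apply/eqP.
apply: eq_integral => z _; congr (normc _ ^+ 2)%:E.
rewrite big_allpairs big_enum /= /fibre mulr_sumr; apply: eq_bigr => i _.
rewrite pE mulr_suml; apply: eq_bigr => m _.
by rewrite zshift_lattice; ring.
Qed.

Lemma fibre_sqr_integrable :
  \int[mu2]_(z in box 0 1 0 1) (normc (F z) ^+ 2)%:E < +oo ->
  \int[mu2]_(z in box 0 tau 0 tau) (fibre_sqr z)%:E < +oo.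
Proof.
move=> Ffin.
have -> : \int[mu2]_(z in box 0 tau 0 tau) (fibre_sqr z)%:E =
    \int[mu2]_(z in box 0 1 0 1) (normc (fibre z) ^+ 2)%:E.
  have -> : box 0 1 0 1 = box 0 (q%:R * tau) 0 (q%:R * tau) by rewrite qtau.
  rewrite (@box_tile R tau q (fun z => (normc (fibre z) ^+ 2)%:E))//.
  - by apply: eq_integral => z _; rewrite sumEFin.
  - by apply/measurable_EFinP; apply: measurable_normcX; exact: cmeasurable_fibre.
  - by move=> z; rewrite lee_fin sqr_ge0.
apply: (@le_lt_trans _ _ (((size (index_enum 'I_n))%:R * \sum_(i : 'I_n) normc (v i) ^+ 2)%R%:E *
   \int[mu2]_(z in box 0 1 0 1) (normc (F z) ^+ 2)%:E)).
  apply: nint_sqr_comb_le; first exact: measurable_box.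
    by move=> i; exact: cmeasurable_zshift.
  move=> i; apply: integral_zshift => // z.
    by have := quasiperiodic_normc 1 0 z qpF.
  by have := quasiperiodic_normc 0 1 z qpF.
apply: lte_mul_pinfty => //; rewrite lee_fin mulr_ge0// sumr_ge0// => i _; exact: sqr_ge0.
Qed.

End FixedVector.
End FibreLowerBound.

(** * Approximation of indicators by trigonometric polynomials *)

Section SteepPolynomials.
Context {R : realType}.
Implicit Types y : R.

(** The Brosowski-Deutsch polynomials: they are near 1 below 1/2 and near 0 above. *)
Definition steep (n : nat) y : R := (1 - y ^+ n) ^+ (2 ^ n).

Lemma bernoulli_le (x : R) K : 0 <= x <= 1 -> 1 - K%:R * x <= (1 - x) ^+ K.
Proof.
move=> /andP[x0 x1]; elim: K => [|K IH]; first by rewrite mul0r subr0 expr0.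
rewrite exprS -natr1; have K0 : 0 <= K%:R :> R by rewrite ler0n.
have : (1 - x) * (1 - K%:R * x) <= (1 - x) * (1 - x) ^+ K by rewrite ler_wpM2l// subr_ge0.
have : 0 <= K%:R * x * x by rewrite !mulr_ge0.
nra.
Qed.

Lemma bernoulli_ge (x : R) K : 0 <= x <= 1 -> (1 - x) ^+ K * (1 + K%:R * x) <= 1.
Proof.
move=> /andP[x0 x1]; elim: K => [|K IH]; first by rewrite mul0r addr0 expr0 mulr1.
have K0 : 0 <= K%:R :> R by rewrite ler0n.
apply: le_trans IH; rewrite exprSr -mulrA ler_wpM2l ?exprn_ge0 ?subr_ge0//.
rewrite -natr1; have : 0 <= K%:R * x * x by rewrite !mulr_ge0.
nra.
Qed.

Lemma steep_ge0_le1 n y : 0 <= y <= 1 -> 0 <= steep n y <= 1.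
Proof.
move=> /andP[y0 y1]; have yn0 : 0 <= y ^+ n by rewrite exprn_ge0.
have yn1 : y ^+ n <= 1 by rewrite exprn_ile1.
by rewrite /steep exprn_ge0 ?subr_ge0//= exprn_ile1 ?subr_ge0// gerBl.
Qed.

Lemma steep_cvg1 y : 0 <= y < 2^-1 -> steep ^~ y @ \oo --> (1 : R).
Proof.
move=> /andP[y0 y1].
have h : (fun n => 1 - (2 * y) ^+ n) @ \oo --> (1 : R).
  rewrite -[X in _ --> X]subr0; apply: cvgB; first exact: cvg_cst.
  by apply: cvg_expr; rewrite ger0_norm ?mulr_ge0//; lra.
apply: squeeze_cvgr h (cvg_cst _); near=> n.
have yy : 0 <= y <= 1 by rewrite y0; lra.
have /andP[_ ->] := steep_ge0_le1 n yy; rewrite andbT exprMn -natrX.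
by apply: bernoulli_le; rewrite exprn_ge0//= exprn_ile1//; lra.
Unshelve. all: by end_near. Qed.

Lemma steep_cvg0 y : 2^-1 < y <= 1 -> steep ^~ y @ \oo --> (0 : R).
Proof.
move=> /andP[y0 y1]; have yp : 0 < 2 * y by lra.
have h : (fun n => ((2 * y)^-1) ^+ n) @ \oo --> (0 : R).
  apply: cvg_expr; rewrite ger0_norm ?invr_ge0 ?(ltW yp)// invf_lt1//; lra.
apply: squeeze_cvgr (cvg_cst 0) h; near=> n.
have yy : 0 <= y <= 1 by apply/andP; split => //; lra.
have /andP[-> _] := steep_ge0_le1 n yy; rewrite andTb exprVn.
have z0 : 0 < (2 * y) ^+ n by rewrite exprn_gt0.
have := @bernoulli_ge (y ^+ n) (2 ^ n)%N; rewrite -/(steep n y) natrX -exprMn => H.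
have yn : 0 <= y ^+ n <= 1.
  by rewrite exprn_ge0 ?exprn_ile1//; lra.
rewrite -(ler_pM2r z0) mulVf ?gt_eqF//; apply: le_trans (H yn).
have /andP[s0 _] := steep_ge0_le1 n yy.
by rewrite ler_wpM2l// lerDr.
Unshelve. all: by end_near. Qed.

End SteepPolynomials.

Section Density.
Context {R : realType}.
Local Notation mu1 := (@lebesgue_measure R).
Local Notation mu2 := (mu1 \x mu1)%E.
Local Notation line := (measurableTypeR R).
Local Notation plane := (line * line)%type.
Variables (q : nat) (w : R * R -> R).
Hypothesis q0 : (0 < q)%N.
Let tau : R := q%:R^-1.
Local Notation D := (box 0 tau 0 tau).
Hypothesis mw : measurable_fun [set: plane] w.
Hypothesis w0 : forall z, 0 <= w z.
Hypothesis wfin : (\int[mu2]_(z in D) (w z)%:E < +oo)%E.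

Let qR : 0 < q%:R :> R. Proof. by rewrite ltr0n. Qed.
Let tau0 : 0 < tau. Proof. by rewrite invr_gt0. Qed.
Let qtau : q%:R * tau = 1. Proof. by rewrite mulfV// gt_eqF. Qed.
Let mD : measurable (D : set plane). Proof. exact: measurable_box. Qed.

(** The squared distance in the space L^2 of the cell for the weight [w]. *)
Definition wdist (f g : R * R -> R[i]) : \bar R :=
  (\int[mu2]_(z in D) (normc (f z - g z) ^+ 2 * w z)%:E)%E.

Let mwd f g : cmeasurable [set: plane] f -> cmeasurable [set: plane] g ->
  measurable_fun [set: plane] (fun z => normc (f z - g z) ^+ 2 * w z).
Proof.
move=> mf mg; apply: measurable_funM => //; apply: measurable_normcX.
exact: cmeasurableB.
Qed.

Lemma wdist_triangle f g h : cmeasurable [set: plane] f ->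
  cmeasurable [set: plane] g -> cmeasurable [set: plane] h ->
  (wdist f h <= 2%:E * wdist f g + 2%:E * wdist g h)%E.
Proof.
move=> mf mg mh.
have p0 (k k' : R * R -> R[i]) z : 0 <= normc (k z - k' z) ^+ 2 * w z.
  by rewrite mulr_ge0 ?sqr_ge0.
have p2 (k k' : R * R -> R[i]) z : 0 <= 2 * (normc (k z - k' z) ^+ 2 * w z).
  by rewrite mulr_ge0.
have Z k k' : cmeasurable [set: plane] k -> cmeasurable [set: plane] k' ->
   (2%:E * wdist k k' = \int[mu2]_(z in D) (2 * (normc (k z - k' z) ^+ 2 * w z))%:E)%E.
  by move=> mk mk'; rewrite /wdist nintZ//; exact: mwd.
have m2 k k' : cmeasurable [set: plane] k -> cmeasurable [set: plane] k' ->
   measurable_fun [set: plane] (fun z => 2 * (normc (k z - k' z) ^+ 2 * w z)).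
  by move=> mk mk'; apply: measurable_funM; [exact: measurable_cst|exact: mwd].
rewrite !Z// -nintD//; [|exact: m2|exact: m2].
apply: nint_le => //; first exact: mwd.
  by apply: measurable_funD; exact: m2.
move=> z _; rewrite (_ : f z - h z = (f z - g z) + (g z - h z)); last by rewrite addrA subrK.
rewrite [leRHS](_ : _ = (2 * normc (f z - g z) ^+ 2 + 2 * normc (g z - h z) ^+ 2) * w z).
  by apply: ler_wpM2r => //; exact: sqr_normcD_le.
by ring.
Qed.

Definition approximable (f : R * R -> R[i]) : Prop :=
  forall eps : R, 0 < eps -> exists p, trig q p /\ (wdist p f <= eps%:E)%E.

Lemma approximable_lim f : cmeasurable [set: plane] f ->
  (forall eps : R, 0 < eps -> exists g,
     [/\ cmeasurable [set: plane] g, approximable g & (wdist g f <= eps%:E)%E]) ->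
  approximable f.
Proof.
move=> mf hf eps eps0; have e4 : 0 < eps / 4 by rewrite divr_gt0.
have [g [mg ag gf]] := hf _ e4; have [p [tp pg]] := ag _ e4.
exists p; split=> //; apply: le_trans (wdist_triangle (cmeasurable_trig tp) mg mf) _.
apply: (@le_trans _ _ (2%:E * (eps / 4)%:E + 2%:E * (eps / 4)%:E)%E).
  by apply: leeD; apply: lee_wpmul2l.
by rewrite -!EFinM -EFinD lee_fin; lra.
Qed.

Lemma wdist_add f g f' g' : cmeasurable [set: plane] f ->
  cmeasurable [set: plane] g -> cmeasurable [set: plane] f' ->
  cmeasurable [set: plane] g' ->
  (wdist (fun z => f z + g z)%R (fun z => f' z + g' z)%R
    <= 2%:E * wdist f f' + 2%:E * wdist g g')%E.
Proof.
move=> mf mg mf' mg'.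
apply: le_trans (@wdist_triangle _ (fun z => f' z + g z) _ _ _ _) _;
  try exact: cmeasurableD.
apply: leeD; apply: lee_wpmul2l => //; rewrite le_eqVlt; apply/orP; left; apply/eqP;
  apply: eq_integral => z _.
  by rewrite (_ : f z + g z - (f' z + g z) = f z - f' z); last by ring.
by rewrite (_ : f' z + g z - (f' z + g' z) = g z - g' z); last by ring.
Qed.

Lemma approximableD f g : cmeasurable [set: plane] f ->
  cmeasurable [set: plane] g -> approximable f -> approximable g ->
  approximable (fun z => f z + g z).
Proof.
move=> mf mg af ag eps eps0; have e4 : 0 < eps / 4 by rewrite divr_gt0.
have [p [tp pf]] := af _ e4; have [p' [tp' pg]] := ag _ e4.
exists (fun z => p z + p' z); split; first exact: trigD.
apply: le_trans (wdist_add (cmeasurable_trig tp) (cmeasurable_trig tp') mf mg) _.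
apply: (@le_trans _ _ (2%:E * (eps / 4)%:E + 2%:E * (eps / 4)%:E)%E).
  by apply: leeD; apply: lee_wpmul2l.
by rewrite -!EFinM -EFinD lee_fin; lra.
Qed.

Lemma approximableN f : approximable f -> approximable (fun z => - f z).
Proof.
move=> af eps eps0; have [p [tp pf]] := af _ eps0.
exists (fun z => 0 - p z); split; first by apply: trigB => //; exact: trig_cst.
apply: le_trans pf; rewrite le_eqVlt; apply/orP; left; apply/eqP.
by apply: eq_integral => z _; rewrite sub0r opprK addrC normc_distC.
Qed.

Lemma approximable_trig p : trig q p -> approximable p.
Proof.
move=> tp eps eps0; exists p; split=> //; rewrite /wdist.
under eq_integral do rewrite subrr normc0 expr0n mul0r.
by rewrite integral0 lee_fin ltW.
Qed.

Definition cindic (E : set (R * R)) (z : R * R) : R[i] := real_complex R (\1_E z).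

Lemma cmeasurable_cindic (E : set plane) : measurable E ->
  cmeasurable [set: plane] (cindic E).
Proof. by move=> mE; split => /=; [exact: measurable_indic|exact: measurable_cst]. Qed.

Lemma approximable_setD (E E' : set plane) : measurable E -> measurable E' -> E `<=` E' ->
  approximable (cindic E) -> approximable (cindic E') -> approximable (cindic (E' `\` E)).
Proof.
move=> mE mE' EE' aE aE'.
have -> : cindic (E' `\` E) = (fun z => cindic E' z + - cindic E z).
  apply/funext => z; rewrite /cindic -rmorphN -rmorphD; congr (real_complex R _).
  rewrite !indicE in_setD.
  have [zE|zE] /= := boolP (z \in E); last by rewrite andbT subr0.
  by rewrite andbF mem_set ?subrr//; apply: EE'; exact: set_mem.
apply: approximableD => //; try exact: cmeasurable_cindic.
  by apply: cmeasurableN; exact: cmeasurable_cindic.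
exact: approximableN.
Qed.

Lemma approximable_bigcup (E : nat -> set plane) : (forall k, measurable (E k)) ->
  trivIset setT E -> (forall k, approximable (cindic (E k))) ->
  approximable (cindic (\bigcup_k E k)).
Proof.
move=> mE tE aE.
pose S n z : R[i] := \sum_(0 <= k < n) cindic (E k) z.
have mS n : cmeasurable [set: plane] (S n).
  by apply: cmeasurable_sum => k; exact: cmeasurable_cindic.
have aS n : approximable (S n).
  elim: n => [|n IH].
    rewrite (_ : S 0%N = fun=> 0); first exact: approximable_trig (trig_cst _ _).
    by apply/funext => z; rewrite /S big_nil.
  rewrite (_ : S n.+1 = fun z => S n z + cindic (E n) z).
    by apply: approximableD => //; exact: cmeasurable_cindic.
  by apply/funext => z; rewrite /S big_nat_recr.
have SE z k n : E k z -> S n z = if (k < n)%N then 1 else 0.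
  move=> Ek; have out j : j != k -> cindic (E j) z = 0.
    move=> jk; rewrite /cindic indicE memNset ?rmorph0// => Ej.
    by move/eqP: jk; apply; apply: (tE j k) => //; exists z.
  have inn : cindic (E k) z = 1 by rewrite /cindic indicE mem_set.
  rewrite /S; case: ifPn => kn.
    rewrite (bigD1_seq k) ?mem_index_iota ?iota_uniq//= inn big1 ?addr0//.
  rewrite big_nat big1// => j /andP[_ jn]; apply: out.
  by apply: contraNneq kn => <-.
have mU : measurable (\bigcup_k E k : set plane) by exact: bigcupT_measurable.
apply: approximable_lim; first exact: cmeasurable_cindic.
move=> eps eps0.
suff [n hn] : exists n, (wdist (S n) (cindic (\bigcup_k E k)) < eps%:E)%E.
  by exists (S n); split => //; exact: ltW.
apply: (@dominated_small _ plane R mu2 D (fun n z => normc (S n z - cindic (\bigcup_k E k) z) ^+ 2 * w z) w) => //.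
- by move=> n; apply: mwd => //; exact: cmeasurable_cindic.
- move=> n z; rewrite mulr_ge0 ?sqr_ge0//= ler_piMl//.
  have [[k _ Ek]|nE] := pselect ((\bigcup_k E k) z).
    rewrite (SE _ _ _ Ek) /cindic indicE mem_set; last by exists k.
    by case: ifP => _; rewrite ?subrr ?sub0r ?normcN ?normc0 ?normc1 ?expr0n ?expr1n//.
  rewrite /cindic indicE memNset// /S big1 ?subrr ?normc0 ?expr0n// => k _.
  by rewrite /cindic indicE memNset// => Ek; apply: nE; exists k.
- apply: aeW => z _; have [[k _ Ek]|nE] := pselect ((\bigcup_k E k) z); last first.
    apply: cvg_near_cst; apply: nearW => n.
    rewrite /cindic indicE memNset// /S big1 ?subrr ?normc0 ?expr0n ?mul0r// => k _.
    by rewrite /cindic indicE memNset// => Ek; apply: nE; exists k.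
  apply: cvg_near_cst; near=> n; rewrite (SE _ _ _ Ek) ifT; last first.
    by near: n; exact: nbhs_infty_gt.
  rewrite /cindic indicE mem_set; last by exists k.
  by rewrite subrr normc0 expr0n mul0r.
Unshelve. all: by end_near. Qed.

(** A function whose level 1/2 separates the part [x < a] of the period ]0, tau[;
    the difference of cosines is [2 sin (pi q x) sin (pi q (a - x))]. *)
Definition arc (a x : R) : R :=
  2^-1 - (cos (2 * pi * (q%:R * x - q%:R * a / 2)) - cos (pi * (q%:R * a))) / 4.

Lemma arc_ge0_le1 a x : 0 <= arc a x <= 1.
Proof.
rewrite /arc; set A := cos _; set B := cos _.
have : `|A| <= 1 by exact: cos_max. have : `|B| <= 1 by exact: cos_max.
rewrite !ler_norml => /andP[? ?] /andP[? ?]; apply/andP; split; lra.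
Qed.

Lemma arcE a x : arc a x = 2^-1 - sin (pi * (q%:R * x)) * sin (pi * (q%:R * (a - x))) / 2.
Proof.
rewrite /arc.
have -> : 2 * pi * (q%:R * x - q%:R * a / 2) = pi * (q%:R * x) - pi * (q%:R * (a - x)) by field.
have -> : pi * (q%:R * a) = pi * (q%:R * x) + pi * (q%:R * (a - x)) by ring.
by rewrite cosB cosD; field.
Qed.

Let pi_period x : 0 < x < tau -> 0 < pi * (q%:R * x) < pi.
Proof.
move=> /andP[x0 x1]; rewrite !mulr_gt0 ?pi_gt0//= gtr_pMr ?pi_gt0//.
have : q%:R * x < q%:R * tau by rewrite ltr_pM2l.
by rewrite qtau.
Qed.

Lemma arc_lt a x : 0 < x -> x < a -> a < tau -> arc a x < 2^-1.
Proof.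
move=> x0 xa at'; rewrite arcE.
have s1 : 0 < sin (pi * (q%:R * x)) by apply/sin_gt0_pi/pi_period; lra.
have s2 : 0 < sin (pi * (q%:R * (a - x))) by apply/sin_gt0_pi/pi_period; lra.
have := mulr_gt0 s1 s2; lra.
Qed.

Lemma arc_gt a x : 0 < a -> a < x -> x < tau -> 2^-1 < arc a x.
Proof.
move=> x0 xa at'; rewrite arcE.
have s1 : 0 < sin (pi * (q%:R * x)) by apply/sin_gt0_pi/pi_period; lra.
have s2 : 0 < sin (pi * (q%:R * (x - a))) by apply/sin_gt0_pi/pi_period; lra.
rewrite (_ : pi * (q%:R * (a - x)) = - (pi * (q%:R * (x - a)))); last by ring.
rewrite sinN; have := mulr_gt0 s1 s2; lra.
Qed.

Let trig_arc (phi : R * R -> R) (m : int * int) a :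
  (forall z, m.1%:~R * (q%:R * z.1) + m.2%:~R * (q%:R * z.2) = q%:R * phi z) ->
  trig q (fun z => real_complex R (arc a (phi z))).
Proof.
move=> hm.
have E z : real_complex R (arc a (phi z)) = real_complex R (2^-1 + cos (pi * (q%:R * a)) / 4) -
    real_complex R 8^-1 * (tchar q m z * e2pi (- (q%:R * a / 2)) +
       tchar q (- m.1, - m.2) z * e2pi (q%:R * a / 2)).
  rewrite /tchar hm /= !mulrNz !mulNr -opprD hm -!e2piD.
  set t := q%:R * phi z; set s := q%:R * a / 2.
  rewrite /arc -/t -/s /e2pi.
  have -> : - t + s = - (t - s) by rewrite opprB addrC.
  rewrite mulrN cosN sinN; apply/eqP; rewrite eq_complex /=; apply/andP; split; apply/eqP; by field.
rewrite (funext E).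
apply: trigB; first exact: trig_cst.
apply: trigM; first exact: trig_cst.
by apply: trigD; apply: trigM; solve [exact: trig_tchar | exact: trig_cst].
Qed.

Let ray_or_line (A : set line) : Prop := A = setT \/ exists a, A = `]-oo, a[%classic.

(** When the end point of the ray lies inside the period, by composing [steep] with [arc];
    otherwise the indicator is constant on the period. *)
Let ray_limit (A : set line) : ray_or_line A ->
  exists (b : R) (t : nat -> R -> R), [/\ forall n x, 0 <= t n x <= 1,
    forall n, trig q (fun z => real_complex R (t n z.1)),
    forall n, trig q (fun z => real_complex R (t n z.2)) &
    forall x, 0 < x < tau -> x != b -> t ^~ x @ \oo --> (\1_A x : R)].
Proof.
have cst_case (c : bool) : (forall x, 0 < x < tau -> \1_A x = c%:R :> R) ->
  exists (b : R) (t : nat -> R -> R), [/\ forall n x, 0 <= t n x <= 1,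
    forall n, trig q (fun z => real_complex R (t n z.1)),
    forall n, trig q (fun z => real_complex R (t n z.2)) &
    forall x, 0 < x < tau -> x != b -> t ^~ x @ \oo --> (\1_A x : R)].
  move=> h; exists 0, (fun _ _ => c%:R); split.
  - by move=> _ _; case: c {h}; rewrite ?ler01 ?lexx.
  - by move=> _; exact: trig_cst.
  - by move=> _; exact: trig_cst.
  - by move=> x hx _; rewrite h//; exact: cvg_cst.
case=> [AT|[a Aa]].
  by apply: (cst_case true) => x _; rewrite AT indicE mem_set.
have [a0|a0] := leP a 0.
  apply: (cst_case false) => x /andP[x0 _]; rewrite Aa indicE memNset//= in_itv /=.
  by apply/negP; rewrite -leNgt; lra.
have [at'|at'] := leP tau a.
  apply: (cst_case true) => x /andP[_ x1]; rewrite Aa indicE mem_set//= in_itv /=.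
  by lra.
have T (phi : R * R -> R) : trig q (fun z => real_complex R (arc a (phi z))) ->
    forall n, trig q (fun z => real_complex R (steep n (arc a (phi z)))).
  move=> tphi n.
  have E z : real_complex R (steep n (arc a (phi z))) =
      (1 - real_complex R (arc a (phi z)) ^+ n) ^+ (2 ^ n).
    by rewrite /steep rmorphXn rmorphB rmorph1 rmorphXn.
  rewrite (funext E).
  by apply: trigX; apply: trigB; [exact: trig_cst|exact: trigX].
exists a, (fun n x => steep n (arc a x)); split.
- by move=> n x; apply: steep_ge0_le1; exact: arc_ge0_le1.
- by apply: T; apply: (@trig_arc fst (1, 0)) => z; rewrite /= mul1r mul0r addr0.
- by apply: T; apply: (@trig_arc snd (0, 1)) => z; rewrite /= mul1r mul0r add0r.
- move=> x /andP[x0 x1] xa; have /andP[r0 r1] := arc_ge0_le1 a x.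
  rewrite Aa; have [xlt|xgt|xE] := ltgtP x a.
  + rewrite indicE mem_set; last by rewrite /= in_itv.
    by apply: steep_cvg1; rewrite r0 arc_lt.
  + rewrite indicE memNset; last by rewrite /= in_itv /=; apply/negP; rewrite -leNgt ltW.
    by apply: steep_cvg0; rewrite r1 arc_gt.
  + by rewrite xE eqxx in xa.
Qed.

Let mray (A : set line) : ray_or_line A -> measurable A.
Proof. by case=> [->|[a ->]]. Qed.

Let approximable_rays (A B : set line) : ray_or_line A -> ray_or_line B ->
  approximable (cindic (A `*` B)).
Proof.
move=> hA hB; have mAB : measurable (A `*` B : set plane) by apply: measurableX; exact: mray.
have [a [t [t01 tt1 _ tc]]] := ray_limit hA; have [b [r [r01 _ rt2 rc]]] := ray_limit hB.
pose p n z : R[i] := real_complex R (t n z.1) * real_complex R (r n z.2).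
have tp n : trig q (p n) by exact: trigM.
apply: approximable_lim; first exact: cmeasurable_cindic.
move=> eps eps0.
suff [n hn] : exists n, (wdist (p n) (cindic (A `*` B)) < eps%:E)%E.
  exists (p n); split => //; [exact: cmeasurable_trig|exact: approximable_trig|exact: ltW].
have E n z : normc (p n z - cindic (A `*` B) z) = `|t n z.1 * r n z.2 - \1_A z.1 * \1_B z.2|.
  rewrite /p /cindic -rmorphM -rmorphB /= expr0n addr0 sqrtr_sqr.
  congr (`| _ - _ |); rewrite !indicE in_setX.
  by case: (_ \in A); case: (_ \in B); rewrite ?mulr1 ?mulr0 ?mul0r.
apply: (@dominated_small _ plane R mu2 D (fun n z => normc (p n z - cindic (A `*` B) z) ^+ 2 * w z) w) => //.
- by move=> n; apply: mwd; [exact: cmeasurable_trig|exact: cmeasurable_cindic].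
- move=> n z; rewrite E; apply/andP; split; first by rewrite mulr_ge0 ?sqr_ge0.
  rewrite ler_piMl// expr_le1//.
  have /andP[h1 h2] := t01 n z.1; have /andP[h3 h4] := r01 n z.2.
  have k0 : 0 <= t n z.1 * r n z.2 by rewrite mulr_ge0.
  have k1 : t n z.1 * r n z.2 <= 1 by rewrite mulr_ile1.
  rewrite !indicE; case: (_ \in A); case: (_ \in B); rewrite /= ?mulr1 ?mulr0 ?mul0r ler_norml; lra.
- pose N : set plane := cross 0 0 `|` cross a b.
  have mN : measurable N by apply: measurableU; exact: measurable_cross.
  have N0 : mu2 N = 0%E.
    apply: null_set_setU.
    - exact: measurable_cross.
    - exact: measurable_cross.
    - exact: null_cross.
    - exact: null_cross.
  have C z : D z -> ~ N z ->
      (fun n => normc (p n z - cindic (A `*` B) z) ^+ 2 * w z) @ \oo --> (0 : R).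
    move=> [/andP[x0 x1] /andP[y0 y1]] nN.
    have x0' : 0 < z.1.
      by rewrite lt_neqAle x0 andbT eq_sym; apply/eqP => e; apply: nN; left; left.
    have y0' : 0 < z.2.
      by rewrite lt_neqAle y0 andbT eq_sym; apply/eqP => e; apply: nN; left; right.
    have xa : z.1 != a by apply/eqP => e; apply: nN; right; left.
    have yb : z.2 != b by apply/eqP => e; apply: nN; right; right.
    have cx := tc z.1; have cy := rc z.2.
    rewrite x0' x1 in cx; rewrite y0' y1 in cy.
    pose e n : R := t n z.1 * r n z.2 - \1_A z.1 * \1_B z.2.
    have ce0 : e @ \oo --> (0 : R).
      rewrite -(subrr (\1_A z.1 * \1_B z.2 : R)); apply: cvgB; last exact: cvg_cst.
      by apply: cvgM; [exact: cx|exact: cy].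
    have ce : (fun n => `|e n|) @ \oo --> (0 : R).
      by rewrite -(normr0 R); apply: cvg_norm; exact: ce0.
    have cee : (fun n => (`|e n| * `|e n|) * w z) @ \oo --> (0 * 0 * w z : R).
      by apply: cvgM; [apply: cvgM|exact: cvg_cst].
    rewrite !mul0r in cee; apply: cvg_trans cee; apply: near_eq_cvg; apply: nearW => n.
    by rewrite E expr2.
  exists N; split => // z hz; apply: contrapT => nN; apply: hz => Dz; exact: C.
Qed.

Let rays : set (set line) := [set A | exists a, A = `]-oo, a[%classic].

Let rays_sigma : @measurable _ line = <<s rays >>.
Proof. exact: RGenInftyO.measurableE. Qed.

Let rays_setI : setI_closed rays.
Proof.
move=> _ _ [a ->] [b ->]; exists (Num.min a b); apply/seteqP; split => x /=;
  rewrite !in_itv /= lt_min.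
  by move=> [-> ->].
by move=> /andP[].
Qed.

(** Two successive Dynkin arguments, one in each variable, lead from rays to Borel sets,
    and a third one from rectangles to Borel subsets of the plane. *)
Let approximable_rect (A B : set line) : measurable A -> measurable B ->
  approximable (cindic (A `*` B)).
Proof.
have mX (X Y : set line) : measurable X -> measurable Y -> measurable (X `*` Y : set plane).
  by move=> mX mY; exact: (@measurableX _ _ line line).
have step1 (Y : set line) : ray_or_line Y -> forall X : set line, measurable X ->
    approximable (cindic (X `*` Y)).
  move=> hY X mX'; have mY := mray hY; rewrite rays_sigma in mX'.
  move: X mX'; apply: (@dynkin_induction _ line rays) => //.
  - by apply: approximable_rays => //; left.
  - by move=> X hX; apply: approximable_rays => //; right.
  - move=> X mX' aX; rewrite (_ : ~` X `*` Y = (setT `*` Y) `\` (X `*` Y)).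
      apply: approximable_setD => //; try exact: mX.
      + by move=> z [].
      + by apply: approximable_rays => //; left.
    apply/seteqP; split => z /=; first by move=> [h1 h2]; split => // -[].
    by move=> [[_ h2] h]; split => // h1; apply: h.
  - move=> E mE tE aE; rewrite setX_bigcupl.
    apply: approximable_bigcup => // [k|]; first exact: mX.
    move=> i j _ _ [z [[h1 _] [h2 _]]]; apply: (tE i j) => //; exists z.1; split => //.
move=> mA; rewrite rays_sigma; move: B; apply: (@dynkin_induction _ line rays) => //.
- by apply: step1 => //; left.
- by move=> Y hY; apply: step1 => //; right.
- move=> Y mY aY; rewrite (_ : A `*` ~` Y = (A `*` setT) `\` (A `*` Y)).
    apply: approximable_setD => //; try exact: mX.
    + by move=> z [].
    + by apply: step1 => //; left.
  apply/seteqP; split => z /=; first by move=> [h1 h2]; split => // -[].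
  by move=> [[h1 _] h]; split => // h2; apply: h.
- move=> E mE tE aE; rewrite setX_bigcupr.
  apply: approximable_bigcup => // [k|]; first exact: mX.
  move=> i j _ _ [z [[_ h1] [_ h2]]]; apply: (tE i j) => //; exists z.2; split => //.
Qed.

Lemma approximable_indic (E : set plane) : measurable E -> approximable (cindic E).
Proof.
pose G : set (set plane) := [set A `*` B | A in @measurable _ line & B in @measurable _ line].
have GE : @measurable _ plane = <<s G >> by rewrite measurable_prod_measurableType.
rewrite GE; move: E; apply: (@dynkin_induction _ plane G) => //.
- move=> _ _ [A mA [B mB <-]] [A' mA' [B' mB' <-]].
  exists (A `&` A'); first exact: measurableI.
  by exists (B `&` B'); [exact: measurableI|rewrite setXI].
- rewrite -setXTT; exact: approximable_rect.
- by move=> _ [A mA [B mB <-]]; exact: approximable_rect.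
- move=> E mE aE; rewrite -setTD; apply: approximable_setD => //.
  by rewrite -setXTT; exact: approximable_rect.
- by move=> E mE tE aE; exact: approximable_bigcup.
Qed.

End Density.

(** * The lower bound at almost every point *)

Section FibreBound.
Local Open Scope ereal_scope.
Context {R : realType}.
Local Notation mu1 := (@lebesgue_measure R).
Local Notation mu2 := (mu1 \x mu1).
Local Notation line := (measurableTypeR R).
Local Notation plane := (line * line)%type.
Variables (q n : nat) (lam : 'I_n -> R * R) (F : R * R -> R[i]).
Hypothesis q0 : (0 < q)%N.
Hypothesis lam_int : forall k, exists c : int, (q%:R * (lam k).1 = c%:~R)%R.
Hypothesis mF : cmeasurable [set: plane] F.
Hypothesis qpF : quasiperiodic F.
Hypothesis Ffin : \int[mu2]_(z in box 0 1 0 1) (normc (F z) ^+ 2)%:E < +oo.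
Variable A : R.
Hypothesis A0 : (0 < A)%R.
Hypothesis lower : zshift_lower q lam F A.
Variable v : 'I_n -> R[i].

Let tau : R := (q%:R^-1)%R.
Let qR : (0 < q%:R :> R)%R. Proof. by rewrite ltr0n. Qed.
Let tau0 : (0 < tau)%R. Proof. by rewrite invr_gt0. Qed.
Local Notation D := (box 0 tau 0 tau).
Let mD : measurable (D : set plane). Proof. exact: measurable_box. Qed.
Local Notation S := (fibre_sqr q lam F v).
Let kappa : R := (A * q%:R ^+ 2 * \sum_i normc (v i) ^+ 2)%R.

Let kappa0 : (0 <= kappa)%R.
Proof.
rewrite /kappa !mulr_ge0 ?exprn_ge0 ?ler0n ?(ltW A0)//.
by apply: sumr_ge0 => i _; exact: sqr_ge0.
Qed.

Let mS : measurable_fun [set: plane] S.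
Proof. exact: measurable_fibre_sqr. Qed.

Let S0 z : (0 <= S z)%R. Proof. exact: fibre_sqr_ge0. Qed.

Let Sfin : \int[mu2]_(z in D) (S z)%:E < +oo.
Proof. exact: fibre_sqr_integrable. Qed.

Let DE : mu2 D = (tau * tau)%:E.
Proof. by rewrite measure_box ?(ltW tau0)// !subr0. Qed.

Let wfin : \int[mu2]_(z in D) (S z + 1)%:E < +oo.
Proof.
rewrite nintD// lte_add_pinfty//.
have -> : \int[mu2]_(z in D) 1%:E = 1%:E * mu2 D by exact: nint_cst.
by rewrite DE -EFinM ltry.
Qed.

Let bad : set plane := [set z | S z < kappa / 8]%R.

Let mbad : measurable bad.
Proof.
rewrite (_ : bad = S @^-1` `]-oo, (kappa / 8)%R[%classic).
  by rewrite -[X in measurable X]setTI; exact: mS.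
by apply/seteqP; split => z /=; rewrite in_itv.
Qed.

(** The lower bound against squared moduli of trigonometric polynomials extends, by
    density in the space of square integrable functions for the weight [S + 1], to
    the indicator of the set where the desired bound fails, which is then null. *)
Lemma fibre_lower_cell : mu2 (D `&` bad) = 0.
Proof.
have [k0|k0] := eqVneq kappa 0%R.
  rewrite (_ : _ `&` _ = set0) ?measure0//; apply/seteqP; split => // z [_].
  by rewrite /bad /= k0 mul0r ltNge S0.
have kp : (0 < kappa)%R by rewrite lt_neqAle eq_sym k0.
have mw : measurable_fun [set: plane] (fun z => S z + 1)%R.
  by apply: measurable_funD => //; exact: measurable_cst.
have w0 z : (0 <= S z + 1)%R by rewrite addr_ge0.
have approx := @approximable_indic R q (fun z => S z + 1)%R q0 mw w0 wfin bad mbad.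
pose f := @cindic R bad.
have mf : cmeasurable [set: plane] f by exact: cmeasurable_cindic.
have f2 z : (normc (f z) ^+ 2 = \1_bad z)%R.
  by rewrite /f /cindic /= expr0n addr0 sqr_sqrtr ?sqr_ge0// indicE; case: (_ \in _); rewrite ?expr1n ?expr0n.
have m2 g : cmeasurable [set: plane] g -> measurable_fun [set: plane] (fun z => normc (g z : R[i]) ^+ 2)%R.
  by move=> mg; exact: measurable_normcX.
have n2 (g : plane -> R[i]) z : (0 <= normc (g z) ^+ 2)%R by exact: sqr_ge0.
pose I := \int[mu2]_(z in D) (normc (f z) ^+ 2)%:E.
have IE : I = mu2 (D `&` bad).
  rewrite /I (eq_integral (fun z => (\1_bad z)%:E)) => [|z _]; last by rewrite f2.
  by rewrite integral_indic// setIC.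
have Ifin : I \is a fin_num.
  rewrite ge0_fin_numE ?nint_ge0// IE.
  apply: (@le_lt_trans _ _ (mu2 D)); last by rewrite DE ltry.
  by apply: le_measure; rewrite ?inE//; exact: measurableI.
suff h : (fine I <= 0)%R.
  rewrite -IE -(fineK Ifin); congr EFin; apply/eqP; rewrite eq_le h /=.
  by apply: fine_ge0; exact: nint_ge0.
suff h : forall e : R, (0 < e)%R -> (kappa / 2 * fine I <= (4 + 2 * kappa) * e)%R.
  rewrite leNgt; apply/negP => I0.
  have k4 : (0 < 4 + 2 * kappa)%R by lra.
  have e0 : (0 < kappa / 4 * fine I / (4 + 2 * kappa))%R.
    by rewrite divr_gt0// mulr_gt0// divr_gt0.
  have := h _ e0; rewrite mulrCA mulfV ?gt_eqF// mulr1.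
  have := mulr_gt0 kp I0; lra.
move=> e e0; have [p [tp pf]] := approx _ e0.
have mp := cmeasurable_trig tp.
have mfp : cmeasurable [set: plane] (fun z => f z - p z)%R by exact: cmeasurableB.
have mS2 g : cmeasurable [set: plane] g -> measurable_fun [set: plane] (fun z => normc (g z : R[i]) ^+ 2 * S z)%R.
  by move=> mg; apply: measurable_funM => //; exact: m2.
have nS2 (g : plane -> R[i]) z : (0 <= normc (g z) ^+ 2 * S z)%R by rewrite mulr_ge0.
pose P := \int[mu2]_(z in D) (normc (p z) ^+ 2)%:E.
have W1 : \int[mu2]_(z in D) (normc (f z - p z)%R ^+ 2)%:E <= e%:E.
  apply: le_trans pf; apply: nint_le => //.
  - by apply: m2.
  - apply: measurable_funM => //; apply: m2; exact: cmeasurableB.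
  - by move=> z; exact: sqr_ge0.
  - by move=> z _; rewrite normc_distC ler_peMr ?sqr_ge0 ?lerDr.
have W2 : \int[mu2]_(z in D) (normc (p z - f z)%R ^+ 2 * S z)%:E <= e%:E.
  apply: le_trans pf; apply: nint_le => //.
  - by apply: mS2; exact: cmeasurableB.
  - apply: measurable_funM => //; apply: m2; exact: cmeasurableB.
  - by move=> z; rewrite mulr_ge0 ?sqr_ge0.
  - by move=> z _; rewrite ler_wpM2l ?sqr_ge0// lerDl.
have H1 : I <= 2%:E * P + 2%:E * e%:E.
  have := @nint_sqrD_le _ plane R mu2 p (fun z => f z - p z)%R D mD mp mfp.
  under eq_integral do rewrite addrC subrK.
  move=> h; apply: le_trans h _; apply: leeD => //; exact: lee_wpmul2l.
have H2 : kappa%:E * P <= \int[mu2]_(z in D) (normc (p z) ^+ 2 * S z)%:E.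
  exact: trig_lower.
have H3 : \int[mu2]_(z in D) (normc (p z) ^+ 2 * S z)%:E <= (kappa / 4)%:E * I + 2%:E * e%:E.
  apply: (@le_trans _ _ (\int[mu2]_(z in D) (kappa / 4 * normc (f z) ^+ 2 + 2 * (normc (p z - f z) ^+ 2 * S z))%R%:E)).
    apply: nint_le => //.
    - exact: mS2.
    - apply: measurable_funD; apply: measurable_funM; try exact: measurable_cst.
        exact: m2.
      by apply: mS2; exact: cmeasurableB.
    - move=> z _.
      have h1 : (normc (p z) ^+ 2 <= 2 * normc (f z) ^+ 2 + 2 * normc (p z - f z) ^+ 2)%R.
        by have := sqr_normcD_le (f z) (p z - f z)%R; rewrite addrC subrK.
      have h2 : (normc (f z) ^+ 2 * S z <= kappa / 8 * normc (f z) ^+ 2)%R.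
        rewrite f2 indicE; case: (boolP (z \in bad)) => [zb|_]; last by rewrite mul0r mulr0.
        by rewrite mul1r mulr1; apply/ltW; exact: (set_mem zb).
      have h3 : (normc (p z) ^+ 2 * S z <=
          (2 * normc (f z) ^+ 2 + 2 * normc (p z - f z) ^+ 2) * S z)%R by rewrite ler_wpM2r.
      move: h2 h3; set x := normc (f z); set y := normc (p z - f z)%R.
      by set t := normc (p z); set s := S z; lra.
  rewrite nintD//; last 4 first.
  - by apply: measurable_funM; [exact: measurable_cst|exact: m2].
  - by apply: measurable_funM; [exact: measurable_cst|apply: mS2; exact: cmeasurableB].
  - by move=> z; rewrite mulr_ge0// divr_ge0.
  - by move=> z; rewrite mulr_ge0// mulr_ge0 ?sqr_ge0.
  rewrite nintZ//; [|exact: m2|by rewrite divr_ge0].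
  rewrite nintZ//; [|by apply: mS2; exact: cmeasurableB|by move=> z; rewrite mulr_ge0 ?sqr_ge0].
  by apply: leeD => //; apply: lee_wpmul2l.
have Pfin : P \is a fin_num.
  rewrite ge0_fin_numE ?nint_ge0//; rewrite ltNge leye_eq; apply/negP => /eqP PE.
  have := le_trans H2 H3; rewrite PE gt0_muley ?lte_fin// -(fineK Ifin).
  by rewrite -!EFinM -EFinD leye_eq.
set i := fine I; set x := fine P.
have IE' : I = i%:E by rewrite fineK.
have PE' : P = x%:E by rewrite fineK.
have h1 : (i <= 2 * x + 2 * e)%R by move: H1; rewrite IE' PE' -!EFinM -EFinD lee_fin.
have h2 : (kappa * x <= kappa / 4 * i + 2 * e)%R.
  by have := le_trans H2 H3; rewrite IE' PE' -!EFinM -EFinD lee_fin.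
have h3 : (kappa * i <= kappa * (2 * x + 2 * e))%R by rewrite ler_wpM2l.
by move: h2 h3; set k := kappa; lra.
Qed.

(** [fibre_sqr] has period [1 / q], so its bad set is null in every box of that side. *)
Lemma fibre_lower_ae a b d : (d < tau)%R ->
  {ae mu2, forall z, cube a b d z ->
     (A * q%:R ^+ 2 / 8 * \sum_i normc (v i) ^+ 2 <= S z)%R}.
Proof.
move=> dt; pose u (z : plane) : R := \1_bad z.
have mu_ : measurable_fun [set: plane] (fun z => (u z)%:E).
  by apply/measurable_EFinP; exact: measurable_indic.
have u0 z : 0 <= (u z)%:E by rewrite lee_fin.
have ind (z z' : plane) : S z = S z' -> (u z)%:E = (u z')%:E.
  move=> SE; rewrite /u !indicE; congr ((_ : bool)%:R)%:E.
  by apply/idP/idP => /set_mem h; apply/mem_set; move: h; rewrite /bad /= SE.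
have := @box_periodic R tau a b (fun z => (u z)%:E) tau0 mu_ u0.
move=> /(_ (fun z => ind _ _ (fibre_sqr_trans1 lam q0 qpF v z)) (fun z => ind _ _ (fibre_sqr_trans2 lam q0 qpF v z))).
have mB : measurable (box a (a + tau) b (b + tau) : set plane) by exact: measurable_box.
rewrite !integral_indic// ![bad `&` _]setIC => E.
exists (box a (a + tau) b (b + tau) `&` bad); split.
- exact: measurableI.
- by rewrite [LHS]E; exact: fibre_lower_cell.
- move=> z /= /not_implyP[/cubeE[/andP[h1 h2] /andP[h3 h4]] h]; split.
    by split; apply/andP; split => //; [apply: le_lt_trans h2 _|apply: le_lt_trans h4 _];
      rewrite ltrD2l.
  by move/negP: h; rewrite -ltNge /bad /= /kappa [X in (_ < X)%R -> _]mulrAC.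
Qed.

End FibreBound.

(** * Averages over cubes *)

Section Averages.
Context {R : realType}.
Local Notation mu1 := (@lebesgue_measure R).
Local Notation mu2 := (mu1 \x mu1)%E.
Local Notation line := (measurableTypeR R).
Local Notation plane := (line * line)%type.
Implicit Types (F G : R * R -> R[i]) (D : set (R * R)).

Definition cintegrable D F : Prop :=
  cmeasurable [set: plane] F /\ (\int[mu2]_(z in D) (normc (F z))%:E < +oo)%E.

Let part_integrable (p : R[i] -> R) (D : set plane) F : (forall z, `|p z| <= normc z) ->
  measurable_fun [set: plane] (p \o F) -> measurable D -> cintegrable D F ->
  mu2.-integrable D (EFin \o (p \o F)).
Proof.
move=> hp mp mD [mF Ffin]; apply/integrableP; split.
  by apply/measurable_EFinP; exact: measurable_funTS.
apply: le_lt_trans Ffin; apply: nint_le => //.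
- exact: measurableT_comp.
- exact: measurable_normc.
- by move=> z _; exact: hp.
Qed.

Lemma cintegrable_Re (D : set plane) F : measurable D -> cintegrable D F ->
  mu2.-integrable D (EFin \o (fun z => complex.Re (F z))).
Proof.
by move=> mD iF; apply: (part_integrable (@Re_le_normc R)) => //; exact: iF.1.1.
Qed.

Lemma cintegrable_Im (D : set plane) F : measurable D -> cintegrable D F ->
  mu2.-integrable D (EFin \o (fun z => complex.Im (F z))).
Proof.
by move=> mD iF; apply: (part_integrable (@Im_le_normc R)) => //; exact: iF.1.2.
Qed.

Lemma cintegrable_le (D : set plane) F (u : plane -> R) : measurable D ->
  cmeasurable [set: plane] F -> measurable_fun [set: plane] u ->
  (forall z, D z -> normc (F z) <= u z) -> (\int[mu2]_(z in D) (u z)%:E < +oo)%E ->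
  cintegrable D F.
Proof.
move=> mD mF mu_ Fu ufin; split => //; apply: le_lt_trans ufin; apply: nint_le => //.
- exact: measurable_normc.
- by move=> z; exact: normc_ge0.
Qed.

Lemma cintegralB (D : set plane) F G : measurable D -> cintegrable D F -> cintegrable D G ->
  cintegral mu2 D F - cintegral mu2 D G = cintegral mu2 D (fun z => F z - G z).
Proof.
move=> mD iF iG; apply/eqP; rewrite eq_complex /=; apply/andP; split; apply/eqP.
  rewrite -RintegralB//; [|exact: cintegrable_Re|exact: cintegrable_Re].
  by apply: eq_Rintegral => z _; case: (F z) (G z) => [? ?] [].
rewrite -RintegralB//; [|exact: cintegrable_Im|exact: cintegrable_Im].
by apply: eq_Rintegral => z _; case: (F z) (G z) => [? ?] [].
Qed.

Lemma cintegralZ (D : set plane) F (c : R[i]) : measurable D -> cintegrable D F ->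
  cintegral mu2 D (fun z => c * F z) = c * cintegral mu2 D F.
Proof.
move=> mD iF; have iR := cintegrable_Re mD iF; have iI := cintegrable_Im mD iF.
have iRk k : mu2.-integrable D (EFin \o (fun z => k * complex.Re (F z))).
  by have := integrableZl mD k iR; apply: eq_integrable => // z _ /=; rewrite EFinM.
have iIk k : mu2.-integrable D (EFin \o (fun z => k * complex.Im (F z))).
  by have := integrableZl mD k iI; apply: eq_integrable => // z _ /=; rewrite EFinM.
apply/eqP; rewrite eq_complex; case: c => a b /=; apply/andP; split; apply/eqP.
  rewrite -!RintegralZl// -RintegralB//.
  by apply: eq_Rintegral => z _; case: (F z).
rewrite -!RintegralZl// -RintegralD//.
by apply: eq_Rintegral => z _; case: (F z).
Qed.

(** The factor 2 comes from bounding the real and imaginary parts separately. *)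
Lemma normc_cintegral_le (D : set plane) F (B : R) : measurable D -> cintegrable D F ->
  (\int[mu2]_(z in D) (normc (F z))%:E <= B%:E)%E ->
  normc (cintegral mu2 D F) <= 2 * B.
Proof.
move=> mD iF FB; apply: le_trans (normc_le_ReIm _) _ => /=.
have part (p : R[i] -> R) : (forall z, `|p z| <= normc z) ->
    measurable_fun [set: plane] (p \o F) -> `|\int[mu2]_(z in D) p (F z)| <= B.
  move=> hp mp; have iP := part_integrable hp mp mD iF.
  rewrite -lee_fin EFin_normr_Rintegral//; apply: le_trans FB.
  apply: le_trans (le_abse_integral _ _ _) _ => //; first exact: measurable_int iP.
  apply: nint_le => //.
  - exact: measurableT_comp.
  - by apply: measurable_normc; exact: iF.1.
rewrite (_ : 2 * B = B + B); last by ring.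
apply: lerD; [apply: part iF.1.1|apply: part iF.1.2];
  [exact: Re_le_normc|exact: Im_le_normc].
Qed.

Definition avg F (a b d : R) : R[i] := mean (cube a b d) F.

Let mC a b d : measurable (cube a b d : set plane).
Proof. exact: measurable_cube. Qed.

Lemma avgE F a b d : 0 < d ->
  avg F a b d = real_complex R (d ^+ 2)^-1 * cintegral mu2 (cube a b d) F.
Proof. by move=> d0; rewrite /avg /mean measure_cube// ltW. Qed.

Lemma avg_dist F G a b d (B : R) : 0 < d ->
  cintegrable (cube a b d) F -> cintegrable (cube a b d) G ->
  (\int[mu2]_(z in cube a b d) (normc (F z - G z))%:E <= (B * d ^+ 2)%:E)%E ->
  normc (avg F a b d - avg G a b d) <= 2 * B.
Proof.
move=> d0 iF iG FG; have d2 : 0 < d ^+ 2 by rewrite exprn_gt0.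
rewrite !avgE// -mulrBr cintegralB// normcM normc_real ger0_norm; last first.
  by rewrite invr_ge0 ltW.
rewrite ler_pdivrMl// (_ : d ^+ 2 * (2 * B) = 2 * (B * d ^+ 2)); last by ring.
apply: normc_cintegral_le => //.
split; first by apply: cmeasurableB; [exact: iF.1|exact: iG.1].
by apply: le_lt_trans FG _; exact: ltry.
Qed.

Lemma cintegrable_cst a b d (c : R[i]) : 0 < d -> cintegrable (cube a b d) (fun=> c).
Proof.
move=> d0; split; first exact: cmeasurable_cst.
rewrite (_ : \int[mu2]_(z in _) _ = (normc c)%:E * mu2 (cube a b d))%E; last exact: nint_cst.
by rewrite measure_cube ?ltW// -EFinM ltry.
Qed.

Lemma avg_cst a b d (c : R[i]) : 0 < d -> avg (fun=> c) a b d = c.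
Proof.
move=> d0; have d2 : d ^+ 2 != 0 by rewrite gt_eqF// exprn_gt0.
rewrite avgE//.
have E (r : R) : \int[mu2]_(z in cube a b d) r = r * d ^+ 2.
  transitivity (r * fine (mu2 (cube a b d))); first exact: Rintegral_cst.
  by rewrite measure_cube// ltW.
rewrite /cintegral !E; case: c => x y; apply/eqP; rewrite eq_complex /= !mul0r subr0 addr0.
by rewrite !(mulrC _ (d ^+ 2)) !mulKf// !eqxx.
Qed.

Lemma avgZ F (c : R[i]) a b d : 0 < d -> cintegrable (cube a b d) F ->
  avg (fun z => c * F z) a b d = c * avg F a b d.
Proof. by move=> d0 iF; rewrite !avgE// cintegralZ// mulrCA. Qed.

Lemma avg_trans F s t a b d : 0 < d -> cmeasurable [set: plane] F ->
  avg F (a + s) (b + t) d = avg (fun z => F (trans s t z)) a b d.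
Proof.
move=> d0 [m1 m2]; rewrite !avgE//; congr (_ * _).
have E (u : plane -> R) : measurable_fun setT u ->
  \int[mu2]_(z in cube (a + s) (b + t) d) u z = \int[mu2]_(z in cube a b d) u (trans s t z).
  move=> mu_; rewrite /Rintegral; congr fine.
  have := @integral_trans R s t (cube (a + s) (b + t) d) (EFin \o u) (mC _ _ _).
  by rewrite cube_trans => <- //; exact/measurable_EFinP.
by rewrite /cintegral; congr Complex; exact: E.
Qed.

Lemma avg_ae F G a b d : cmeasurable [set: plane] F ->
  cmeasurable [set: plane] G -> {ae mu2, forall z, F z = G z} ->
  avg F a b d = avg G a b d.
Proof.
move=> [mF1 mF2] [mG1 mG2] FG; rewrite /avg /mean; congr (_ * _).
have E (u v : plane -> R) : measurable_fun setT u -> measurable_fun setT v ->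
    {ae mu2, forall z, u z = v z} ->
    \int[mu2]_(z in cube a b d) u z = \int[mu2]_(z in cube a b d) v z.
  move=> mu_ mv uv; rewrite /Rintegral; congr fine.
  apply: ae_eq_integral => //.
  - by apply/measurable_EFinP; exact: measurable_funTS.
  - by apply/measurable_EFinP; exact: measurable_funTS.
  - by apply: ae_mono uv => z /= ->.
have AE (p : R[i] -> R) : {ae mu2, forall z, p (F z) = p (G z)}.
  by apply: ae_mono FG => z /= ->.
by rewrite /cintegral; congr Complex; apply: E => //; exact: AE.
Qed.

Lemma cube_sub (a b d a' b' d' : R) : a' <= a -> a + d <= a' + d' -> b' <= b -> b + d <= b' + d' ->
  cube a b d `<=` cube a' b' d'.
Proof.
move=> h1 h2 h3 h4 z /cubeE[/andP[z1 z2] /andP[z3 z4]]; apply/cubeE.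
split; apply/andP; split; [exact: le_trans z1|exact: le_trans h2|exact: le_trans z3|exact: le_trans h4].
Qed.

(** The small cube has at least a quarter of the area of the large one. *)
Lemma avg_subcube F (a b d a' b' d' eta : R) : 0 < d -> 0 < d' -> d' <= 2 * d ->
  cube a b d `<=` cube a' b' d' -> cintegrable (cube a' b' d') F ->
  (\int[mu2]_(z in cube a' b' d') (normc (F z - avg F a' b' d'))%:E <= (eta * d' ^+ 2)%:E)%E ->
  0 <= eta ->
  normc (avg F a b d - avg F a' b' d') <= 8 * eta.
Proof.
move=> d0 d0' d'2 sub iF osc eta0.
have mF := iF.1.
rewrite -[X in normc (_ - X)](@avg_cst a b d)//.
rewrite (_ : 8 * eta = 2 * (4 * eta)); last by ring.
apply: avg_dist => //.
- split => //; apply: le_lt_trans iF.2; apply: nint_sub => //.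
    exact: measurable_normc.
  by move=> z; exact: normc_ge0.
- exact: cintegrable_cst.
- apply: (@le_trans _ _ (\int[mu2]_(z in cube a' b' d') (normc (F z - avg F a' b' d'))%:E)%E).
    apply: nint_sub => //; last by move=> z; exact: normc_ge0.
    by apply: measurable_normc; apply: cmeasurableB => //; exact: cmeasurable_cst.
  apply: (le_trans osc); rewrite lee_fin.
  have : d' ^+ 2 <= (2 * d) ^+ 2 by rewrite lerXn2r// nnegrE; lra.
  by move=> /(ler_wpM2l eta0); rewrite exprMn; lra.
Qed.

End Averages.

Section SmallCubes.
Context {R : realType}.
Local Notation mu1 := (@lebesgue_measure R).
Local Notation mu2 := (mu1 \x mu1)%E.
Local Notation line := (measurableTypeR R).
Local Notation plane := (line * line)%type.
Implicit Types (F : R * R -> R[i]).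

Let bounded_open_ball (r : R) : open (ball (0 : R * R) r) /\ bounded_set (ball (0 : R * R) r).
Proof.
split; first exact: ball_open.
exists r; split; first exact: num_real.
move=> M rM z; rewrite -ball_normE /= sub0r normrN => h.
exact: ltW (lt_trans h rM).
Qed.

Definition vanishing_oscillation F (K : R) : Prop :=
  forall eta : R, 0 < eta -> exists2 delta : R, 0 < delta &
    forall a b d : R, 0 < d < delta -> `|a| <= K -> `|b| <= K ->
      (\int[mu2]_(z in cube a b d) (normc (F z - avg F a b d))%:E <= (eta * d ^+ 2)%:E)%E.

Lemma vmo_small_cubes F (K : R) : VMOloc F -> vanishing_oscillation F K.
Proof.
move=> [_ hF] eta eta0.
pose U := ball (0 : R * R) (K + 2).
have [oU bU] := bounded_open_ball (K + 2).
have [_ osc] := hF U oU bU.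
have [e /= e0 he] : exists2 e : R, 0 < e & forall x, 0 < x < e -> (osc_small x U F < eta%:E)%E.
  move/fine_cvgP: osc => [ffin /cvgrPdist_lt /(_ _ eta0) fosc].
  have [e /= e0 he] := filterI ffin fosc.
  exists e => // x /andP[x0 xe].
  have [] := he x _ x0; first by rewrite /ball_ /= sub0r normrN gtr0_norm.
  move=> h1; rewrite /= sub0r normrN => h2.
  by rewrite -(fineK h1) lte_fin; apply: le_lt_trans h2; exact: ler_norm.
exists (Num.min 1 (e / 2)); first by rewrite lt_min ltr01 divr_gt0.
move=> a b d /andP[d0]; rewrite lt_min => /andP[d1 de] ha hb.
have d2 : 0 < d ^+ 2 by rewrite exprn_gt0.
(* the cubes of side [d] have area [d ^ 2 <= d < e / 2] *)
have he2 : 0 < e / 2 < e by rewrite divr_gt0//= ltr_pdivrMr// mulr_natr mulr2n ltrDr.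
have := he _ he2; rewrite /osc_small => hs.
have : (mean_osc (cube a b d) F <= eta%:E)%E.
  apply: ltW; apply: le_lt_trans hs; apply: ereal_sup_ubound; right.
  exists (cube a b d) => //; split.
  - by exists a, b, d.
  - move=> z /cubeE[/andP[h1 h2] /andP[h3 h4]].
    rewrite /U -ball_normE /= sub0r normrN /Num.norm /= gt_max.
    move: ha hb; rewrite !ler_norml => /andP[? ?] /andP[? ?].
    by rewrite !ltr_norml; apply/andP; split; apply/andP; split; lra.
  - rewrite measure_cube ?ltW// lte_fin; nra.
rewrite /mean_osc measure_cube ?(ltW d0)//= /int_normc.
by rewrite lee_pdivrMl// -EFinM mulrC.
Qed.

End SmallCubes.

(** * Averages of quasi-periodic functions *)

Section QuasiPeriodicAverages.
Context {R : realType}.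
Local Notation mu1 := (@lebesgue_measure R).
Local Notation mu2 := (mu1 \x mu1)%E.
Local Notation line := (measurableTypeR R).
Local Notation plane := (line * line)%type.
Variable F : R * R -> R[i].
Hypothesis mF : cmeasurable [set: plane] F.
Hypothesis qpF : quasiperiodic F.
Hypothesis Ffin : (\int[mu2]_(z in box 0 1 0 1) (normc (F z) ^+ 2)%:E < +oo)%E.

Let F1 z : F (trans 1 0 z) = e2pi z.2 * F z.
Proof. by have := qpF 1 0 z; rewrite mul1r. Qed.

Let F2 z : F (trans 0 1 z) = F z.
Proof. by have := qpF 0 1 z; rewrite mul0r e2pi0 mul1r. Qed.

Let mF2 : measurable_fun [set: plane] (fun z => normc (F z) ^+ 2).
Proof. exact: measurable_normcX. Qed.

Lemma qp_locally_L2 (c : R) (n : nat) :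
  (\int[mu2]_(z in box c (c + n%:R) c (c + n%:R)) (normc (F z) ^+ 2)%:E < +oo)%E.
Proof.
pose u (z : plane) := (normc (F z) ^+ 2)%:E.
have mu_ : measurable_fun [set: plane] u by exact/measurable_EFinP.
have u0 z : (0 <= u z)%E by rewrite lee_fin sqr_ge0.
have u1 z : u (trans 1 0 z) = u z by rewrite /u F1 normcM normc_e2pi mul1r.
have u2 z : u (trans 0 1 z) = u z by rewrite /u F2.
have un1 (j : nat) z : u (trans (j%:R * 1) 0 z) = u z.
  elim: j => [|j IH]; first by rewrite mul0r trans0.
  by rewrite -natr1 mulrDl mul1r addrC -[in LHS](addr0 0) transD u1 IH.
have un2 (j : nat) z : u (trans 0 (j%:R * 1) z) = u z.
  elim: j => [|j IH]; first by rewrite mul0r trans0.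
  by rewrite -natr1 mulrDl mul1r addrC -[in LHS](addr0 0) transD u2 IH.
have mB a b a' b' : measurable (box a b a' b' : set plane) by exact: measurable_box.
have IS (D : set plane) : measurable D ->
    (\int[mu2]_(z in D) \sum_(k < n) u z = \sum_(k < n) \int[mu2]_(z in D) u z)%E.
  by move=> mD; rewrite ge0_integral_sum// => _; exact: measurable_funTS.
rewrite -[n%:R]mulr1 (@box_tile1 R 1 c _ _ n u)//.
under eq_integral do under eq_bigr do rewrite un1.
rewrite IS// (@box_tile2 R 1 c _ _ n u)//.
under eq_bigr do under eq_integral do under eq_bigr do rewrite un2.
under eq_bigr do rewrite IS//.
under eq_bigr do under eq_bigr do rewrite (@box_periodic R 1 c c u)//.
by apply: lte_sum_pinfty => i _; apply: lte_sum_pinfty => j _; exact: Ffin.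
Qed.

(** By absolute continuity of the integral of [normc F ^ 2], and since
    [x <= t + x ^ 2 / t]. *)
Lemma qp_small_L1 (K eta : R) : 0 < eta ->
  exists2 delta : R, 0 < delta & forall a b d, 0 < d < delta -> `|a| <= K -> `|b| <= K ->
    (\int[mu2]_(z in cube a b d) (normc (F z))%:E <= (eta * d)%:E)%E.
Proof.
move=> eta0; have [n hn] := natr_bound (K + 1).
pose B : set plane := box (- n%:R) (- n%:R + (n + n)%:R) (- n%:R) (- n%:R + (n + n)%:R).
have mB : measurable B by exact: measurable_box.
pose f (z : plane) : R := normc (F z) ^+ 2 * \1_B z.
have f0 z : 0 <= f z by rewrite mulr_ge0 ?sqr_ge0// indicE.
have mf : measurable_fun [set: plane] f.
  by apply: measurable_funM => //; exact: measurable_indic.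
have ffin : (\int[mu2]_(z in setT) (f z)%:E < +oo)%E.
  apply: le_lt_trans (qp_locally_L2 (- n%:R) (n + n)).
  rewrite [leRHS]integral_mkcond; apply: ge0_le_integral => //.
  - by move=> z _; rewrite lee_fin.
  - exact/measurable_EFinP.
  - apply/(measurable_restrictT _ _).1 => //.
    by apply: measurable_funTS; exact/measurable_EFinP.
  - move=> z _; rewrite -/B /f patchE indicE; case: (z \in B); first by rewrite mulr1.
    by rewrite mulr0.
have intf : mu2.-integrable setT (EFin \o f).
  apply/integrableP; split; first exact/measurable_EFinP.
  apply: le_lt_trans ffin; apply: ge0_le_integral => //.
  - by apply: measurableT_comp => //; exact/measurable_EFinP.
  - exact/measurable_EFinP.
  - by move=> z _; rewrite /= ger0_norm.
pose s : R := eta / 2.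
have s0 : 0 < s by rewrite divr_gt0.
have s20 : 0 < s ^+ 2 by rewrite exprn_gt0.
have [delta [delta0 hd]] := integral_normr_continuous intf s20.
exists (Num.min 1 delta); first by rewrite lt_min ltr01.
move=> a b d /andP[d0]; rewrite lt_min => /andP[d1 dd] ha hb.
have mC : measurable (cube a b d : set plane) by exact: measurable_cube.
have d2 : d ^+ 2 < delta by nra.
have sub : cube a b d `<=` B.
  move=> z /cubeE[/andP[h1 h2] /andP[h3 h4]].
  move: ha hb; rewrite !ler_norml => /andP[? ?] /andP[? ?].
  by rewrite /B natrD; split; apply/andP; split; lra.
have kap : (\int[mu2]_(z in cube a b d) (normc (F z) ^+ 2)%:E <= (s ^+ 2)%:E)%E.
  have dC : (mu2 (cube a b d) < delta%:E)%E by rewrite measure_cube ?lte_fin// ltW.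
  have := hd (cube a b d) mC dC.
  have fE : \int[mu2]_(z in cube a b d) `|f z| = fine (\int[mu2]_(z in cube a b d) (normc (F z) ^+ 2)%:E)%E.
    congr fine; apply: eq_integral => z /set_mem zC.
    by rewrite ger0_norm// /f indicE mem_set ?mulr1//; exact: sub.
  rewrite fE => h.
  have fn : (\int[mu2]_(z in cube a b d) (normc (F z) ^+ 2)%:E \is a fin_num)%E.
    rewrite ge0_fin_numE; last by apply: nint_ge0 => z; exact: sqr_ge0.
    apply: le_lt_trans (qp_locally_L2 (- n%:R) (n + n)).
    by apply: nint_sub => // z; exact: sqr_ge0.
  by rewrite -(fineK fn) lee_fin ltW.
have [t tE] : exists t, t = s / d by exists (s / d).
have t0 : 0 < t by rewrite tE divr_gt0.
apply: (@le_trans _ _ (\int[mu2]_(z in cube a b d) (t + t^-1 * normc (F z) ^+ 2)%:E)%E).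
  apply: nint_le => //.
  - exact: measurable_normc.
  - by apply: measurable_funD; [exact: measurable_cst|apply: measurable_funM; first exact: measurable_cst].
  - by move=> z; exact: normc_ge0.
  - move=> z _; set x := normc _; rewrite -(ler_pM2l t0) mulrDr mulVKf ?gt_eqF//.
    have : 0 <= (t - x) ^+ 2 by exact: sqr_ge0.
    have : 0 <= t ^+ 2 by exact: sqr_ge0.
    have : 0 <= x ^+ 2 by exact: sqr_ge0.
    nra.
rewrite nintD//; last 3 first.
- by apply: measurable_funM; first exact: measurable_cst.
- by move=> z; exact: ltW.
- by move=> z; rewrite mulr_ge0 ?sqr_ge0// invr_ge0 ltW.
rewrite nintZ ?invr_ge0 ?(ltW t0)//; last by move=> z; exact: sqr_ge0.
have -> : (\int[mu2]_(z in cube a b d) t%:E = t%:E * mu2 (cube a b d))%E by exact: nint_cst.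
rewrite measure_cube ?(ltW d0)// -EFinM.
apply: (@le_trans _ _ ((t * d ^+ 2)%:E + t^-1%:E * (s ^+ 2)%:E)%E).
  by apply: leeD => //; apply: lee_wpmul2l => //; rewrite lee_fin invr_ge0 ltW.
rewrite -EFinM -EFinD lee_fin tE /s le_eqVlt; apply/orP; left; apply/eqP.
by field; rewrite !gt_eqF.
Qed.

Lemma qp_cube_integrable a b d : 0 < d -> cintegrable (cube a b d) F.
Proof.
move=> d0; have [n hn] := natr_bound (`|a| + `|b| + d + 1).
have mC : measurable (cube a b d : set plane) by exact: measurable_cube.
have mB : measurable (box (- n%:R) (- n%:R + (n + n)%:R) (- n%:R) (- n%:R + (n + n)%:R) : set plane).
  exact: measurable_box.
apply: (@cintegrable_le _ _ _ (fun z => 1 + normc (F z) ^+ 2)) => //.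
- by apply: measurable_funD; first exact: measurable_cst.
- move=> z _; set x := normc _.
  have : 0 <= (1 - x) ^+ 2 by exact: sqr_ge0.
  have : 0 <= x ^+ 2 by exact: sqr_ge0.
  nra.
rewrite nintD//; last by move=> z; exact: sqr_ge0.
have -> : (\int[mu2]_(z in cube a b d) 1%:E = 1%:E * mu2 (cube a b d))%E by exact: nint_cst.
rewrite measure_cube ?(ltW d0)// -EFinM lte_add_pinfty ?ltry//.
apply: le_lt_trans (qp_locally_L2 (- n%:R) (n + n)).
apply: nint_sub => //; first by move=> z; exact: sqr_ge0.
move=> z /cubeE[/andP[h1 h2] /andP[h3 h4]].
have ha := ler_norm a; have hb := ler_norm b.
have ha' : - `|a| <= a by rewrite lerNl -normrN ler_norm.
have hb' : - `|b| <= b by rewrite lerNl -normrN ler_norm.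
have na := normr_ge0 a; have nb := normr_ge0 b.
by rewrite natrD; split; apply/andP; split; lra.
Qed.

(** What makes the averages at scale [d] behave, up to [eta], like the values on a grid of
    step [d] of a continuous quasi-periodic function. The second property absorbs the
    variation of the phases over a cube, which is of order [d]. *)
Definition good_averages (K eta d : R) : Prop := forall a b, `|a| <= K -> `|b| <= K ->
  [/\ (\int[mu2]_(z in cube a b d) (normc (F z - avg F a b d))%:E <= (eta * d ^+ 2)%:E)%E,
      d * normc (avg F a b d) <= eta,
      normc (avg F (a + d) b d - avg F a b d) <= eta,
      normc (avg F a (b + d) d - avg F a b d) <= eta
    & normc (avg F (a + 1) b d - e2pi b * avg F a b d) <= eta].

Lemma avg_periodic2 a b d : 0 < d -> avg F a (b + 1) d = avg F a b d.
Proof.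
move=> d0; rewrite -[a in LHS]addr0 avg_trans//.
by congr (avg _ a b d); apply/funext => z; exact: F2.
Qed.

(** Cubes at distance [d] lie in a common cube of side [2 d], whose average is close to
    both of theirs by the bound on the oscillation. The quasi-periodicity suffers from the
    variation of the phase over the cube, which multiplies the integral of [normc F] by a
    multiple of [d]: here [qp_small_L1] is used. *)
Lemma good_averages_small (K eta : R) : vanishing_oscillation F K -> 0 < eta ->
  exists2 delta : R, 0 < delta & forall d, 0 < d < delta -> good_averages K eta d.
Proof.
move=> osc eta0; have p0 := pi_ge0 R.
pose e : R := eta / (16 + 8 * pi).
have c0 : 0 < 16 + 8 * pi :> R by lra.
have e0 : 0 < e by rewrite divr_gt0.
have eE : (16 + 8 * pi) * e = eta by rewrite /e mulrC divfK// gt_eqF.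
have e16 : 16 * e <= eta by have := mulr_ge0 p0 (ltW e0); lra.
have e8 : 8 * pi * e <= eta by have := ltW e0; lra.
have [d1 d10 h1] := osc _ e0; have [d2 d20 h2] := qp_small_L1 K e0.
exists (Num.min (d1 / 2) d2); first by rewrite lt_min d20 divr_gt0.
move=> d /andP[d0]; rewrite lt_min => /andP[dd1 dd2] a b ha hb.
have dd : 0 < d < d1 by rewrite d0; lra.
have dd' : 0 < 2 * d < d1 by rewrite mulr_gt0//; lra.
have dd2' : 0 < d < d2 by rewrite d0.
have iQ x y s : 0 < s -> cintegrable (cube x y s) F by exact: qp_cube_integrable.
have O := h1 a b d dd ha hb; have O' := h1 a b (2 * d) dd' ha hb.
have L := h2 a b d dd2' ha hb.
have d20' : 0 < 2 * d by rewrite mulr_gt0.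
have near_big x y : cube x y d `<=` cube a b (2 * d) ->
    normc (avg F x y d - avg F a b (2 * d)) <= 8 * e.
  move=> sub; apply: avg_subcube => //; [exact: iQ|exact: ltW].
have near2 x y : cube x y d `<=` cube a b (2 * d) ->
    normc (avg F x y d - avg F a b d) <= eta.
  move=> sub; apply: le_trans (normc_sub_le (avg F a b (2 * d)) _ _) _.
  apply: le_trans e16; rewrite (_ : 16 * e = 8 * e + 8 * e); last by ring.
  apply: lerD; first exact: near_big.
  by rewrite normc_distC; apply: near_big; apply: cube_sub; lra.
split.
- apply: (le_trans O); rewrite lee_fin ler_wpM2r ?sqr_ge0//; lra.
- have := @avg_dist R F (fun=> 0) a b d (e / d) d0 (iQ _ _ _ d0) (cintegrable_cst _ _ 0 d0).
  rewrite avg_cst// subr0.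
  have -> : e / d * d ^+ 2 = e * d by field; rewrite gt_eqF.
  under eq_integral do rewrite subr0.
  move=> /(_ L) h; have := ler_wpM2l (ltW d0) h.
  have -> : d * (2 * (e / d)) = 2 * e by field; rewrite gt_eqF.
  by move=> /le_trans; apply; lra.
- by apply: near2; apply: cube_sub; lra.
- by apply: near2; apply: cube_sub; lra.
- rewrite -[b in X in normc (X - _)]addr0 avg_trans// -avgZ//; last exact: iQ.
  rewrite (_ : (fun z => F (trans 1 0 z)) = (fun z => e2pi z.2 * F z)); last first.
    by apply/funext => z; exact: F1.
  have twist (t : plane -> R) : measurable_fun [set: plane] t ->
      cintegrable (cube a b d) (fun z => e2pi (t z) * F z).
    move=> mt; have m : cmeasurable [set: plane] (fun z => e2pi (t z) * F z).
      by apply: cmeasurableM => //; exact: cmeasurable_e2pi.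
    split => //; apply: le_lt_trans (iQ a b d d0).2; apply: nint_le => //.
    * exact: measurable_cube.
    * exact: measurable_normc.
    * exact: measurable_normc.
    * by move=> z; exact: normc_ge0.
    * by move=> z _; rewrite normcM normc_e2pi mul1r.
  have i1 := twist _ measurable_snd; have i2 := twist _ (@measurable_cst _ _ _ _ _ b).
  apply: le_trans e8; rewrite (_ : 8 * pi * e = 2 * (4 * pi * e)); last by ring.
  apply: avg_dist => //.
  + have pd : 0 <= 4 * pi * d by rewrite !mulr_ge0// ltW.
    apply: (@le_trans _ _ (\int[mu2]_(z in cube a b d) (4 * pi * d * normc (F z))%:E)%E).
      apply: nint_le => //.
      * exact: measurable_cube.
      * by apply: measurable_normc; apply: cmeasurableB; [exact: i1.1|exact: i2.1].
      * by apply: measurable_funM; [exact: measurable_cst|exact: measurable_normc].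
      * by move=> z; exact: normc_ge0.
      * move=> z /cubeE[_ /andP[h3 h4]]; rewrite -mulrBl normcM ler_wpM2r ?normc_ge0//.
        apply: le_trans (e2pi_lip _ _) _; rewrite ler_wpM2l ?mulr_ge0//.
        by rewrite ger0_norm; lra.
    rewrite nintZ//; last 3 first.
    * exact: measurable_cube.
    * exact: measurable_normc.
    * by move=> z; exact: normc_ge0.
    apply: (@le_trans _ _ ((4 * pi * d)%:E * (e * d)%:E)%E); first by apply: lee_wpmul2l.
    by rewrite -EFinM lee_fin le_eqVlt; apply/orP; left; apply/eqP; ring.
Qed.

End QuasiPeriodicAverages.

(** * The matrix of averages *)

Section ZakMatrix.
Context {R : realType}.
Local Notation mu1 := (@lebesgue_measure R).
Local Notation mu2 := (mu1 \x mu1)%E.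
Local Notation line := (measurableTypeR R).
Local Notation plane := (line * line)%type.

Lemma sum_sqr_le_sqr_sum (I : Type) (s : seq I) (f : I -> R) : (forall i, 0 <= f i) ->
  \sum_(i <- s) f i ^+ 2 <= (\sum_(i <- s) f i) ^+ 2.
Proof.
move=> f0; elim: s => [|i s IH]; first by rewrite !big_nil expr0n.
rewrite !big_cons sqrrD -addrA lerD2l; apply: le_trans IH _.
rewrite lerDr mulrn_wge0// mulr_ge0// sumr_ge0//.
Qed.

Lemma ord_pair_enum q : exists en : 'I_(q * q) -> 'I_q * 'I_q, bijective en.
Proof.
have e : (q * q)%N = #|{: 'I_q * 'I_q}| by rewrite card_prod card_ord.
exists (fun k => enum_val (cast_ord e k)).
exists (fun p => cast_ord (esym e) (enum_rank p)) => [k|p].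
  by rewrite enum_valK cast_ordK.
by rewrite cast_ordKV enum_rankK.
Qed.

Variables (q : nat) (lam : 'I_(q * q) -> R * R) (F : R * R -> R[i]).
Variable en : 'I_(q * q) -> 'I_q * 'I_q.
Hypothesis q0 : (0 < q)%N.
Hypothesis en_bij : bijective en.
Hypothesis mF : cmeasurable [set: plane] F.
Hypothesis qpF : quasiperiodic F.

Let n := (q * q)%N.
Let tau : R := q%:R^-1.
Let g1 (k : 'I_n) : R := (en k).1%:R * tau.
Let g2 (k : 'I_n) : R := (en k).2%:R * tau.

(** The matrix of the values, at the points congruent to [(x, y)] modulo [(1 / q) Z^2], of
    the shifted Zak transforms [zshift (lam i) F], the values of [F] being replaced by
    averages over cubes. *)
Definition zmx (d x y : R) : 'M[R[i]]_(q * q) :=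
  \matrix_(i, k) (e2pi ((lam i).1 * (x + g1 k)) *
    avg F (x + g1 k - (lam i).2) (y + g2 k - (lam i).1) d).

Variables (K C eta d : R).
Hypothesis d0 : 0 < d.
Hypothesis eta0 : 0 <= eta.
Hypothesis good : good_averages F K eta d.
Hypothesis hC : forall i, 4 * pi * `|(lam i).1| <= C.

Definition in_region (x y : R) : Prop := forall i k,
  `|x + g1 k - (lam i).2| <= K /\ `|y + g2 k - (lam i).1| <= K.

Let C0 : 0 <= C.
Proof.
have n0 : (0 < q * q)%N by rewrite muln_gt0 q0.
by apply: le_trans (hC (Ordinal n0)); rewrite !mulr_ge0// pi_ge0.
Qed.

Lemma zmx_step1 x y i k : in_region x y ->
  normc (zmx d (x + d) y i k - zmx d x y i k) <= eta * (1 + C).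
Proof.
move=> hxy; have [h1 h2] := hxy i k; have [_ gM gx _ _] := good h1 h2.
rewrite !mxE.
have -> : x + d + g1 k - (lam i).2 = x + g1 k - (lam i).2 + d by ring.
set a' := avg F (_ + d) _ _ in gx *; set a := avg F _ _ _ in gM gx *.
have -> : e2pi ((lam i).1 * (x + d + g1 k)) * a' - e2pi ((lam i).1 * (x + g1 k)) * a =
  e2pi ((lam i).1 * (x + d + g1 k)) * (a' - a) +
  (e2pi ((lam i).1 * (x + d + g1 k)) - e2pi ((lam i).1 * (x + g1 k))) * a by ring.
apply: le_trans (le_normcD _ _) _; rewrite normcM normc_e2pi mul1r normcM.
rewrite [leRHS]mulrDr mulr1; apply: lerD => //.
apply: (@le_trans _ _ ((C * d) * normc a)).
  rewrite ler_wpM2r ?normc_ge0//; apply: le_trans (e2pi_lip _ _) _.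
  have -> : (lam i).1 * (x + d + g1 k) - (lam i).1 * (x + g1 k) = (lam i).1 * d by ring.
  by rewrite normrM (ger0_norm (ltW d0)) mulrA ler_wpM2r// ltW.
by rewrite -mulrA [leRHS]mulrC ler_wpM2l.
Qed.

Lemma zmx_step2 x y i k : in_region x y ->
  normc (zmx d x (y + d) i k - zmx d x y i k) <= eta * (1 + C).
Proof.
move=> hxy; have [h1 h2] := hxy i k; have [_ _ _ gy _] := good h1 h2.
rewrite !mxE -mulrBr normcM normc_e2pi mul1r.
have -> : y + d + g2 k - (lam i).1 = y + g2 k - (lam i).1 + d by ring.
by apply: le_trans gy _; rewrite ler_peMr// lerDl.
Qed.

Lemma zmx_periodic x y : zmx d x (y + 1) = zmx d x y.
Proof.
apply/matrixP => i k; rewrite !mxE; congr (_ * _).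
have -> : y + 1 + g2 k - (lam i).1 = y + g2 k - (lam i).1 + 1 by ring.
exact: avg_periodic2.
Qed.

(** The phase does not depend on the row: the factor [e2pi (lam i).1] gained by the
    prefactor compensates the shift by [(lam i).1] of the second coordinate. *)
Lemma zmx_quasiperiodic x y i k : in_region x y ->
  normc (zmx d (x + 1) y i k - e2pi (y + g2 k) * zmx d x y i k) <= eta * (1 + C).
Proof.
move=> hxy; have [h1 h2] := hxy i k; have [_ _ _ _ gq] := good h1 h2.
rewrite !mxE.
have -> : x + 1 + g1 k - (lam i).2 = x + g1 k - (lam i).2 + 1 by ring.
have -> : e2pi ((lam i).1 * (x + 1 + g1 k)) = e2pi ((lam i).1 * (x + g1 k)) * e2pi (lam i).1.
  by rewrite -e2piD; congr e2pi; ring.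
have -> : e2pi (y + g2 k) = e2pi (lam i).1 * e2pi (y + g2 k - (lam i).1).
  by rewrite -e2piD; congr e2pi; ring.
set E := e2pi (_ * _); set E' := e2pi (lam i).1; set a := avg _ _ _ _; set a' := avg _ _ _ _.
rewrite (_ : E * E' * a - E' * _ * (E * a') = E * E' * (a - e2pi (y + g2 k - (lam i).1) * a')).
  rewrite !normcM !normc_e2pi !mul1r; apply: le_trans gq _.
  by rewrite ler_peMr// lerDl.
ring.
Qed.

Variables (c0 kappa : R).
Hypothesis kappa0 : 0 < kappa.
Hypothesis c0E : (2 * kappa) ^+ 2 * n%:R <= c0.
Hypothesis small : n%:R * eta * (1 + C) < kappa.
Hypothesis fibre_bound : forall (v : 'I_(q * q) -> R[i]) a b,
  {ae mu2, forall z, cube a b d z ->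
     c0 * \sum_i normc (v i) ^+ 2 <= fibre_sqr q lam F v z}.

(** The lower bound holds for the matrix of values at almost every point of the cube;
    in mean over the cube, these values differ little from their averages. *)
Lemma zmx_rows_expand x y : in_region x y -> rows_expand kappa (zmx d x y).
Proof.
move=> hxy v; set M := zmx d x y.
set V := \sum_i normc (v 0 i); rewrite leNgt; apply/negP => WV.
have nv i : 0 <= normc (v 0 i) by exact: normc_ge0.
have V0 : 0 < V.
  have : 0 <= V by exact: sumr_ge0.
  rewrite le_eqVlt => /orP[/eqP V0|//]; move: WV; rewrite -V0 mulr0.
  by rewrite ltNge sumr_ge0// => k _; exact: normc_ge0.
pose A i k := avg F (x + g1 k - (lam i).2) (y + g2 k - (lam i).1) d.
pose sh i k (z : plane) : plane := trans (g1 k - (lam i).2) (g2 k - (lam i).1) z.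
pose H i k (z : plane) : R := normc (F (sh i k z) - A i k).
have mH i k : measurable_fun [set: plane] (H i k).
  apply: measurable_normc; apply: cmeasurableB; last exact: cmeasurable_cst.
  exact: (cmeasurable_comp (measurable_trans _ _) mF).
have H0 i k z : 0 <= H i k z by exact: normc_ge0.
have mC : measurable (cube x y d : set plane) by exact: measurable_cube.
have HI i k : (\int[mu2]_(z in cube x y d) (H i k z)%:E <= (eta * d ^+ 2)%:E)%E.
  have [h1 h2] := hxy i k; have [osc _ _ _ _] := good h1 h2.
  apply: le_trans osc.
  have := @ge0_integral_trans R (g1 k - (lam i).2) (g2 k - (lam i).1)
    (cube (x + (g1 k - (lam i).2)) (y + (g2 k - (lam i).1)) d)
    (fun z => (normc (F z - A i k))%:E).
  rewrite cube_trans => -> //.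
  - by rewrite /A !addrA.
  - exact: measurable_cube.
  - apply/measurable_EFinP; apply: measurable_normc.
    by apply: cmeasurableB; [exact: mF|exact: cmeasurable_cst].
  - by move=> z; rewrite lee_fin normc_ge0.
pose T (z : plane) : R := \sum_k \sum_i normc (v 0 i) * H i k z.
have mT : measurable_fun [set: plane] T.
  apply: measurable_sum => k; apply: measurable_sum => i.
  by apply: measurable_funM; first exact: measurable_cst.
have T0 z : 0 <= T z by apply: sumr_ge0 => k _; apply: sumr_ge0 => i _; exact: mulr_ge0.
have TI : (\int[mu2]_(z in cube x y d) (T z)%:E <= (n%:R * V * (eta * d ^+ 2))%:E)%E.
  have m1 i k : measurable_fun [set: plane] (fun z => normc (v 0 i) * H i k z).
    by apply: measurable_funM; first exact: measurable_cst.
  have p1 i k z : 0 <= normc (v 0 i) * H i k z by exact: mulr_ge0.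
  rewrite /T nint_sum//; last 2 first.
  - by move=> k; apply: measurable_sum.
  - by move=> k z; apply: sumr_ge0.
  apply: (@le_trans _ _ (\sum_(k < n) (V * (eta * d ^+ 2))%:E)%E).
    apply: lee_sum => k _; rewrite nint_sum// /V mulr_suml -sumEFin.
    apply: lee_sum => i _; rewrite nintZ// EFinM.
    by apply: lee_wpmul2l; rewrite ?lee_fin.
  by rewrite sumEFin sumr_const card_ord lee_fin -[leLHS]mulr_natl mulrA.
have ptw : {ae mu2, forall z : plane, cube x y d z -> (kappa * V - n%:R * C * eta * V <= T z)%R}.
  have [N [mN N0 sN]] := fibre_bound (fun i => v 0 i) x y.
  exists N; split => // z h; apply: sN => hz; apply: h => zC.
  have {}hz := hz zC.
  pose G k := fibre lam F (fun i => v 0 i) (trans (g1 k) (g2 k) z).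
  have SE : fibre_sqr q lam F (fun i => v 0 i) z = \sum_k normc (G k) ^+ 2.
    rewrite /fibre_sqr (reindex en) /=; first by [].
    exact: onW_bij.
  have L1 : 2 * kappa * V <= \sum_k normc (G k).
    have GS0 : 0 <= \sum_k normc (G k) by apply: sumr_ge0 => k _; exact: normc_ge0.
    rewrite -(@ler_pXn2r _ 2)// ?nnegrE//; last by rewrite !mulr_ge0// ltW.
    apply: le_trans (sum_sqr_le_sqr_sum _ _); last by move=> k; exact: normc_ge0.
    rewrite -SE; apply: le_trans hz; rewrite exprMn.
    have hV : V ^+ 2 <= n%:R * \sum_i normc (v 0 i) ^+ 2.
      have := @sqr_sum_le R _ (index_enum 'I_n) (fun i => normc (v 0 i)).
      have -> : size (index_enum 'I_n) = n by rewrite -[RHS]card_ord cardT enumT.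
      exact.
    have s0 : 0 <= \sum_i normc (v 0 i) ^+ 2 by apply: sumr_ge0 => i _; exact: sqr_ge0.
    apply: (@le_trans _ _ ((2 * kappa) ^+ 2 * (n%:R * \sum_i normc (v 0 i) ^+ 2))).
      by rewrite ler_wpM2l// sqr_ge0.
    by rewrite mulrA ler_wpM2r.
  have L2 k : normc (G k) <= normc ((v *m M) 0 k) + \sum_i normc (v 0 i) * (H i k z + C * eta).
    rewrite -lerBlDl; apply: le_trans (normc_subr_le _ _) _.
    rewrite mxE /G /fibre -sumrB; apply: le_trans (normc_sum _ _ _) _.
    apply: ler_sum => i _; rewrite -mulrBr normcM ler_wpM2l// !mxE -/(A i k).
    rewrite /zshift /trans /=.
    have -> : F (z.1 + g1 k - (lam i).2, z.2 + g2 k - (lam i).1) = F (sh i k z).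
      by rewrite /sh /trans /= !addrA.
    have -> : e2pi ((lam i).1 * (z.1 + g1 k)) * F (sh i k z) - e2pi ((lam i).1 * (x + g1 k)) * A i k
      = e2pi ((lam i).1 * (z.1 + g1 k)) * (F (sh i k z) - A i k) +
        (e2pi ((lam i).1 * (z.1 + g1 k)) - e2pi ((lam i).1 * (x + g1 k))) * A i k by ring.
    apply: le_trans (le_normcD _ _) _; rewrite normcM normc_e2pi mul1r normcM lerD2l.
    have [h1 h2] := hxy i k; have [_ gM _ _ _] := good h1 h2.
    apply: (@le_trans _ _ ((C * d) * normc (A i k))).
      rewrite ler_wpM2r ?normc_ge0//; apply: le_trans (e2pi_lip _ _) _.
      rewrite (_ : (lam i).1 * (z.1 + g1 k) - (lam i).1 * (x + g1 k) = (lam i).1 * (z.1 - x)); last by ring.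
      rewrite normrM mulrA ler_pM ?normr_ge0//; first by rewrite !mulr_ge0// pi_ge0.
      have [/andP[z1 z2] _] := (cubeE _ _ _ _).1 zC.
      by rewrite ger0_norm ?subr_ge0// lerBlDl.
    by rewrite -mulrA ler_wpM2l.
  have L3 : \sum_k normc (G k) <= \sum_k normc ((v *m M) 0 k) + (T z + n%:R * C * eta * V).
    apply: (@le_trans _ _ (\sum_k (normc ((v *m M) 0 k) + \sum_i normc (v 0 i) * (H i k z + C * eta)))).
      by apply: ler_sum => k _; exact: L2.
    rewrite big_split /= lerD2l le_eqVlt; apply/orP; left; apply/eqP.
    have -> : n%:R * C * eta * V = \sum_(k < n) \sum_i normc (v 0 i) * (C * eta).
      by rewrite sumr_const card_ord -mulr_suml -/V -[RHS]mulr_natl; ring.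
    rewrite /T -big_split /=; apply: eq_bigr => k _.
    by rewrite -big_split /=; apply: eq_bigr => i _; rewrite mulrDr.
  by move: WV L1 L3; lra.
have nC : n%:R * C * eta <= kappa.
  have : 0 <= n%:R * eta by rewrite mulr_ge0.
  by move: small; lra.
have low0 : 0 <= kappa * V - n%:R * C * eta * V by rewrite -mulrBl mulr_ge0 ?(ltW V0)// subr_ge0.
have : ((kappa * V - n%:R * C * eta * V)%:E * mu2 (cube x y d) <= (n%:R * V * (eta * d ^+ 2))%:E)%E.
  apply: le_trans TI; rewrite -nint_cst//.
  apply: ae_ge0_le_integral => //.
  - by move=> z _; rewrite lee_fin T0.
  - by apply/measurable_EFinP; exact: measurable_funTS.
rewrite measure_cube ?(ltW d0)// -EFinM lee_fin.
have d2 : 0 < d ^+ 2 by rewrite exprn_gt0.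
rewrite (_ : n%:R * V * (eta * d ^+ 2) = (n%:R * V * eta) * d ^+ 2); last by ring.
rewrite ler_pM2r// => h.
have : n%:R * eta * (1 + C) * V < kappa * V by rewrite ltr_pM2r.
lra.
Qed.

End ZakMatrix.

(** * Winding of the determinant *)

Section Contradiction.
Context {R : realType}.
Local Notation mu1 := (@lebesgue_measure R).
Local Notation mu2 := (mu1 \x mu1)%E.
Local Notation line := (measurableTypeR R).
Local Notation plane := (line * line)%type.

Lemma rows_expand_phases m (kappa : R) (M : 'M[R[i]]_m) (p : 'I_m -> R) :
  rows_expand kappa M ->
  rows_expand kappa (\matrix_(i, k) (e2pi (p k) * M i k)).
Proof.
move=> h v; apply: le_trans (h v) _; apply: ler_sum => k _.
have -> : (v *m \matrix_(i, k) (e2pi (p k) * M i k)) 0 k = e2pi (p k) * (v *m M) 0 k.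
  rewrite !mxE mulr_sumr; apply: eq_bigr => i _; rewrite mxE mulrCA //.
by rewrite normcM normc_e2pi mul1r.
Qed.

Lemma det_phases m (M : 'M[R[i]]_m) (p : 'I_m -> R) :
  \det (\matrix_(i, k) (e2pi (p k) * M i k)) = e2pi (\sum_k p k) * \det M.
Proof.
have -> : \matrix_(i, k) (e2pi (p k) * M i k) = M *m diag_mx (\row_k e2pi (p k)).
  by apply/matrixP => i k; rewrite mul_mx_diag !mxE mulrC.
rewrite det_mulmx det_diag mulrC e2pi_sum; congr (_ * _).
by apply: eq_bigr => k _; rewrite mxE.
Qed.

(** Over a grid of small step [1 / N], the determinants of the matrices of averages form
    a twisted grid: from the left edge to the right edge each of the [n] columns of the
    matrix gains one turn as [y] runs over a period. *)
Lemma lower_bound_large_oscillation (q : nat) (lam : 'I_(q * q) -> R * R)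
    (F : R * R -> R[i]) (A : R) :
  (0 < q)%N ->
  (forall k, exists c : int, q%:R * (lam k).1 = c%:~R) ->
  cmeasurable [set: plane] F -> quasiperiodic F ->
  (\int[mu2]_(z in box 0 1 0 1) (normc (F z) ^+ 2)%:E < +oo)%E ->
  0 < A ->
  zshift_lower q lam F A ->
  ~ (forall K, vanishing_oscillation F K).
Proof.
move=> q0 lam_int mF qpF Ffin A0 lower osc.
have [en en_bij] := ord_pair_enum q.
set n := (q * q)%N; have n0 : (0 < n)%N by rewrite muln_gt0 q0.
have nR : 0 < n%:R :> R by rewrite ltr0n.
have qR : 0 < q%:R :> R by rewrite ltr0n.
pose c0 : R := A * q%:R ^+ 2 / 8.
have c00 : 0 < c0 by rewrite !mulr_gt0// ?invr_gt0// exprn_gt0.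
pose kappa : R := Num.sqrt (c0 / n%:R) / 2.
have kappa0 : 0 < kappa by rewrite divr_gt0// sqrtr_gt0 divr_gt0.
have c0E : (2 * kappa) ^+ 2 * n%:R <= c0.
  have -> : 2 * kappa = Num.sqrt (c0 / n%:R) by rewrite /kappa; field.
  rewrite sqr_sqrtr; last by rewrite divr_ge0// ltW.
  by rewrite divfK// gt_eqF.
pose C : R := \sum_i 4 * pi * `|(lam i).1|.
have hC i : 4 * pi * `|(lam i).1| <= C.
  rewrite /C (bigD1 i)//= lerDl sumr_ge0// => k _.
  by rewrite !mulr_ge0// pi_ge0.
have C0 : 0 <= C by apply: sumr_ge0 => i _; rewrite !mulr_ge0// pi_ge0.
pose L : R := \sum_i (`|(lam i).1| + `|(lam i).2|).
have hL i : `|(lam i).1| + `|(lam i).2| <= L.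
  by rewrite /L (bigD1 i)//= lerDl sumr_ge0// => k _; rewrite addr_ge0.
(* bounds the coordinates of all the corners of cubes that occur *)
pose K := 3 + L.
have [eta1 eta10 etaP] := @rows_expand_det_close R n _ kappa0.
pose eta := Num.min (eta1 / (1 + C)) (kappa / (2 * n%:R * (1 + C))).
have C1 : 0 < 1 + C by rewrite ltr_pwDl.
have eta0 : 0 < eta by rewrite lt_min divr_gt0//= divr_gt0// !mulr_gt0.
have eta_1 : eta * (1 + C) <= eta1.
  by rewrite -ler_pdivlMr// ge_min lexx.
have small : n%:R * eta * (1 + C) < kappa.
  have : eta * (2 * n%:R * (1 + C)) <= kappa.
    by rewrite -ler_pdivlMr ?mulr_gt0// ge_min lexx orbT.
  have : 0 < n%:R * eta * (1 + C) by rewrite !mulr_gt0.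
  lra.
have [delta delta0 goodP] := good_averages_small mF qpF Ffin (osc K) eta0.
have [N N4 [Nd Nq]] : exists2 N, (4 * n < N)%N &
    N%:R^-1 < delta :> R /\ N%:R^-1 < q%:R^-1 :> R.
  exists (4 * n + q + (Num.truncn delta^-1)).+1; first by rewrite ltnS -addnA leq_addr.
  split.
    rewrite invf_plt ?posrE ?ltr0n//; apply: lt_le_trans (truncnS_gt _) _.
    by rewrite ler_nat ltnS leq_addl.
  by rewrite ltf_pV2 ?posrE ?ltr0n// ltr_nat ltnS -addnA addnCA leq_addr.
have N0 : (0 < N)%N by exact: leq_ltn_trans N4.
have NR : 0 < N%:R :> R by rewrite ltr0n.
pose d : R := N%:R^-1.
have d0 : 0 < d by rewrite invr_gt0.
have good : good_averages F K eta d by apply: goodP; rewrite d0.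
have reg i j : (i <= N)%N -> (j <= N)%N -> in_region lam en K (i%:R * d) (j%:R * d).
  have in01 m : (m <= N)%N -> 0 <= m%:R * d <= 1.
    by move=> mN; rewrite mulr_ge0 ?(ltW d0)//= -[leRHS](mulfV (lt0r_neq0 NR)) ler_pM2r// ler_nat.
  have ord0 (m : 'I_q) : 0 <= m%:R * q%:R^-1 :> R by rewrite mulr_ge0 ?invr_ge0.
  have ord1 (m : 'I_q) : m%:R * q%:R^-1 <= 1 :> R.
    by rewrite -[leRHS](mulfV (lt0r_neq0 qR)) ler_pM2r ?invr_gt0// ler_nat ltnW.
  move=> /in01 /andP[x0 x1] /in01 /andP[y0 y1] l k.
  have k0 := ord0 (en k).1; have k1 := ord1 (en k).1.
  have l0 := ord0 (en k).2; have l1 := ord1 (en k).2.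
  have hl := hL l; have n1 := normr_ge0 (lam l).1; have n2 := normr_ge0 (lam l).2.
  rewrite /K; split; apply: le_trans (ler_normB _ _) _;
    rewrite ger0_norm ?addr_ge0//; lra.
pose D i j := zmx lam F en d (i%:R * d) (j%:R * d).
have DE i j : (i <= N)%N -> (j <= N)%N -> rows_expand kappa (D i j).
  move=> iN jN; apply: (zmx_rows_expand q0 en_bij mF d0 (ltW eta0) good hC kappa0 c0E small);
    last exact: reg.
  by move=> v a b; apply: (fibre_lower_ae q0 lam_int mF qpF Ffin A0 lower).
have dS m : m.+1%:R * d = m%:R * d + d by rewrite -natr1 mulrDl mul1r.
have d1 : N%:R * d = 0%:R * d + 1 by rewrite mul0r add0r mulfV// gt_eqF.
pose u : R[i] := e2pi (\sum_k (en k).2%:R * q%:R^-1).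
apply: (@no_twisted_grid R (fun i j => \det (D i j)) u n N) => //.
- exact: e2pi_neq0.
- by move=> i iN; rewrite /D d1 zmx_periodic.
- move=> i j iN jN; apply: etaP; first exact: DE (ltnW jN).
  move=> l k; rewrite /D dS; apply: le_trans eta_1.
  by apply: (zmx_step2 q0 (ltW eta0) good hC); apply: reg => //; exact: ltnW.
- move=> i j iN jN; apply: etaP; first exact: DE (ltnW iN) _.
  move=> l k; rewrite /D dS; apply: le_trans eta_1.
  by apply: (zmx_step1 q0 d0 good hC); apply: reg => //; exact: ltnW.
move=> j jN.
have -> : u * e2pi (n%:R / N%:R * j%:R) * \det (D 0 j) =
    \det (\matrix_(i, k) (e2pi (j%:R * d + (en k).2%:R * q%:R^-1) * D 0%N j i k)).
  rewrite det_phases big_split /= sumr_const card_ord e2piD; congr (_ * _).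
  rewrite mulrC; congr (e2pi _ * _).
  by rewrite -[RHS]mulr_natl -/n /d; ring.
apply: etaP; first by apply: rows_expand_phases; exact: DE.
move=> l k; rewrite [X in _ - X]mxE /D d1; apply: le_trans eta_1.
by apply: (zmx_quasiperiodic q0 (ltW eta0) good hC); exact: (reg 0%N).
Qed.

End Contradiction.

(** * Zak transforms of generators of Gabor Riesz bases *)

Section Transfer.
Context {R : realType}.
Local Notation mu1 := (@lebesgue_measure R).
Local Notation mu2 := (mu1 \x mu1)%E.
Local Notation line := (measurableTypeR R).
Local Notation plane := (line * line)%type.

(** Distinct pairs of a class and a point of [q Z^2] give distinct points of the lattice,
    so the coefficients can be carried over to a family indexed by the lattice. *)
Lemma riesz_lower_bound (g : R -> R[i]) (A : 'M[rat]_2) (Zg F : R * R -> R[i])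
    (q : nat) (lam : 'I_(q * q) -> R * R) :
  in_Lp mu1 setT 2 g -> riesz_basis (@lattice R A) (gabor g) -> is_zak g Zg ->
  cmeasurable [set: plane] F -> quasiperiodic F ->
  {ae mu2, forall z, F z = Zg z} ->
  (forall k (m : int * int),
    lattice A ((lam k).1 + q%:R * m.1%:~R, (lam k).2 + q%:R * m.2%:~R)) ->
  (forall k k' (m m' : int * int),
    (lam k).1 + q%:R * m.1%:~R = (lam k').1 + q%:R * m'.1%:~R ->
    (lam k).2 + q%:R * m.2%:~R = (lam k').2 + q%:R * m'.2%:~R -> k = k' /\ m = m') ->
  exists2 a : R, 0 < a & zshift_lower q lam F a.
Proof.
move=> g2 [_ _ [a [b [a0 b0 ab]]]] [mZ _ zak _] mF qpF FZ lam_lattice lam_inj.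
exists (a / 4) => [|s c us]; first by rewrite divr_gt0.
pose phi (j : 'I_(q * q) * (int * int)) : R * R :=
  ((lam j.1).1 + q%:R * j.2.1%:~R, (lam j.1).2 + q%:R * (- j.2.2)%:~R).
have phi_inj : injective phi.
  move=> [k [m1 m2]] [k' [m1' m2']] [e1 e2].
  have [-> [-> /oppr_inj ->]] // := lam_inj k k' (m1, - m2) (m1', - m2') e1 e2.
have [psi psiK] : exists psi, forall j, j \in s -> psi (phi j) = c j.
  exists (fun l => nth 0 (map c s) (index l (map phi s))) => j js.
  by rewrite index_map// (nth_map j) ?index_mem// nth_index.
have us' : uniq (map phi s) by rewrite map_inj_uniq.
have sL l : l \in map phi s -> lattice A l.
  by move=> /mapP[[k m] _ ->]; exact: (lam_lattice k (m.1, - m.2)).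
have /andP[low _] := ab (map phi s) psi us' sL.
have zak' (eps : R) : 0 < eps -> exists2 delta : R, 0 < delta & forall f K,
    supported_in K f -> in_Lp mu1 setT 1 f -> in_Lp mu1 setT 2 f ->
    (int_normc mu1 setT 2 (fun x => (f x - g x)%R) < delta%:E)%E ->
    (int_normc mu2 (@unit_square R) 2 (fun z => (zak_series f z - F z)%R) < eps%:E)%E.
  move=> /zak [delta delta0 zd]; exists delta => // f K fK f1 f2 fg.
  rewrite /int_normc; rewrite (_ : integral _ _ _ =
    int_normc mu2 (@unit_square R) 2 (fun z => (zak_series f z - Zg z)%R)); first exact: zd.
  have mS : cmeasurable [set: plane] (zak_series f).
    by apply: cmeasurable_zak_series fK _; case: f1.
  apply: nint_ae.
  - by rewrite unit_squareE; exact: measurable_cube.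
  - by apply: measurable_normcX; exact: cmeasurableB.
  - by apply: measurable_normcX; exact: cmeasurableB.
  - by move=> z; rewrite exprn_ge0// normc_ge0.
  - by move=> z; rewrite exprn_ge0// normc_ge0.
  - by apply: ae_mono FZ => z /= ->.
have sumE : \sum_(l <- map phi s) normc (psi l) ^+ 2 = \sum_(j <- s) normc (c j) ^+ 2.
  by rewrite big_map; apply: eq_big_seq => j js; rewrite psiK.
have combE z : zcomb F psi (map phi s) z = \sum_(j <- s) c j * zshift (phi j) F z.
  by rewrite /zcomb big_map; apply: eq_big_seq => j js; rewrite psiK.
have := zak_lower g2 mF qpF zak' low; rewrite sumE.
under eq_integral do rewrite combE.
move=> h; rewrite mulrAC EFinM.
rewrite lee_pdivrMr ?ltr0n// muleC; exact: h.
Qed.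

Lemma VMOloc_oscillation (F Zg : R * R -> R[i]) :
  cmeasurable [set: plane] F -> cmeasurable [set: plane] Zg ->
  {ae mu2, forall z, F z = Zg z} -> VMOloc Zg -> forall K, vanishing_oscillation F K.
Proof.
move=> mF mZ FZ vmo K eta eta0.
have [delta delta0 h] := vmo_small_cubes K vmo eta0.
exists delta => // a b d dd aK bK; apply: le_trans (h _ _ _ dd aK bK).
rewrite (avg_ae a b d mF mZ FZ) le_eqVlt; apply/orP; left; apply/eqP.
apply: nint_ae => [||| z|z|]; try exact: normc_ge0.
- exact: measurable_cube.
- by apply: measurable_normc; apply: cmeasurableB => //; exact: cmeasurable_cst.
- by apply: measurable_normc; apply: cmeasurableB => //; exact: cmeasurable_cst.
- by apply: ae_mono FZ => z /= ->.
Qed.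

End Transfer.

Unset Implicit Arguments.

Theorem theorem1p7 (R : realType) (g : R -> R[i]) (A : 'M[rat]_2)
    (Zg : R * R -> R[i]) :
  in_Lp (@lebesgue_measure R) setT 2 g ->
  A \in unitmx -> \det A = 1 ->
  riesz_basis (@lattice R A) (gabor g) ->
  is_zak g Zg ->
  ~ VMOloc Zg.
Proof.
move=> g2 _ detA riesz zak vmo; have [mZ [_ Z2] _ qpZ] := zak.
pose F := quasiperiodize Zg.
have FZ := quasiperiodize_ae qpZ.
have mF := cmeasurable_quasiperiodize mZ.
have [q [lam [q0 lam_lattice lam_inj lam_int]]] := @lattice_representatives R A detA.
have [a a0 lower] := riesz_lower_bound g2 riesz zak mF (quasiperiodize_qp Zg) FZ lam_lattice lam_inj.
apply: (lower_bound_large_oscillation q0 lam_int mF (quasiperiodize_qp Zg) _ a0 lower).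
  apply: le_lt_trans Z2; rewrite /int_normc unit_squareE integral_cube_box.
  - rewrite !add0r le_eqVlt; apply/orP; left; apply/eqP; apply: nint_ae.
    + exact: measurable_box.
    + exact: measurable_normcX.
    + exact: measurable_normcX.
    + by move=> z; rewrite exprn_ge0// normc_ge0.
    + by move=> z; rewrite exprn_ge0// normc_ge0.
    + by apply: ae_mono FZ => z /= ->.
  - by apply/measurable_EFinP; exact: measurable_normcX.
  - by move=> z; rewrite lee_fin exprn_ge0// normc_ge0.
exact: VMOloc_oscillation vmo.
Qed.
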